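(* Let $k$ be an algebraically closed field of arbitrary characteristic and let $A \in M_n(k)$. Then there exist a semisimple element $S \in M_n(k)$ and an equipotent element $N \in M_n(k)$ such that: (1) the Zariski closure of $D(S)$ contains $D(A)$; (2) the Zariski closure of $D(A)$ contains $D(N)$; (3) the centralizers of $A$, $S$ and $N$ in $M_n(k)$ all have the same dimension; (4) for every $1 \le d < n$, the fixed point spaces $\mathcal{G}_d^A$, $\mathcal{G}_d^S$, $\mathcal{G}_d^N$ all have the same dimension.
   Context: $M_n(k)$ is the algebra of $n\times n$ matrices over $k$. For $A \in M_n(k)$, $D(A)$ denotes the set of all $B \in M_n(k)$ having the same Jordan canonical form as $A$ up to changing the eigenvalues, with the same number of distinct eigenvalues; that is, $B \in D(A)$ iff there is a bijection between the distinct eigenvalues of $A$ and those of $B$ such that corresponding eigenvalues have the same partition of Jordan block sizes in their generalized eigenspaces. A matrix is equipotent if it has a single eigenvalue. $\mathcal{G}_d$ is the Grassmannian of $d$-dimensional subspaces of $k^n$, and for $A \in M_n(k)$, $\mathcal{G}_d^A$ is the (closed) subvariety of $\mathcal{G}_d$ consisting of the subspaces $W$ with $AW \subseteq W$. *)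

(* Defs.v *)
From HB Require Import structures.
From mathcomp Require Import all_boot all_order all_algebra.
From mathcomp Require Import mpoly.
Set Implicit Arguments. Unset Strict Implicit. Unset Printing Implicit Defensive.
Import Order.TTheory GRing.Theory.
Local Open Scope ring_scope.

Section Defs.
Variable k : closedFieldType.

Section Topo.
Variable T : Type.
Variable closed : (T -> Prop) -> Prop.

Definition tclosure (X : T -> Prop) (x : T) : Prop :=
  forall C, closed C -> (forall y, X y -> C y) -> C x.

Definition tirreducible (Z : T -> Prop) : Prop :=
  (exists z, Z z) /\
  forall C1 C2, closed C1 -> closed C2 ->
    (forall z, Z z -> C1 z \/ C2 z) ->
    (forall z, Z z -> C1 z) \/ (forall z, Z z -> C2 z).

Definition rel_closed (Y Z : T -> Prop) : Prop :=
  exists C, closed C /\ forall x, Z x <-> (Y x /\ C x).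

Definition has_chain (Y : T -> Prop) (m : nat) : Prop :=
  exists Zs : nat -> T -> Prop,
    (forall i, (i <= m)%N -> rel_closed Y (Zs i) /\ tirreducible (Zs i)) /\
    (forall i, (i < m)%N ->
       (forall x, Zs i x -> Zs i.+1 x) /\ exists x, Zs i.+1 x /\ ~ Zs i x).

Definition krull_dim (Y : T -> Prop) (m : nat) : Prop :=
  has_chain Y m /\ forall m', has_chain Y m' -> (m' <= m)%N.
End Topo.

Definition mx_closed (n : nat) (C : 'M[k]_n -> Prop) : Prop :=
  exists P : {mpoly k[n * n]} -> Prop,
    forall A : 'M[k]_n, C A <-> forall p, P p -> p.@[fun i => mxvec A 0 i] = 0.

(* ---------- Grassmannian G_d of d-dim subspaces of k^n ----------
   A subspace is represented by the canonical square matrix <<W>>%MS whose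
   row space is it (rows = coordinate vectors of the subspace). *)
Definition grass (n d : nat) (W : 'M[k]_n) : Prop :=
  (<<W>>%MS = W) /\ \rank W = d.

Definition plucker (n d : nat) (B : 'M[k]_(d, n)) :
    'I_#|{ffun 'I_d -> 'I_n}| -> k :=
  fun i => \det (colsub (enum_val i) B).

Definition grass_closed (n d : nat) (C : 'M[k]_n -> Prop) : Prop :=
  exists P : {mpoly k[#|{ffun 'I_d -> 'I_n}|]} -> Prop,
    forall W : 'M[k]_n, C W <->
      (@grass n d W /\
       forall B : 'M[k]_(d, n), (B == W)%MS ->
         forall p, P p -> p.@[@plucker n d B] = 0).

(* G_d^A : d-dimensional subspaces W of k^n (column vectors) with A W <= W;
   in row-vector form v |-> v A^T. *)
Definition grass_fix (n d : nat) (A : 'M[k]_n) (W : 'M[k]_n) : Prop :=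
  @grass n d W /\ (W *m A^T <= W)%MS.

(* Jordan matrix with diagonal lam and superdiagonal entries 1 exactly
   where e i holds (blocks = maximal runs linked by e). *)
Definition jordan_mx (n : nat) (lam : 'I_n -> k) (e : 'I_n -> bool) : 'M[k]_n :=
  \matrix_(i, j) (if i == j then lam i
                  else if ((j : nat) == i.+1) && e i then 1 else 0).

Definition jordan_data (n : nat) (lam : 'I_n -> k) (e : 'I_n -> bool) : Prop :=
  forall i j : 'I_n, (j : nat) = i.+1 -> e i -> lam i = lam j.

Definition similar (n : nat) (A B : 'M[k]_n) : Prop :=
  exists P : 'M[k]_n, P \in unitmx /\ A = invmx P *m B *m P.

(* B \in D(A): B has the Jordan form of A with eigenvalues relabelled
   bijectively (sigma injective on the eigenvalues of A). *)
Definition Dset (n : nat) (A : 'M[k]_n) (B : 'M[k]_n) : Prop :=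
  exists (lam : 'I_n -> k) (e : 'I_n -> bool),
    jordan_data lam e /\ similar A (jordan_mx lam e) /\
    exists sigma : k -> k,
      (forall i j, sigma (lam i) = sigma (lam j) -> lam i = lam j) /\
      similar B (jordan_mx (fun i => sigma (lam i)) e).

(* semisimple = diagonalizable (k algebraically closed) *)
Definition semisimple (n : nat) (S : 'M[k]_n) : Prop :=
  exists (P : 'M[k]_n) (d : 'rV[k]_n), P \in unitmx /\ S = invmx P *m diag_mx d *m P.

Definition equipotent (n : nat) (N : 'M[k]_n) : Prop :=
  exists mu : k, forall a : k, eigenvalue N a -> a = mu.

Definition cent_dim (n : nat) (A : 'M[k]_n) : nat :=
  \dim (lker (linfun (fun B : 'M[k]_n => A *m B - B *m A))).

End Defs.
Arguments grass_fix {k n} d A W.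

(* Main.v *)
(* Write lambda for the partition obtained by adding, row by row, the partitions
   attached to the eigenvalues of A.  In a suitable basis A^T is a matrix X_t
   which has the nilpotent Jordan form of type lambda off the diagonal and the
   same diagonal entry t_m throughout the m-th column of the Young diagram of
   lambda.  Constant t gives (the transpose of) N, injective t gives S, so it is
   enough to see that the quantities of (3) and (4) depend on the column lengths
   a_m only, and that the closures come from moving t along a line.

   (3) A matrix commuting with X_t is determined by its rows at the first boxes of
   the rows of the diagram, which range over kernels whose dimensions do not
   depend on t.

   (4) Let V_m be spanned by the columns of index >= m, so that X_t - t_m maps V_m
   onto V_(m+1) with an a_m-dimensional kernel.  For a stable W the space
   W :&: V_m lies between W' = W :&: V_(m+1) and the preimage of W' in V_m, which
   exceeds W' by a_m dimensions.  So the fixed points are covered by finitely many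
   polynomial images of affine spaces of dimension sum f_m (a_m - f_m), where
   f_m <= a_m and sum f_m = d.  Conversely, the maximum of this expression is
   attained with a_m - f_m nonincreasing, and then the corresponding cell can be
   written in reduced echelon form with free entries.

   The Krull dimension is bounded above without dimension theory: on the cone over
   a set covered by polynomial images of k^m, at most C (r + 1)^(m + 1) polynomials
   of degree <= r are linearly independent, and the exponent drops by one on each
   proper closed subset of an irreducible set. *)
Require Import Defs.
From HB Require Import structures.
From mathcomp Require Import all_boot all_order all_algebra.
From mathcomp Require Import mpoly.
From mathcomp Require Import fingroup perm zify.
From Stdlib Require Import Classical_Prop.
Set Implicit Arguments. Unset Strict Implicit. Unset Printing Implicit Defensive.
Import GRing.Theory.
Local Open Scope ring_scope.

(** * Polynomial functions and growth of coordinate rings *)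

(** [Dset] is phrased with the classical Jordan form, whereas the rows of X_t mix eigenvalues, so
    the two forms have to be matched box by box. A box of X_t in column m corresponds to a box of
    the partition attached to t_m, in the column numbered by the earlier occurrences of t_m in t;
    ranks of powers of A - a count the boxes with a given label on both sides. Since these labels
    distinguish the columns of lambda, a generic perturbation of the eigenvalues by the positions
    has exactly these columns as eigenvalue classes. In (4) the difficulty is that stability of a
    subspace in reduced form is a quadratic condition on its entries. At a pivot in column m it
    involves only the rows of pivots in later columns, so it can be solved by polynomials in the
    free entries. *)

Section PolyFun.
Variable k : closedFieldType.

(* A vanishing p makes p + 1 rootless, hence constant. *)
Lemma poly_fun0 (p : {poly k}) : (forall s, p.[s] = 0) -> p = 0.
Proof.
move=> p0; have : ~~ (size (p + 1) != 1).
  apply/negP => /closed_rootP [x]; rewrite /root hornerD hornerC p0 add0r.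
  by rewrite oner_eq0.
rewrite negbK => /size_poly1P [c _ pc].
have {pc} pc : p = (c - 1)%:P by rewrite polyCB -pc addrK.
by have := p0 0; rewrite pc hornerC => ->.
Qed.

Definition upoly (f : k -> k) := exists q : {poly k}, forall s, f s = q.[s].

Lemma upoly_ext f g : f =1 g -> upoly f -> upoly g.
Proof. by move=> fg [q qE]; exists q => s; rewrite -fg. Qed.

Lemma upolyC c : upoly (fun=> c).
Proof. by exists c%:P => s; rewrite hornerC. Qed.

Lemma upolyX : upoly id.
Proof. by exists 'X => s; rewrite hornerX. Qed.

Lemma upolyD f g : upoly f -> upoly g -> upoly (fun s => f s + g s).
Proof. by move=> [p pE] [q qE]; exists (p + q) => s; rewrite hornerD pE qE. Qed.

Lemma upolyM f g : upoly f -> upoly g -> upoly (fun s => f s * g s).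
Proof. by move=> [p pE] [q qE]; exists (p * q) => s; rewrite hornerM pE qE. Qed.

Lemma upoly_sum (I : Type) (r : seq I) (F : I -> k -> k) :
  (forall i, upoly (F i)) -> upoly (fun s => \sum_(i <- r) F i s).
Proof.
move=> FE; elim: r => [|i r IH].
  by apply: upoly_ext (upolyC 0) => s; rewrite big_nil.
by apply: upoly_ext (upolyD (FE i) IH) => s; rewrite big_cons.
Qed.

Lemma upoly_prod (I : Type) (r : seq I) (F : I -> k -> k) :
  (forall i, upoly (F i)) -> upoly (fun s => \prod_(i <- r) F i s).
Proof.
move=> FE; elim: r => [|i r IH].
  by apply: upoly_ext (upolyC 1) => s; rewrite big_nil.
by apply: upoly_ext (upolyM (FE i) IH) => s; rewrite big_cons.
Qed.

Lemma upoly_exp f m : upoly f -> upoly (fun s => f s ^+ m).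
Proof.
move=> fE; elim: m => [|m IH]; first exact: upoly_ext (upolyC 1).
by apply: upoly_ext (upolyM fE IH) => s; rewrite exprS.
Qed.

Lemma upoly_meval M (p : {mpoly k[M]}) (F : 'I_M -> k -> k) :
  (forall i, upoly (F i)) -> upoly (fun s => p.@[fun i => F i s]).
Proof.
move=> FE; apply: (@upoly_ext (fun s => \sum_(m <- msupp p) p@_m * \prod_(i < M) F i s ^+ m i)).
  by move=> s; rewrite mevalE.
apply: upoly_sum => m; apply: upolyM; first exact: upolyC.
by apply: upoly_prod => i; apply: upoly_exp.
Qed.

Lemma upoly_mulmx m n p (A : k -> 'M[k]_(m, n)) (B : k -> 'M[k]_(n, p)) :
  (forall i j, upoly (fun s => A s i j)) -> (forall i j, upoly (fun s => B s i j)) ->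
  forall i j, upoly (fun s => (A s *m B s) i j).
Proof.
move=> AE BE i j; apply: (@upoly_ext (fun s => \sum_l A s i l * B s l j)).
  by move=> s; rewrite mxE.
by apply: upoly_sum => l; apply: upolyM.
Qed.

Lemma upoly_det d (A : k -> 'M[k]_d) :
  (forall i j, upoly (fun s => A s i j)) -> upoly (fun s => \det (A s)).
Proof.
move=> AE; rewrite /determinant; apply: upoly_sum => s; apply: upolyM.
  exact: upolyC.
by apply: upoly_prod => i.
Qed.

Lemma msizeM_leq m (p q : {mpoly k[m]}) :
  (msize (p * q) <= (msize p + msize q).-1)%N.
Proof.
have [->|p0] := eqVneq p 0; first by rewrite mul0r mmeasure0.
have [->|q0] := eqVneq q 0; first by rewrite mulr0 mmeasure0.
by rewrite msizeM.
Qed.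

(** [msize] exceeds the degree by one, so this is degree at most [D]. Functions stand in for
    polynomials so that matrix expressions can be handled pointwise. *)
Definition pdeg m D (f : 'rV[k]_m -> k) :=
  exists q : {mpoly k[m]}, (msize q <= D.+1)%N /\ forall y, f y = q.@[fun i => y 0 i].

Definition pfun m (f : 'rV[k]_m -> k) := exists D, pdeg D f.

Section Closure.
Variable m : nat.
Implicit Types f g : 'rV[k]_m -> k.

Lemma pdeg_ext D f g : f =1 g -> pdeg D f -> pdeg D g.
Proof. by move=> fg [q [qs qE]]; exists q; split=> // y; rewrite -fg. Qed.

Lemma pdegW D D' f : (D <= D')%N -> pdeg D f -> pdeg D' f.
Proof. by move=> le [q [qs qE]]; exists q; split=> //; apply: leq_trans qs _. Qed.

Lemma pdegC D c : pdeg D (fun _ : 'rV[k]_m => c).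
Proof.
exists c%:MP; split; last by move=> y; rewrite mevalC.
by rewrite mmeasureC; case: (c != 0).
Qed.

Lemma pdegX i : pdeg 1 (fun y : 'rV[k]_m => y 0 i).
Proof. by exists 'X_i; split=> [|y]; rewrite ?mevalXU // msizeX mdeg1. Qed.

Lemma pdegD D f g : pdeg D f -> pdeg D g -> pdeg D (fun s => f s + g s).
Proof.
move=> [p [ps pE]] [q [qs qE]]; exists (p + q); split=> [|s].
  by apply: leq_trans (mmeasureD_le _ _ _) _; rewrite geq_max ps.
by rewrite mevalD pE qE.
Qed.

Lemma pdegM D D' f g : pdeg D f -> pdeg D' g -> pdeg (D + D') (fun s => f s * g s).
Proof.
move=> [p [ps pE]] [q [qs qE]]; exists (p * q); split=> [|s].
  by have := msizeM_leq p q; lia.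
by rewrite mevalM pE qE.
Qed.

Lemma pdeg_sum D (I : eqType) (r : seq I) (F : I -> 'rV[k]_m -> k) :
  (forall i, i \in r -> pdeg D (F i)) -> pdeg D (fun s => \sum_(i <- r) F i s).
Proof.
elim: r => [|i r IH] FE.
  by apply: pdeg_ext (pdegC D 0) => s; rewrite big_nil.
apply: (@pdeg_ext _ (fun s => F i s + \sum_(j <- r) F j s)).
  by move=> s; rewrite big_cons.
apply: pdegD; first by apply: FE; rewrite mem_head.
by apply: IH => j jr; apply: FE; rewrite inE jr orbT.
Qed.

Lemma pdeg_exp D f r : pdeg D f -> pdeg (D * r) (fun s => f s ^+ r).
Proof.
move=> fE; elim: r => [|r IH]; first exact: pdeg_ext (pdegC _ 1).
by rewrite mulnS; apply: pdeg_ext (pdegM fE IH) => s; rewrite exprS.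
Qed.

Lemma pdeg_prod (I : Type) (r : seq I) (D : I -> nat) (F : I -> 'rV[k]_m -> k) :
  (forall i, pdeg (D i) (F i)) ->
  pdeg (\sum_(i <- r) D i) (fun s => \prod_(i <- r) F i s).
Proof.
move=> FE; elim: r => [|i r IH].
  by rewrite big_nil; apply: pdeg_ext (pdegC _ 1) => s; rewrite big_nil.
by rewrite big_cons; apply: pdeg_ext (pdegM (FE i) IH) => s; rewrite big_cons.
Qed.

Lemma pdeg_meval M D r (p : {mpoly k[M]}) (F : 'rV[k]_m -> 'I_M -> k) :
  (forall i, pdeg D (fun y => F y i)) -> (msize p <= r.+1)%N ->
  pdeg (D * r) (fun y => p.@[F y]).
Proof.
move=> FE pr.
apply: (@pdeg_ext _ (fun s => \sum_(a <- msupp p) p@_a * \prod_(i < M) F s i ^+ a i)).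
  by move=> s; rewrite mevalE.
apply: pdeg_sum => a ap.
have aD : pdeg (D * mdeg a) (fun s => \prod_(i < M) F s i ^+ a i).
  rewrite mdegE big_distrr /=.
  exact: (pdeg_prod _ (F := fun i s => F s i ^+ a i) (fun i => pdeg_exp (a i) (FE i))).
apply: (@pdegW (0 + D * mdeg a)); last by apply: pdegM => //; apply: pdegC.
rewrite add0n leq_mul2l -ltnS (leq_trans _ pr) ?orbT //.
exact: msize_mdeg_lt.
Qed.

Lemma pfun_ext f g : f =1 g -> pfun f -> pfun g.
Proof. by move=> fg [D /(pdeg_ext fg) fD]; exists D. Qed.

Lemma pfunC c : pfun (fun _ : 'rV[k]_m => c).
Proof. by exists 0%N; apply: pdegC. Qed.

Lemma pfunX i : pfun (fun y : 'rV[k]_m => y 0 i).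
Proof. by exists 1%N; apply: pdegX. Qed.

Lemma pfunD f g : pfun f -> pfun g -> pfun (fun s => f s + g s).
Proof.
move=> [D fD] [D' gD]; exists (maxn D D').
by apply: pdegD; [apply: pdegW fD|apply: pdegW gD]; rewrite ?leq_maxl ?leq_maxr.
Qed.

Lemma pfunM f g : pfun f -> pfun g -> pfun (fun s => f s * g s).
Proof. by move=> [D fD] [D' gD]; exists (D + D')%N; apply: pdegM. Qed.

Lemma pfun_sum (I : Type) (r : seq I) (F : I -> 'rV[k]_m -> k) :
  (forall i, pfun (F i)) -> pfun (fun s => \sum_(i <- r) F i s).
Proof.
move=> FE; elim: r => [|i r IH].
  by apply: pfun_ext (pfunC 0) => s; rewrite big_nil.
by apply: pfun_ext (pfunD (FE i) IH) => s; rewrite big_cons.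
Qed.

Lemma pfun_prod (I : Type) (r : seq I) (F : I -> 'rV[k]_m -> k) :
  (forall i, pfun (F i)) -> pfun (fun s => \prod_(i <- r) F i s).
Proof.
move=> FE; elim: r => [|i r IH].
  by apply: pfun_ext (pfunC 1) => s; rewrite big_nil.
by apply: pfun_ext (pfunM (FE i) IH) => s; rewrite big_cons.
Qed.

Lemma pfun_line f (y v : 'rV[k]_m) : pfun f -> upoly (fun s => f (y + s *: v)).
Proof.
move=> [D [q [_ qE]]].
apply: (@upoly_ext (fun s => q.@[fun i => (y + s *: v) 0 i])); first by move=> s; rewrite -qE.
apply: upoly_meval => i; apply: (@upoly_ext (fun s => y 0 i + s * v 0 i)).
  by move=> s; rewrite !mxE.
by apply: upolyD; [apply: upolyC|apply: upolyM; [apply: upolyX|apply: upolyC]].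
Qed.

Definition pmx a b (F : 'rV[k]_m -> 'M[k]_(a, b)) := forall i j, pfun (fun y => F y i j).

Lemma pmxC a b (A : 'M[k]_(a, b)) : pmx (fun=> A).
Proof. by move=> i j; apply: pfunC. Qed.

Lemma pmxD a b (F G : 'rV[k]_m -> 'M[k]_(a, b)) :
  pmx F -> pmx G -> pmx (fun y => F y + G y).
Proof. by move=> FE GE i j; apply: pfun_ext (pfunD (FE i j) (GE i j)) => y; rewrite mxE. Qed.

Lemma pmxN a b (F : 'rV[k]_m -> 'M[k]_(a, b)) : pmx F -> pmx (fun y => - F y).
Proof.
move=> FE i j; apply: pfun_ext (pfunM (pfunC (-1)) (FE i j)) => y.
by rewrite mxE mulN1r.
Qed.

Lemma pmxM a b c (F : 'rV[k]_m -> 'M[k]_(a, b)) (G : 'rV[k]_m -> 'M[k]_(b, c)) :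
  pmx F -> pmx G -> pmx (fun y => F y *m G y).
Proof.
move=> FE GE i j; apply: (@pfun_ext (fun s => \sum_l F s i l * G s l j)).
  by move=> s; rewrite mxE.
by apply: pfun_sum => l; apply: pfunM.
Qed.

Lemma pmx_rowsub a b c (h : 'I_c -> 'I_a) (F : 'rV[k]_m -> 'M[k]_(a, b)) :
  pmx F -> pmx (fun y => rowsub h (F y)).
Proof. by move=> FE i j; apply: pfun_ext (FE (h i) j) => y; rewrite mxE. Qed.

Lemma pmx_col a b c (F : 'rV[k]_m -> 'M[k]_(a, c)) (G : 'rV[k]_m -> 'M[k]_(b, c)) :
  pmx F -> pmx G -> pmx (fun y => col_mx (F y) (G y)).
Proof.
move=> FE GE i j; rewrite -(splitK i); case: (split i) => l /=.
  by apply: pfun_ext (FE l j) => y; rewrite col_mxEu.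
by apply: pfun_ext (GE l j) => y; rewrite col_mxEd.
Qed.

Lemma pfun_det d (F : 'rV[k]_m -> 'M[k]_d) : pmx F -> pfun (fun y => \det (F y)).
Proof.
move=> FE; rewrite /determinant; apply: pfun_sum => s; apply: pfunM.
  exact: pfunC.
by apply: pfun_prod => i.
Qed.

End Closure.

Lemma pfun_comp m m' (f : 'rV[k]_m -> k) (h : 'rV[k]_m' -> 'rV[k]_m) :
  pfun f -> pmx h -> pfun (fun y => f (h y)).
Proof.
move=> [D [q [_ qE]]] hE.
apply: (@pfun_ext _ (fun y => \sum_(a <- msupp q) q@_a * \prod_(i < m) h y 0 i ^+ a i)).
  by move=> y; rewrite qE mevalE.
apply: pfun_sum => a; apply: pfunM; first exact: pfunC.
apply: pfun_prod => i; have [E hi] := hE 0 i.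
by exists (E * a i)%N; apply: pdeg_exp.
Qed.

Lemma pfun_bound m (I : finType) (F : I -> 'rV[k]_m -> k) :
  (forall i, pfun (F i)) -> exists D, forall i, pdeg D (F i).
Proof.
move=> FE; have [D DE] := fin_all_exists FE.
exists (\max_i D i)%N => i; apply: pdegW (DE i).
exact: leq_bigmax.
Qed.

End PolyFun.

Section Growth.
Variables (k : closedFieldType) (M : nat) (T : Type) (ev : T -> 'I_M -> k).
Implicit Type Z : T -> Prop.

Definition vanish Z (p : {mpoly k[M]}) := forall z, Z z -> p.@[ev z] = 0.

Definition indep Z (I : finType) (p : I -> {mpoly k[M]}) :=
  forall c : I -> k, vanish Z (\sum_i c i *: p i) -> forall i, c i = 0.

(** A bound on the Hilbert function of the coordinate ring of [Z]: a family independent modulo the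
    vanishing ideal stands for a subspace of the quotient. *)
Definition growth Z m := exists C : nat, forall r (I : finType) (p : I -> {mpoly k[M]}),
  (forall i, msize (p i) <= r.+1)%N -> indep Z p -> (#|I| <= C * r.+1 ^ m)%N.

Definition prime_on Z := forall f g, vanish Z (f * g) -> vanish Z f \/ vanish Z g.

(* If the p_i are independent on Z and f vanishes on Z but is no zero divisor
   on Z', then the f^j p_i with j <= r are independent on Z'. *)
Lemma growth_drop Z Z' f m : (forall z, Z z -> Z' z) -> prime_on Z' ->
  vanish Z f -> ~ vanish Z' f -> growth Z' m.+1 -> growth Z m.
Proof.
move=> sZ prZ fZ fZ' [C gC]; set D := msize f.
exists (C * D.+2 ^ m.+1)%N => r I p pr ip.
pose q (x : I * 'I_r.+1) := f ^+ x.2 * p x.1.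
have fX j : (msize (f ^+ j) <= (D * j).+1)%N.
  elim: j => [|j IH]; first by rewrite expr0 msize1.
  rewrite exprS; have := msizeM_leq f (f ^+ j); rewrite -/D; move: IH.
  by rewrite mulnS; lia.
have qr x : (msize (q x) <= (D * r + r + 1).+1)%N.
  rewrite /q; have := msizeM_leq (f ^+ x.2) (p x.1).
  have := fX x.2; have := pr x.1.
  have : (D * x.2 <= D * r)%N by rewrite leq_mul2l -ltnS ltn_ord orbT.
  by lia.
have iq : indep Z' q.
  move=> c cv.
  pose Q j : {mpoly k[M]} := \sum_i c (i, j) *: p i.
  have cE : \sum_x c x *: q x = \sum_(j < r.+1) f ^+ j * Q j.
    rewrite (eq_bigr (fun x : I * 'I_r.+1 => f ^+ x.2 * (c (x.1, x.2) *: p x.1))); last first.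
      by move=> [i j] _; rewrite /q /= scalerAr.
    rewrite -(pair_big xpredT xpredT (fun i (j : 'I_r.+1) => f ^+ j * (c (i, j) *: p i))) /= exchange_big /=.
    by apply: eq_bigr => j _; rewrite mulr_sumr.
  (* On [Z], where [f] vanishes, only the term of index 0 remains, and independence makes it zero as
     a polynomial. Primality on [Z'], where [f] does not vanish identically, then cancels one factor
     [f]. *)
  have Q0 : forall s (G : nat -> {mpoly k[M]}),
      (forall j, (j < s)%N -> exists d : I -> k, G j = \sum_i d i *: p i) ->
      vanish Z' (\sum_(j < s) f ^+ j * G j) -> forall j, (j < s)%N -> vanish Z (G j).
    elim=> [|s IHs] G Gs; first by [].
    rewrite big_ord_recl expr0 mul1r => v.
    have v' : vanish Z' (G 0 + f * \sum_(j < s) f ^+ j * G j.+1).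
      move=> z zZ; rewrite -[RHS](v z zZ); congr (_ .@[_]); congr (_ + _).
      rewrite mulr_sumr; apply: eq_bigr => j _.
      by rewrite mulrA -exprS.
    have G0 : vanish Z (G 0).
      move=> z zZ; have := v' z (sZ z zZ); rewrite mevalD mevalM (fZ z zZ).
      by rewrite mul0r addr0.
    have [d dE] := Gs 0 (ltn0Sn _).
    have d0 : forall i, d i = 0 by apply: ip; rewrite -dE.
    have G00 : G 0 = 0 by rewrite dE big1 // => i _; rewrite d0 scale0r.
    case=> [//|j] js; apply: (IHs (fun j => G j.+1)) => //.
      by move=> l ls; apply: Gs.
    by move: v'; rewrite G00 add0r => /prZ [].
  case=> i j.
  pose G l := if insub l is Some l' then Q l' else 0.
  have GE (l : 'I_r.+1) : G l = Q l by rewrite /G valK.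
  have : vanish Z (Q j).
    rewrite -GE; apply: (Q0 r.+1 G) => //.
      by move=> l lr; exists (fun i => c (i, Ordinal lr)); rewrite -[l]/(val (Ordinal lr)) GE.
    rewrite (eq_bigr (fun j : 'I__ => f ^+ j * Q j)) -?cE // => l _.
    by rewrite GE.
  by move/ip/(_ i).
(* There are [#|I| * r.+1] products, of degree linear in [r]; dividing by [r.+1] is what lowers the
   exponent. *)
have := gC _ _ q qr iq; rewrite card_prod card_ord => h.
rewrite -(@leq_pmul2r r.+1) //; apply: leq_trans h _.
rewrite -!mulnA leq_mul2l; apply/orP; right.
rewrite -expnSr -expnMn leq_exp2r //.
by rewrite addn1 mulnS !mulSn; lia.
Qed.

(** Composed with a chart, a polynomial of degree at most [r] becomes one of degree at most [D * r]
    in [m] variables. More polynomials than there are coefficients in all charts together have a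
    nontrivial combination vanishing on every chart. *)
Lemma growth_param Z m (I : finType) (F : I -> 'rV[k]_m -> 'I_M -> k) :
  (forall i j, pfun (fun y => F i y j)) ->
  (forall z, Z z -> exists i y, ev z =1 F i y) -> growth Z m.
Proof.
move=> FE cov.
have [D DE] : exists D, forall x : I * 'I_M, pdeg D (fun y => F x.1 y x.2).
  by apply: pfun_bound => x; apply: FE.
exists (#|I| * D.+1 ^ m)%N => r J p pr ip; rewrite leqNgt; apply/negP => lt.
have qE (x : I * J) : exists q : {mpoly k[m]}, (msize q <= (D * r).+1)%N /\
    forall y, (p x.2).@[F x.1 y] = q.@[fun i => y 0 i].
  by apply: pdeg_meval => // i; apply: (DE (x.1, i)).
have {qE} [q qE] := fin_all_exists qE.
(* Exponents are bounded one variable at a time: a cruder count than by total degree, with the same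
   power of [r]. *)
pose S := {ffun 'I_m -> 'I_(D * r).+1}.
pose mon (a : S) : 'X_{1..m} := [multinom (a i : nat) | i < m].
pose A := \matrix_(j < #|J|, t < #|{: I * S}|)
  (q ((enum_val t).1, enum_val j))@_(mon (enum_val t).2).
have : \rank (kermx A) != 0%N.
  rewrite mxrank_ker subn_eq0 -ltnNge; apply: leq_ltn_trans (rank_leq_col _) _.
  rewrite card_prod card_ffun !card_ord; apply: leq_ltn_trans lt.
  rewrite -mulnA leq_mul2l -expnMn; apply/orP; right.
  case: (m) => [|m'] //; rewrite leq_exp2r //.
  by rewrite mulSn mulnS; lia.
rewrite mxrank_eq0 => /rowV0Pn [c /sub_kermxP cA c0].
case/negP: c0; apply/eqP/rowP => j; rewrite mxE.
have := ip (fun j => c 0 (enum_rank j)) _ (enum_val j); rewrite enum_valK; apply.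
move=> z zZ; have [i [y zE]] := cov z zZ.
rewrite (meval_eq _ zE).
have s0 : \sum_j c 0 (enum_rank j) *: q (i, j) = 0.
  apply/mpolyP => a; rewrite mcoeff0 raddf_sum /=.
  have [ad|ad] := boolP [forall l : 'I_m, a l < (D * r).+1]%N; last first.
    apply: big1 => l _; rewrite mcoeffZ memN_msupp_eq0 ?mulr0 //.
    apply: msize_mdeg_ge; apply: leq_trans (qE (i, l)).1 _.
    move: ad; rewrite negb_forall => /existsP [u]; rewrite -leqNgt => ad.
    by apply: leq_trans ad _; rewrite mdegE (bigD1 u) //= leq_addr.
  pose b : S := [ffun l => inord (a l)].
  have bE : mon b = a.
    by apply/mnmP => l; rewrite mnmE ffunE inordK //; apply: (forallP ad).
  have := congr1 (fun v : 'rV_ _ => v 0 (enum_rank (i, b))) cA; rewrite !mxE => cE.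
  rewrite -[RHS]cE (reindex (@enum_val J J)) /=; last first.
    by exists enum_rank => ? _; rewrite ?enum_rankK ?enum_valK.
  by apply: eq_bigr => l _; rewrite !mxE enum_rankK bE enum_valK mcoeffZ.
have := congr1 (fun P => P.@[fun l => y 0 l]) s0; rewrite meval0 => <-.
rewrite !raddf_sum /=; apply: eq_bigr => l _.
by rewrite !mevalZ (qE (i, l)).2.
Qed.

End Growth.

(** * Chains of closed subsets of Grassmannians *)

Section Grass.
Variables (k : closedFieldType) (n d : nat).
Implicit Types (B : 'M[k]_(d, n)) (W : 'M[k]_n) (Y : 'M[k]_n -> Prop).

Lemma pluckerM (G : 'M[k]_d) B i : plucker (G *m B) i = \det G * plucker B i.
Proof.
rewrite /plucker -det_mulmx; congr (\det _); apply/matrixP => a b.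
by rewrite !mxE; apply: eq_bigr => l _; rewrite mxE.
Qed.

(* Cauchy-Binet, in the form where the sum runs over all maps. *)
Lemma plucker_mulr B (P : 'M[k]_n) (f : {ffun 'I_d -> 'I_n}) :
  plucker (B *m P) (enum_rank f) =
  \sum_(h : {ffun 'I_d -> 'I_n}) (\prod_i P (h i) (f i)) * plucker B (enum_rank h).
Proof.
rewrite /plucker enum_rankK -det_tr.
under eq_bigr => h _ do rewrite enum_rankK -det_tr /determinant mulr_sumr.
rewrite exchange_big; apply: eq_bigr => s _ /=.
transitivity ((-1) ^+ s * \prod_i \sum_u P u (f i) * B (s i) u :> k).
  congr (_ * _); apply: eq_bigr => i _; rewrite !mxE.
  by apply: eq_bigr => u _; rewrite mulrC.
rewrite bigA_distr_bigA mulr_sumr; apply: eq_bigr => h _.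
rewrite mulrCA -big_split /=; congr (_ * _); apply: eq_bigr => i _.
by rewrite !mxE.
Qed.

(** Expansion along row [i] leaves one term, the new entry times an identity minor. This is how the
    free entries of a reduced basis become Plucker coordinates. *)
Lemma plucker_replace B (g : 'I_d -> 'I_n) i u : colsub g B = 1%:M ->
  plucker B (enum_rank [ffun l => if l == i then u else g l]) = B i u.
Proof.
move=> gB; rewrite /plucker enum_rankK (expand_det_row _ i) (bigD1 i) //=.
have gE a b : B a (g b) = (a == b)%:R.
  by have := congr1 (fun A : 'M_ _ => A a b) gB; rewrite !mxE.
rewrite big1 ?addr0; last first.
  by move=> j /negbTE ji; rewrite !mxE ffunE ji gE eq_sym ji mul0r.
rewrite !mxE ffunE eqxx /cofactor -signr_odd addnn odd_double expr0 mul1r.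
rewrite (_ : row' i _ = 1%:M) ?det1 ?mulr1 //.
apply/matrixP => a b; rewrite !mxE ffunE eq_sym (negbTE (neq_lift _ _)) gE.
by rewrite (inj_eq lift_inj).
Qed.

Lemma basis_change B B' : \rank B = d -> (B == B')%MS ->
  exists2 G : 'M[k]_d, \det G != 0 & B = G *m B'.
Proof.
move=> rB /andP [/submxP [G GE] _]; exists G => //.
rewrite -unitfE -[_ \is a _]/(G \in unitmx) -row_full_unit /row_full.
rewrite eqn_leq rank_leq_row /= -{1}rB {1}GE.
by rewrite (leq_trans (mxrankM_maxl _ _)).
Qed.

Lemma basis_change2 B B' W : grass d W -> (B == W)%MS -> (B' == W)%MS ->
  exists2 G : 'M[k]_d, \det G != 0 & B = G *m B'.
Proof.
move=> [_ rW] /eqmxP BW /eqmxP B'W; apply: basis_change; first by rewrite BW.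
by apply/eqmxP; apply: eqmx_trans BW (eqmx_sym B'W).
Qed.

Lemma basis_mul (G : 'M[k]_d) B W : \det G != 0 -> (B == W)%MS -> (G *m B == W)%MS.
Proof.
move=> G0 /eqmxP BW; apply/eqmxP; apply: eqmx_trans BW.
by apply: eqmxMfull; rewrite row_full_unit unitmxE unitfE.
Qed.

Lemma plucker_neq0 B : \rank B = d -> exists i, plucker B i != 0.
Proof.
move=> rB.
have fB : row_full B^T by rewrite /row_full mxrank_tr rB.
exists (enum_rank [ffun i => fullrankfun fB i]).
rewrite /plucker enum_rankK -det_tr -unitfE -[_ \is a _]/(_ \in unitmx).
rewrite (_ : _^T = rowsub (fullrankfun fB) B^T) ?fullrowsub_unit //.
by apply/matrixP => a b; rewrite !mxE ffunE.
Qed.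

Lemma det_surj (c : k) : (0 < d)%N -> exists G : 'M[k]_d, \det G = c.
Proof.
case: (d) => // d' _.
exists (diag_mx (\row_i if i == 0 then c else 1)).
rewrite det_diag (bigD1 0) //= big1 ?mulr1 ?mxE // => i /negbTE i0.
by rewrite mxE i0.
Qed.

(** All bases of members of [Z]. Plucker coordinates are defined only up to a scalar, and the
    polynomials defining closed sets need not be homogeneous, so growth is measured on bases, at the
    price of one more parameter. *)
Definition cone (Z : 'M[k]_n -> Prop) B := exists2 W, Z W & (B == W)%MS.

Lemma upoly_cone (p : {mpoly k[#|{ffun 'I_d -> 'I_n}|]}) B :
  upoly (fun c => p.@[fun i => c * plucker B i]).
Proof.
by apply: upoly_meval => i; apply: upolyM; [apply: upolyX|apply: upolyC].
Qed.

Section Chain.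
Hypothesis d_gt0 : (0 < d)%N.

(** For positive [d] every scalar is a determinant, so a change of basis realises any nonzero
    multiple of the Plucker vector. *)
Lemma vanish_cone (Z : 'M[k]_n -> Prop) p W B c : Z W -> (B == W)%MS ->
  vanish (@plucker k n d) (cone Z) p -> c != 0 -> p.@[fun i => c * plucker B i] = 0.
Proof.
move=> ZW BW v c0; have [G Gc] := det_surj c d_gt0.
rewrite -[RHS](v (G *m B)); last first.
  by exists W => //; apply: basis_mul; rewrite ?Gc.
by apply: meval_eq => i; rewrite pluckerM Gc.
Qed.

(** On the line through the Plucker vector of [W] a product of two one-variable polynomials
    vanishes, so one factor does. Hence each [W] lies in one of the closed sets [C f] and [C g], and
    irreducibility selects the same one for all [W]. *)
Lemma prime_cone (Z : 'M[k]_n -> Prop) : (forall W, Z W -> grass d W) ->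
  (forall W, Z W -> exists B, (B == W)%MS) -> tirreducible (@grass_closed k n d) Z ->
  prime_on (@plucker k n d) (cone Z).
Proof.
move=> Zg Zb [_ irr] f g fg.
pose C h W := grass d W /\ forall B, (B == W)%MS -> forall p, p = h -> p.@[plucker B] = 0.
have Cc h : grass_closed d (C h) by exists (eq^~ h).
have sub h : (forall W, Z W -> C h W) -> vanish (@plucker k n d) (cone Z) h.
  by move=> ZC B [W /ZC [_ CW] BW]; apply: CW.
case: (irr (C f) (C g) (Cc f) (Cc g)) => [W ZW| |]; last 2 first.
- by left; apply: sub.
- by right; apply: sub.
have [B BW] := Zb W ZW.
have [u uE] := upoly_cone f B; have [v vE] := upoly_cone g B.
have uv : u * v * 'X = 0.
  apply: poly_fun0 => c; rewrite !hornerE.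
  have [->|c0] := eqVneq c 0; first by rewrite mulr0.
  by rewrite -uE -vE -mevalM (vanish_cone ZW BW fg c0) mul0r.
have key h w : (forall c, h.@[fun i => c * plucker B i] = w.[c]) -> w = 0 -> C h W.
  move=> wE w0; split; first exact: Zg.
  move=> B' BW' _ ->; have [G _ ->] := basis_change2 (Zg W ZW) BW' BW.
  rewrite (@meval_eq _ _ _ (fun i => \det G * plucker B i)) => [|i].
    by rewrite wE w0 horner0.
  exact: pluckerM.
move/eqP: uv; rewrite mulf_eq0 polyX_eq0 orbF mulf_eq0 => /orP [] /eqP z.
- by left; apply: key uE z.
- by right; apply: key vE z.
Qed.

(** The powers of a nonvanishing Plucker coordinate are independent already on the multiples of one
    vector, so growth is at least linear. *)
Lemma cone_growth0 (Z : 'M[k]_n -> Prop) W B : Z W -> (B == W)%MS -> \rank B = d ->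
  ~ growth (@plucker k n d) (cone Z) 0.
Proof.
move=> ZW BW rB [C gC]; have [i0 pi0] := plucker_neq0 rB.
have := gC C 'I_C.+1 (fun j => 'X_i0 ^+ j).
rewrite card_ord muln1 ltnn => h; apply: notF; apply: h => [j|c cv j].
  by rewrite mpolyXn msizeX mdegMn mdeg1 mul1n; apply: ltn_ord.
pose w : {poly k} := \poly_(j < C.+1) (c (inord j) * plucker B i0 ^+ j).
have w0 : w * 'X = 0.
  apply: poly_fun0 => s; rewrite !hornerE.
  have [->|s0] := eqVneq s 0; first by rewrite mulr0.
  rewrite (_ : w.[s] = 0) ?mul0r // -(vanish_cone ZW BW cv s0) horner_poly raddf_sum /=.
  apply: eq_bigr => l _; rewrite mevalZ rmorphXn /= mevalXU inord_val exprMn.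
  by rewrite mulrA mulrAC.
have w00 : w = 0 by move/eqP: w0; rewrite mulf_eq0 polyX_eq0 orbF => /eqP.
have := congr1 (fun p : {poly k} => p`_j) w00; rewrite coef_poly ltn_ord coef0 inord_val.
by move/eqP; rewrite mulf_eq0 expf_eq0 (negbTE pi0) andbF orbF => /eqP.
Qed.

Lemma chain_le Y m (I : finType) (F : I -> 'rV[k]_m -> 'M[k]_(d, n)) L :
  (forall W, Y W -> grass d W) -> (forall i, pmx (F i)) ->
  (forall W, Y W -> exists i y, (F i y == W)%MS) ->
  has_chain (@grass_closed k n d) Y L -> (L <= m)%N.
Proof.
move=> Yg FE cov [Zs [Zcl Zlt]]; rewrite leqNgt; apply/negP => mL.
have ZY i W : (i <= L)%N -> Zs i W -> Y W.
  by move=> iL; have [[C [_ CE]] _] := Zcl i iL; case/CE.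
have Zb i W : (i <= L)%N -> Zs i W -> exists B, (B == W)%MS.
  by move=> iL /(ZY i W iL) /cov [j [y jy]]; exists (F j y).
(* The additional coordinate [y 0 0] carries the determinant that relates an arbitrary basis to the
   one given by the chart. *)
have gL : growth (@plucker k n d) (cone (Zs L)) m.+1.
  apply: (@growth_param _ _ _ _ _ _ I
    (fun i (y : 'rV[k]_(1 + m)) j => y 0 0 * plucker (F i (@rsubmx _ _ 1 m y)) j)).
  - move=> i j; apply: pfunM; first exact: pfunX.
    rewrite /plucker; apply: pfun_det => a b.
    apply: (@pfun_ext _ _ (fun y => F i (@rsubmx _ _ 1 m y) a (enum_val j b))).
      by move=> y; rewrite mxE.
    apply: (pfun_comp (f := fun y => F i y a (enum_val j b))); first exact: FE.
    by move=> u v; apply: pfun_ext (pfunX k (rshift 1 v)) => y; rewrite mxE ord1.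
  move=> B [W ZW BW]; have YW := ZY _ _ (leqnn L) ZW.
  have [i [y yW]] := cov W YW.
  have [G _ GE] := basis_change2 (Yg W YW) BW yW.
  exists i, (@row_mx _ _ 1 m (\det G)%:M y) => j.
  rewrite row_mxKr GE pluckerM; congr (_ * _).
  by rewrite -[X in row_mx _ _ _ X](lshift0 m 0) row_mxEl mxE.
have gI j : (j <= m.+1)%N -> growth (@plucker k n d) (cone (Zs (L - j)%N)) (m.+1 - j).
  elim: j => [|j IH] jm; first by rewrite !subn0.
  have jL : (j < L)%N by apply: leq_trans mL.
  have := IH (ltnW jm); rewrite -(subnSK jm) -(subnSK jL) => gj.
  have [sub [W [ZW nZW]]] := Zlt (L - j.+1)%N ltac:(lia).
  have le1 : ((L - j.+1).+1 <= L)%N by lia.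
  have [[C [[P CE] ZE]] _] := Zcl (L - j.+1)%N ltac:(lia).
  have YW := ZY _ _ le1 ZW.
  have nC : ~ C W by move=> CW; apply: nZW; apply/ZE.
  have [p Pp [B BW pB]] : exists2 p, P p & exists2 B, (B == W)%MS & p.@[plucker B] <> 0.
    apply: NNPP => h; apply: nC; apply/CE; split; first exact: Yg.
    move=> B BW p Pp; apply: NNPP => pB; apply: h; exists p => //.
    by exists B.
  apply: growth_drop gj; first by move=> B' [W' /sub ZW' BW']; exists W'.
  - apply: prime_cone => [W' /(ZY _ _ le1) /Yg // |W' /(Zb _ _ le1) //|].
    by case: (Zcl _ le1).
  - move=> B' [W' /ZE [_ /CE [_ CW]] BW']; apply: CW BW' _ Pp.
  - by move=> v; apply: pB; apply: v; exists W.
(* After [m.+1] drops the exponent is 0, while the set reached is still nonempty. *)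
have := gI m.+1 (leqnn _); rewrite subnn.
have leL : (L - m.+1 <= L)%N by exact: leq_subr.
have [_ [[W ZW] _]] := Zcl _ leL.
have [B BW] := Zb _ _ leL ZW; have [_ rW] := Yg W (ZY _ _ leL ZW).
by apply: (cone_growth0 ZW BW); rewrite (eqmxP BW).
Qed.

End Chain.

(** The chain consists of the closures in [Y] of the images of the coordinate subspaces where y_j =
    0 for j >= i. They are irreducible because two parameter points are joined by a line, on which a
    product of nonzero polynomials cannot vanish; they are distinct because each parameter is an
    entry of [F y], which Plucker coordinates detect. *)
Lemma chain_ge Y m (F : 'rV[k]_m -> 'M[k]_(d, n)) (P : 'M[k]_n) (g : 'I_d -> 'I_n) :
  pmx F -> P \in unitmx -> (forall y, colsub g (F y) = 1%:M) ->
  (forall j, exists i u, forall y, F y i u = y 0 j) ->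
  (forall y, Y (<<F y *m P>>%MS)) -> has_chain (@grass_closed k n d) Y m.
Proof.
move=> FE uP gF Fy FY.
have rF y : \rank (F y *m P) = d.
  rewrite mxrankMfree ?row_free_unit //; apply/eqP; rewrite eqn_leq rank_leq_row /=.
  rewrite -[X in (X <= _)%N](mxrank1 k d) -(gF y).
  have -> : colsub g (F y) = F y *m colsub g 1%:M by rewrite mulmx_colsub mulmx1.
  exact: mxrankM_maxl.
have Fg y : grass d <<F y *m P>>%MS by split; rewrite ?genmx_id ?genmxE.
have Fb y : (F y *m P == <<F y *m P>>)%MS by apply/eqmxP/eqmx_sym/genmxE.
pose A i (y : 'rV[k]_m) := forall j : 'I_m, (i <= j)%N -> y 0 j = 0.
pose I i p := forall y, A i y -> forall B, (B == <<F y *m P>>)%MS -> p.@[plucker B] = 0.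
pose C i W := grass d W /\ forall B, (B == W)%MS -> forall p, I i p -> p.@[plucker B] = 0.
have Cc i : grass_closed d (C i) by exists (I i).
have CF i y : A i y -> C i <<F y *m P>>%MS.
  by move=> Ay; split=> // B BF p Ip; apply: Ip BF.
exists (fun i W => Y W /\ C i W); split=> [i _|i im].
  split; first by exists (C i).
  split; first by exists <<F 0 *m P>>%MS; split=> //; apply: CF => j; rewrite mxE.
  move=> C1 C2 cl1 cl2 cov.
  have sub C' : grass_closed d C' -> (forall y, A i y -> C' <<F y *m P>>%MS) ->
      forall W, Y W /\ C i W -> C' W.
    move=> [Q QE] AC W [YW [gW CW]]; apply/QE; split=> // B BW p Qp.
    by apply: CW => // y Ay B' B'y; have /QE [_ ] := AC y Ay; apply.
  have [a1|n1] := classic (forall y, A i y -> C1 <<F y *m P>>%MS); first by left; apply: sub.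
  have [a2|n2] := classic (forall y, A i y -> C2 <<F y *m P>>%MS); first by right; apply: sub.
  (* A basis at which [C'] fails differs from [F y *m P] by a matrix of determinant [c]; with [c]
     fixed, [p] becomes a polynomial function of the parameters. *)
  have wit C' : grass_closed d C' -> ~ (forall y, A i y -> C' <<F y *m P>>%MS) ->
      exists y c p, [/\ A i y, p.@[fun j => c * plucker (F y *m P) j] <> 0 &
        forall y', C' <<F y' *m P>>%MS -> p.@[fun j => c * plucker (F y' *m P) j] = 0].
    move=> [Q QE] h; apply: NNPP => h'; apply: h => y Ay; apply/QE; split=> // B By p Qp.
    apply: NNPP => pB; apply: h'; have [G G0 GE] := basis_change2 (Fg y) By (Fb y).
    exists y, (\det G), p; split=> // [|y' /QE [_ h]].
      by move=> z; apply: pB; rewrite -{}z GE; apply: meval_eq => j; rewrite pluckerM.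
    rewrite -[RHS](h (G *m (F y' *m P)) _ p Qp); last exact: basis_mul.
    by apply: meval_eq => j; rewrite pluckerM.
  have [y1 [c1 [p1 [Ay1 p1y z1]]]] := wit C1 cl1 n1.
  have [y2 [c2 [p2 [Ay2 p2y z2]]]] := wit C2 cl2 n2.
  pose l s : 'rV[k]_m := y1 + s *: (y2 - y1).
  have Al s : A i (l s) by move=> j ij; rewrite /l !mxE Ay1 ?Ay2 // subrr mulr0 addr0.
  have lp c (p : {mpoly k[_]}) : upoly (fun s => p.@[fun j => c * plucker (F (l s) *m P) j]).
    apply: upoly_meval => j; apply: upolyM; first exact: upolyC.
    rewrite /plucker; apply: upoly_det => a b.
    apply: (@upoly_ext _ (fun s => (F (l s) *m P) a (enum_val j b))).
      by move=> s; rewrite !mxE.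
    apply: (pfun_line (f := fun y => (F y *m P) a (enum_val j b))).
    by apply: pmxM => //; apply: pmxC.
  have [q1 q1E] := lp c1 p1; have [q2 q2E] := lp c2 p2.
  have : q1 * q2 = 0.
    apply: poly_fun0 => s; rewrite hornerM -q1E -q2E.
    have [/z1 -> | /z2 ->] := cov _ (conj (FY (l s)) (CF i (l s) (Al s))).
      by rewrite mul0r.
    by rewrite mulr0.
  move/eqP; rewrite mulf_eq0 => /orP [] /eqP z.
    by case: p1y; have := q1E 0; rewrite z horner0 /l scale0r addr0.
  by case: p2y; have := q2E 1; rewrite z horner0 /l scale1r addrC subrK.
split=> [W [YW [gW CW]]|].
  split=> //; split=> // B BW p Ip; apply: CW => // y Ay.
  by apply: Ip => j /ltnW; apply: Ay.
pose j0 := Ordinal im; have [a [u Fau]] := Fy j0.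
pose y0 : 'rV[k]_m := delta_mx 0 j0.
have A0 : A i.+1 y0.
  move=> j ij; rewrite mxE /= (_ : (j == j0) = false) ?andbF //.
  by apply/negbTE; rewrite -val_eqE /= neq_ltn ij orbT.
exists <<F y0 *m P>>%MS; split; first by split=> //; apply: CF.
case=> _ [_ h].
pose f : {ffun 'I_d -> 'I_n} := [ffun l => if l == a then u else g l].
(* A linear form in the Plucker coordinates of [F y *m P] that undoes [P] by Cauchy-Binet and
   returns [y 0 j0], up to the determinant of the change of basis. *)
pose p : {mpoly k[#|{ffun 'I_d -> 'I_n}|]} :=
  \sum_(h : {ffun 'I_d -> 'I_n}) (\prod_i invmx P (h i) (f i)) *: 'X_(enum_rank h).
have pE (G : 'M[k]_d) y : p.@[plucker (G *m (F y *m P))] = \det G * y 0 j0.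
  rewrite /p raddf_sum /=; under eq_bigr => h' _ do rewrite mevalZ mevalXU.
  rewrite -plucker_mulr mulmxA mulmxK // pluckerM plucker_replace ?gF //.
  by rewrite Fau.
have := h _ (Fb y0) p; rewrite -[F y0 *m P]mul1mx pE det1 mul1r mxE !eqxx /=.
have Ip : I i p.
  move=> y Ay B By; have [G _ ->] := basis_change2 (Fg y) By (Fb y).
  by rewrite pE (Ay j0) ?mulr0.
by move/(_ Ip)/eqP; rewrite oner_eq0.
Qed.

End Grass.

(** * Stable subspaces: the upper bound *)

Section Coordinate.
Variables (k : fieldType) (n : nat).

Definition dg (S : pred 'I_n) : 'M[k]_n := diag_mx (\row_i (S i)%:R).

Lemma mul_dg p (A : 'M[k]_(p, n)) S i j : (A *m dg S) i j = if S j then A i j else 0.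
Proof. by rewrite mul_mx_diag !mxE; case: (S j); rewrite ?mulr1 ?mulr0. Qed.

Lemma dg_mul p (A : 'M[k]_(n, p)) S i j : (dg S *m A) i j = if S i then A i j else 0.
Proof. by rewrite mul_diag_mx !mxE; case: (S i); rewrite ?mul1r ?mul0r. Qed.

Lemma sub_dgP p (A : 'M[k]_(p, n)) S :
  reflect (forall i j, ~~ S j -> A i j = 0) (A <= dg S)%MS.
Proof.
apply: (iffP idP) => [/submxP [B ->] i j Sj|A0]; first by rewrite mul_dg (negbTE Sj).
apply/submxP; exists A; apply/matrixP => i j; rewrite mul_dg.
by case: ifPn => // /A0.
Qed.

Lemma rank_dg S : \rank (dg S) = #|S|.
Proof.
pose f (i : 'I_#|S|) : 'I_n := enum_val i.
apply/eqP; rewrite eqn_leq; apply/andP; split.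
  have : (dg S <= rowsub f 1%:M)%MS.
    apply/row_subP => i; have [Si|Si] := boolP (S i); last first.
      rewrite (_ : row i _ = 0) ?sub0mx //; apply/rowP => j; rewrite !mxE (negbTE Si).
      by rewrite mul0rn.
    have Si' : i \in S by [].
    rewrite (_ : row i _ = row (enum_rank_in Si' i) (rowsub f 1%:M)) ?row_sub //.
    apply/rowP => j; rewrite !mxE Si /f enum_rankK_in //.
  by move/mxrankS/leq_trans; apply; rewrite rank_leq_row.
have : (rowsub f 1%:M <= dg S)%MS.
  apply/sub_dgP => i j Sj; rewrite !mxE; case: eqP => // fj.
  by have := enum_valP i; rewrite -/(f i) fj unfold_in (negbTE Sj).
move/mxrankS/(leq_trans _); apply.
have : row_free (rowsub f 1%:M : 'M[k]_(_, n)).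
  apply/row_freeP; exists (colsub f 1%:M); rewrite -mxsub_mul mulmx1.
  by apply/matrixP => i j; rewrite !mxE (inj_eq enum_val_inj).
by rewrite /row_free => /eqP ->.
Qed.

(** Multiplication by [cokermx W] is the quotient map modulo [W], so an inclusion of quotients lifts
    after adding [W]. *)
Lemma sub_cokermx p q (A : 'M[k]_(p, n)) (B : 'M[k]_(q, n)) r (W : 'M[k]_(r, n)) :
  (A *m cokermx W <= B *m cokermx W)%MS -> (A <= B + W)%MS.
Proof.
case/submxP => X XE; have : (A - X *m B <= W)%MS.
  by rewrite submxE mulmxBl -mulmxA -XE subrr.
move=> h; rewrite -[A](subrK (X *m B)) addmx_sub //.
  by apply: submx_trans h (addsmxSr _ _).
by apply: submx_trans (submxMl _ _) (addsmxSl _ _).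
Qed.

Lemma rank_cokermx p (A : 'M[k]_(p, n)) r (W : 'M[k]_(r, n)) : (W <= A)%MS ->
  (\rank (A *m cokermx W) + \rank W)%N = \rank A.
Proof.
move=> WA; rewrite -[RHS](mxrank_mul_ker A (cokermx W)); congr (_ + _)%N.
apply: eqmx_rank; apply/andP; split.
  by rewrite sub_capmx WA; apply/sub_kermxP; apply: mulmx_coker.
apply: (@submx_trans _ _ _ _ _ _ (kermx (cokermx W))); first exact: capmxSr.
by rewrite submxE mulmx_ker.
Qed.

Lemma sum_onth (I : Type) (V : zmodType) b (s : seq I) (F : I -> V) : (size s <= b)%N ->
  \sum_(j < b) (if onth s j is Some l then F l else 0) = \sum_(l <- s) F l.
Proof.
elim: b s => [|b IH] [|x s] // sb; rewrite ?big_nil ?big_ord0 //.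
  by rewrite big1 // => j _; case: (nat_of_ord j).
by rewrite big_ord_recl big_cons -(IH s) //.
Qed.

(** [None] gives a zero row, which pads a generating family shorter than its bound. *)
Definition orow p q (g : 'I_q -> option 'I_p) (A : 'M[k]_(p, n)) : 'M[k]_(q, n) :=
  \matrix_(i, j) if g i is Some u then A u j else 0.

(** Charts of the Grassmannian of a quotient: modulo [W'] the space [W] has dimension [b] inside a
    space of dimension at most [a], so once [b] pivot generators are chosen it is described by
    [b * (a - b)] coefficients on the remaining ones. The choice of generators is the finite
    datum. *)
Lemma between_chart N p (Y : 'M[k]_(N, n)) (W' : 'M[k]_(p, n)) (W : 'M[k]_n) b a :
  (W' <= W)%MS -> (W <= Y)%MS -> \rank W = (\rank W' + b)%N ->
  (\rank Y <= \rank W' + a)%N ->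
  exists (f : {ffun 'I_b -> 'I_N}) (g : {ffun 'I_(a - b) -> option 'I_N})
    (Z : 'M[k]_(b, a - b)), (col_mx W' (rowsub f Y + Z *m orow g Y) :=: W)%MS.
Proof.
move=> W'W WY rW rY; set C := cokermx W'.
have rWC : \rank (W *m C) = b by have := rank_cokermx W'W; rewrite rW -/C; lia.
have rYC : (\rank (Y *m C) <= a)%N.
  by have := rank_cokermx (submx_trans W'W WY); rewrite -/C; lia.
pose h := maxrankfun (Y *m C); pose rho := \rank (Y *m C).
have hE : (rowsub h (Y *m C) :=: Y *m C)%MS by apply: eq_maxrowsub.
move: rWC; pose R := row_base (W *m C); set b' := \rank (W *m C) in R * => rWC; subst b.
have RE : (R :=: W *m C)%MS := eq_row_base _.
have /submxP [Z0 Z0E] : (R <= rowsub h (Y *m C))%MS.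
  by rewrite hE RE; apply: submxMr.
have rZ0 : \rank Z0 = b'.
  have rR : \rank R = b' by rewrite RE.
  by apply/eqP; rewrite eqn_leq rank_leq_row /= -[X in (X <= _)%N]rR Z0E mxrankM_maxl.
have fZ : row_full Z0^T by rewrite /row_full mxrank_tr rZ0.
pose f0 := fullrankfun fZ.
have uZ : colsub f0 Z0 \in unitmx.
  by rewrite -unitmx_tr; have := fullrowsub_unit fZ; rewrite trmx_mxsub.
pose Z1 := invmx (colsub f0 Z0) *m Z0.
have Z1f i j : Z1 i (f0 j) = (i == j)%:R.
  have := mulVmx uZ; rewrite mulmx_colsub => /(congr1 (fun A : 'M_ _ => A i j)).
  by rewrite !mxE.
have Z1E : (Z1 *m rowsub h (Y *m C) :=: W *m C)%MS.
  rewrite /Z1 -mulmxA -Z0E; apply: eqmx_trans RE; apply: eqmxMfull.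
  by rewrite row_full_unit unitmx_inv.
pose S := [set l | l \notin codom f0].
have cS : (size (enum S) <= a - b')%N.
  rewrite -cardE.
  have -> : #|S| = (rho - b')%N.
    have -> : S = ~: [set f0 x | x in 'I_b'].
      apply/setP => l; rewrite !inE; congr (~~ _).
      by apply/codomP/imsetP => [[x ->]|[x _ ->]]; exists x.
    by rewrite cardsCs setCK card_ord card_imset ?card_ord //; apply: fullrankfun_inj.
  by rewrite leq_sub2r.
pose g : {ffun 'I_(a - b') -> option 'I_N} := [ffun j => omap h (onth (enum S) (nat_of_ord j))].
pose f : {ffun 'I_b' -> 'I_N} := [ffun i => h (f0 i)].
pose Z : 'M[k]_(b', a - b') :=
  \matrix_(i, j) if onth (enum S) (nat_of_ord j) is Some l then Z1 i l else 0.
exists f, g, Z.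
have RE' : rowsub f Y + Z *m orow g Y = Z1 *m rowsub h Y.
  apply/matrixP => i j; rewrite !mxE.
  rewrite [RHS](bigID (mem S)) /= [RHS]addrC; congr (_ + _).
    rewrite (eq_bigl (mem [set f0 x | x in 'I_b'])); last first.
      move=> l /=; have -> : (l \notin S) = (l \in codom f0) by rewrite inE negbK.
      by apply/codomP/imsetP => [[x ->]|[x _ ->]]; exists x.
    rewrite big_imset /=; last by move=> x y _ _; apply: fullrankfun_inj.
    rewrite (bigD1 i) //= Z1f eqxx mul1r big1 ?addr0 ?mxE ?ffunE // => l li.
    by rewrite Z1f eq_sym (negbTE li) mul0r.
  rewrite -[RHS]big_enum /= -[RHS](sum_onth _ cS); apply: eq_bigr => l _.
  by rewrite !mxE ffunE; case: (onth _ _) => [u|] /=; rewrite ?mul0r ?mxE.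
rewrite RE'; apply/eqmxP/andP; split.
  rewrite -addsmxE addsmx_sub W'W.
  have : (Z1 *m rowsub h Y *m C <= W *m C)%MS by rewrite -mulmxA mul_rowsub_mx Z1E.
  move/sub_cokermx/submx_trans; apply; rewrite addsmx_sub submx_refl //.
have : (W *m C <= Z1 *m rowsub h Y *m C)%MS by rewrite -mulmxA mul_rowsub_mx Z1E.
by move/sub_cokermx/submx_trans; apply; rewrite -addsmxE addsmxC.
Qed.

End Coordinate.

Section Columns.
Variables (n : nat) (e : 'I_n -> bool) (c : 'I_n -> nat).

Definition lk (i j : 'I_n) := ((j : nat) == i.+1) && e i.

(** This makes [c i] the position of [i] in its Jordan block, counted from 0: the second clause
    forces 0 at the first box. *)
Definition columns :=
  (forall i j, lk i j -> c j = (c i).+1) /\ (forall j, (0 < c j)%N -> exists i, lk i j).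

Definition csize (m : nat) := #|[pred i | c i == m]|.

Lemma lk_fun i j j' : lk i j -> lk i j' -> j = j'.
Proof. by move=> /andP [/eqP h _] /andP [/eqP h' _]; apply: val_inj; rewrite /= h h'. Qed.

Lemma lk_inj i i' j : lk i j -> lk i' j -> i = i'.
Proof.
move=> /andP [/eqP h _] /andP [/eqP h' _]; apply: val_inj.
by apply/eqP; rewrite -eqSS -h -h'.
Qed.

Hypothesis Hc : columns.

Lemma col_le i : (c i <= i)%N.
Proof.
case: i => i Hi /=; elim: i Hi => [|i IH] Hi.
  by case: (posnP (c (Ordinal Hi))) => [->//|/(Hc.2) [j /andP [/eqP]]].
case: (posnP (c (Ordinal Hi))) => [->//|/(Hc.2) [j ji]].
rewrite (Hc.1 _ _ ji); move: (ji) => /andP [/eqP [/= ij] _].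
by rewrite ltnS; case: j ij {ji} => j Hj /= ij; subst j; apply: IH.
Qed.

Lemma col_lt i : (c i < n)%N.
Proof. exact: leq_ltn_trans (col_le i) (ltn_ord i). Qed.

End Columns.

Section Boxes.
Variables (k : closedFieldType) (n : nat) (e : 'I_n -> bool) (c : 'I_n -> nat).
Hypothesis Hc : columns e c.
Variable t : nat -> k.

(** The matrix X_t, acting on row vectors from the right; [shifted m] is X_t - t_m, and [from m] has
    row space V_m. *)
Definition cmx : 'M[k]_n := jordan_mx (fun i => t (c i)) e.
Definition shifted m : 'M[k]_n := cmx - (t m)%:M.
Definition from m : 'M[k]_n := dg k (fun i => (m <= c i)%N).

Lemma cmxE i j : cmx i j = (if i == j then t (c i) else 0) + (lk e i j)%:R.
Proof.
rewrite mxE /lk; case: (eqVneq i j) => [->|ij].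
  by rewrite -[_ == _.+1]negbK neq_ltn ltnSn /= addr0.
by case: ifP; rewrite add0r.
Qed.

Lemma shiftedE m i j :
  shifted m i j = (t (c i) - t m) * (i == j)%:R + (lk e i j)%:R.
Proof.
rewrite /shifted mxE cmxE !mxE; case: eqP => _; last by rewrite mulr0 add0r subr0.
by rewrite mulr1 addrAC.
Qed.

Lemma row_shifted m i j : lk e i j ->
  row i (shifted m) = (t (c i) - t m) *: delta_mx 0 i + delta_mx 0 j.
Proof.
move=> ij; apply/rowP => l; rewrite mxE shiftedE !mxE eqxx /= [l == i]eq_sym.
congr (_ + _%:R); have [il|/negP il] := boolP (lk e i l).
  by rewrite (lk_fun il ij) eqxx.
by case: eqP => // lj; rewrite lj in il.
Qed.

Lemma from_shifted m p (A : 'M[k]_(p, n)) : (A <= from m)%MS -> (A *m shifted m <= from m.+1)%MS.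
Proof.
move=> /sub_dgP Am; apply/sub_dgP => i j; rewrite -leqNgt => cj.
rewrite mxE big1 // => l _; rewrite shiftedE.
have [cl|cl] := leqP m (c l); last by rewrite Am ?mul0r // -ltnNge.
rewrite (_ : lk e l j = false) ?addr0; last first.
  by apply/negP => /(Hc.1); lia.
case: eqP => [lj|_]; last by rewrite !mulr0.
have -> : c l = m by subst l; lia.
by rewrite subrr mul0r mulr0.
Qed.

(* The last conjunct says that the inverse of the shift avoids the ends of the
   rows of U. *)
Lemma shift_inverse (U : pred 'I_n) m :
  (forall i j, lk e i j -> U j -> U i) ->
  exists K : 'M[k]_n,
    (forall u, U u -> (m < c u)%N -> row u K *m shifted m = delta_mx 0 u) /\
    (forall u j, K u j != 0 ->
       [/\ U j, (m <= c j)%N & exists2 j', lk e j j' & U j']).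
Proof.
move=> Uc.
pose R u (v : 'rV[k]_n) := ((U u && (m < c u)%N) -> v *m shifted m = delta_mx 0 u) /\
  (forall j, v 0 j != 0 -> [/\ U j, (m <= c j)%N & exists2 j', lk e j j' & U j']).
have ex u : exists v, R u v.
  have [h|h] := boolP (U u && (m < c u)%N); last first.
    by exists 0; split; [rewrite (negbTE h) | move=> j; rewrite mxE eqxx].
  move: h; have [q] := ubnP (c u); elim: q u => // q IH u cq /andP [Uu mu].
  have [x xu] := Hc.2 u (leq_ltn_trans (leq0n _) mu).
  have cx : c u = (c x).+1 := Hc.1 _ _ xu.
  have dxE : (delta_mx 0 x : 'rV[k]_n) *m shifted m =
    (t (c x) - t m) *: delta_mx 0 x + delta_mx 0 u.
    by rewrite -rowE (row_shifted _ xu).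
  have dx j : (delta_mx 0 x : 'rV[k]_n) 0 j != 0 ->
      [/\ U j, (m <= c j)%N & exists2 j', lk e j j' & U j'].
    rewrite mxE /=; have [->|] := eqVneq j x; last by rewrite eqxx.
    by move=> _; split; [apply: Uc Uu|lia|exists u].
  have [mx|mx] := eqVneq (c x) m.
    exists (delta_mx 0 x); split=> // _.
    by rewrite dxE mx subrr scale0r add0r.
  have hx : U x && (m < c x)%N by rewrite (Uc _ _ xu) //=; lia.
  have [v [/(_ hx) vx vj]] := IH x ltac:(lia) hx.
  (* The box [x] before [u] is sent to [u] plus a multiple of [x]; the preimage of [x] obtained by
     induction removes that multiple. *)
  exists (delta_mx 0 x - (t (c x) - t m) *: v); split=> [_|j].
    by rewrite mulmxBl dxE -scalemxAl vx addrAC subrr add0r.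
  have [v0|/vj //] := eqVneq (v 0 j) 0.
  have -> : (delta_mx 0 x - (t (c x) - t m) *: v) 0 j = (delta_mx 0 x : 'rV[k]_n) 0 j.
    by rewrite !mxE v0 mulr0 subr0.
  exact: dx.
have [f fE] := fin_all_exists ex.
exists (\matrix_u f u); split=> [u Uu mu|u j].
  by rewrite rowK (fE u).1 // Uu.
by rewrite mxE; apply: (fE u).2.
Qed.

Lemma shift_section m : exists K : 'M[k]_n, forall p (A : 'M[k]_(p, n)),
  (A <= from m.+1)%MS -> A *m K *m shifted m = A /\ (A *m K <= from m)%MS.
Proof.
have [K [K1 K2]] := @shift_inverse xpredT m (fun _ _ _ _ => isT).
exists K => p A /sub_dgP Am; split.
  apply/row_matrixP => i; rewrite -mulmxA row_mul mulmx_sum_row.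
  rewrite [RHS]row_sum_delta; apply: eq_bigr => j _; rewrite mxE.
  have [cj|cj] := boolP (m.+1 <= c j)%N; last by rewrite Am // !scale0r.
  by rewrite row_mul K1.
apply/sub_dgP => i j cj; rewrite mxE big1 // => l _.
have [->|/K2 [_ h _]] := eqVneq (K l j) 0; first by rewrite mulr0.
by rewrite h in cj.
Qed.

Lemma shift_from m : (from m *m shifted m :=: from m.+1)%MS.
Proof.
apply/eqmxP/andP; split; first by apply: from_shifted.
have [K KE] := shift_section m; have [h1 h2] := KE _ _ (submx_refl (from m.+1)).
by rewrite -h1; apply: submxMr.
Qed.

Lemma rank_from m : \rank (from m) = (\rank (from m.+1) + csize c m)%N.
Proof.
rewrite /from !rank_dg /csize -cardUI addnC [X in (X + _)%N](_ : _ = 0%N).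
  by apply: eq_card => i; rewrite !inE; lia.
by apply: eq_card0 => i; rewrite !inE; lia.
Qed.

Lemma rank_from_ker m : \rank (from m :&: kermx (shifted m))%MS = csize c m.
Proof.
have := mxrank_mul_ker (from m) (shifted m); rewrite shift_from (rank_from m).
by move/eqP; rewrite eqn_add2l => /eqP.
Qed.

Lemma from_big m : (n <= m)%N -> from m = 0.
Proof.
move=> nm; apply/matrixP => i j; rewrite !mxE leqNgt (leq_trans (col_lt Hc i) nm).
by rewrite mul0rn.
Qed.

Lemma from0 p (A : 'M[k]_(p, n)) : (A <= from 0)%MS.
Proof. by apply/sub_dgP => i j. Qed.

Lemma fromS m p : (m <= p)%N -> (from p <= from m)%MS.
Proof.
move=> mp; apply/sub_dgP => i j cj; rewrite !mxE; case: eqP => // ij.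
by subst j; rewrite (_ : (p <= c i)%N = false) //; lia.
Qed.

Lemma shifted_stable m p (A : 'M[k]_(p, n)) :
  (A *m cmx <= A)%MS -> (A *m shifted m <= A)%MS.
Proof.
by move=> h; rewrite mulmxBr addmx_sub // eqmx_opp mul_mx_scalar scalemx_sub.
Qed.

Definition pcover m (Q : 'M[k]_n -> Prop) :=
  exists (I : finType) (p : nat) (F : I -> 'rV[k]_m -> 'M[k]_(p, n)),
    (forall i, pmx (F i)) /\ forall W, Q W -> exists i y, (F i y :=: W)%MS.

(** [f j] is the jump of dimension from [W :&: from j.+1] to [W :&: from j]. Recording the ranks as
    tail sums fits the descending induction on [m]. *)
Definition with_profile (f : nat -> nat) m (W : 'M[k]_n) :=
  [/\ (W <= from m)%MS, (W *m cmx <= W)%MS &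
    forall l, (m <= l <= n)%N -> \rank (W :&: from l)%MS = (\sum_(l <= j < n) f j)%N].

(* Descends through the filtration W :&: from m: each W :&: from m contains
   W' := W :&: from m.+1 and lies in the preimage of W' under the shift, which
   exceeds W' by exactly csize c m dimensions. *)
Lemma cover_profile (f : nat -> nat) m : (m <= n)%N ->
  pcover (\sum_(m <= j < n) f j * (csize c j - f j)) (with_profile f m).
Proof.
move=> mn; rewrite -(subKn mn); have := leq_subr m n; move: (n - m)%N => q {mn m}.
elim: q => [|q IH] qn.
  rewrite subn0 big_geq //; exists 'I_1, 0%N, (fun _ _ => 0); split=> [i [] //|W [W0 _ _]].
  exists 0, 0; move: W0; rewrite from_big // submx0 => /eqP ->.
  by apply/eqmxP; rewrite !sub0mx.
set m := (n - q.+1)%N; have mS : (n - q)%N = m.+1 by rewrite /m; lia.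
have mn : (m < n)%N by rewrite /m; lia.
have [I [p [F [FE cov]]]] := IH (ltnW qn); rewrite mS in F FE cov.
rewrite big_ltn //; set M := (\sum_(m.+1 <= j < n) _)%N in F FE cov *.
have [K KE] := shift_section m.
set a := csize c m; set b := f m.
pose N := row_base (from m :&: kermx (shifted m))%MS.
set r := \rank (from m :&: kermx (shifted m))%MS in N *.
have ra : r = a by apply: rank_from_ker.
pose yl (y : 'rV[k]_(b * (a - b) + M)) : 'rV[k]_M := rsubmx y.
pose yz (y : 'rV[k]_(b * (a - b) + M)) : 'M[k]_(b, a - b) := vec_mx (lsubmx y).
(* Rows spanning the preimage of [W']: the kernel of the shift on [from m], and the section [K]
   applied to generators of [W']. Since [K] does not depend on [W'], they are polynomial in the
   parameters. *)
pose Y i y := col_mx N (F i y *m K).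
pose F' (x : I * ({ffun 'I_b -> 'I_(r + p)} * {ffun 'I_(a - b) -> option 'I_(r + p)})) y :=
  col_mx (F x.1 (yl y)) (rowsub x.2.1 (Y x.1 (yl y)) + yz y *m orow x.2.2 (Y x.1 (yl y))).
exists (I * ({ffun 'I_b -> 'I_(r + p)} * {ffun 'I_(a - b) -> option 'I_(r + p)}))%type.
exists (p + b)%N, F'; split=> [[i [f0 g]]|W [Wm Ws Wr]].
  have pyl : pmx yl by move=> u v; apply: pfun_ext (pfunX k (rshift _ v)) => y; rewrite mxE ord1.
  have Fl : pmx (fun y => F i (yl y)).
    by move=> u v; apply: (pfun_comp (f := fun y => F i y u v)) => //; apply: FE.
  have Yl : pmx (fun y => Y i (yl y)).
    by apply: pmx_col; [apply: pmxC|apply: pmxM => //; apply: pmxC].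
  apply: pmx_col => //; apply: pmxD; first exact: pmx_rowsub.
  apply: pmxM; first by move=> u v; apply: pfun_ext (pfunX k (lshift _ (mxvec_index u v))) => y; rewrite !mxE.
  move=> u v; case E : (g u) => [w|].
    by apply: pfun_ext (Yl w v) => y; rewrite [RHS]mxE E.
  by apply: pfun_ext (pfunC _ 0) => y; rewrite [RHS]mxE E.
pose W' := (W :&: from m.+1)%MS.
have W's : (W' *m cmx <= W')%MS.
  rewrite sub_capmx (submx_trans _ Ws) ?submxMr ?capmxSl //=.
  rewrite -[cmx](subrK (t m)%:M) mulmxDr addmx_sub //.
    apply: from_shifted; apply: submx_trans (capmxSr _ _) _.
    exact: fromS.
  by rewrite mul_mx_scalar scalemx_sub // capmxSr.
have [i [y yW']] : exists i y, (F i y :=: W')%MS.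
  apply: cov; split=> // [|l /andP [ml ln]]; first exact: capmxSr.
  rewrite -Wr; last by rewrite (ltnW ml).
  apply: eqmx_rank; apply/andP; split.
    by rewrite sub_capmx capmxSr (submx_trans (capmxSl _ _)) // capmxSl.
  rewrite !sub_capmx capmxSl capmxSr !andbT /=.
  by apply: submx_trans (capmxSr _ _) (fromS ml).
have rW' : \rank W' = (\sum_(m.+1 <= j < n) f j)%N by apply: Wr; rewrite leqnSn.
have rW : \rank W = (\rank (F i y) + b)%N.
  rewrite yW' rW' addnC -big_ltn // -Wr ?leqnn 1?ltnW //.
  by apply: eqmx_rank; apply/andP; rewrite capmxSl sub_capmx submx_refl Wm.
have WD : (W *m shifted m <= W')%MS.
  by rewrite sub_capmx shifted_stable //=; apply: from_shifted.
have [WK1 WK2] := KE _ _ (submx_trans WD (capmxSr _ _)).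
have WY : (W <= Y i y)%MS.
  rewrite -[W](subrK (W *m shifted m *m K)) -addsmxE addmx_sub //.
    apply: submx_trans (addsmxSl _ _); rewrite eq_row_base sub_capmx.
    rewrite addmx_sub ?eqmx_opp //=; apply/sub_kermxP.
    by rewrite mulmxBl WK1 subrr.
  apply: submx_trans (addsmxSr _ _); apply: submxMr.
  by rewrite yW'.
have rY : (\rank (Y i y) <= \rank (F i y) + a)%N.
  rewrite /Y -addsmxE addnC; apply: leq_trans (mxrank_adds_leqif _ _) _.
  by rewrite leq_add ?mxrankM_maxl // eq_row_base -/r ra.
have W'W : (F i y <= W)%MS by rewrite yW' capmxSl.
have [f0 [g [Z ZE]]] := between_chart W'W WY rW rY.
exists (i, (f0, g)), (row_mx (mxvec Z) y).
by rewrite /F' /yl /yz row_mxKl row_mxKr mxvecK.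
Qed.

End Boxes.

Lemma ex_max_prop (T : Type) (P : T -> Prop) (mu : T -> nat) b :
  (exists x, P x) -> (forall x, P x -> (mu x <= b)%N) ->
  exists2 x, P x & forall y, P y -> (mu y <= mu x)%N.
Proof.
move=> [x Px] mub; have [q] := ubnP (b - mu x); elim: q x Px => // q IH x Px bq.
have [[y [Py xy]]|h] := classic (exists y, P y /\ (mu x < mu y)%N).
  by apply: (IH y Py); have := mub y Py; lia.
by exists x => // y Py; rewrite leqNgt; apply/negP => xy; apply: h; exists y.
Qed.

Section StableSubspaces.
Variables (k : closedFieldType) (n d : nat) (e : 'I_n -> bool) (c : 'I_n -> nat).
Hypothesis Hc : columns e c.
Variable t : nat -> k.
Notation X := (cmx e c t).

Definition coverd m (Q : 'M[k]_n -> Prop) :=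
  exists (I : finType) (F : I -> 'rV[k]_m -> 'M[k]_(d, n)),
    (forall i, pmx (F i)) /\ forall W, Q W -> exists i y, (F i y == W)%MS.

(** Some [d] rows of a spanning family form a basis, and which rows do so is a finite choice. *)
Lemma coverdW m m' (Q : 'M[k]_n -> Prop) : (m <= m')%N ->
  (forall W, Q W -> \rank W = d) -> pcover m Q -> coverd m' Q.
Proof.
move=> mm Qr [I [p [F [FE cov]]]].
pose pr (y : 'rV[k]_m') : 'rV[k]_m := \row_j y 0 (widen_ord mm j).
exists (I * {ffun 'I_d -> 'I_p})%type, (fun x : I * {ffun 'I_d -> 'I_p} => fun y => rowsub x.2 (F x.1 (pr y))); split.
  move=> [i h]; apply: pmx_rowsub => a b /=.
  apply: (pfun_comp (f := fun y => F i y a b)); first exact: FE.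
  by move=> u v; apply: pfun_ext (pfunX k (widen_ord mm v)) => y; rewrite !mxE.
move=> W QW; have [i [y yW]] := cov W QW.
have [h hE] : exists h : {ffun 'I_d -> 'I_p}, (rowsub h (F i y) :=: F i y)%MS.
  have := Qr W QW; rewrite -yW => <-; exists [ffun j => maxrankfun (F i y) j].
  apply: eqmx_trans (eq_maxrowsub (F i y)).
  rewrite (_ : rowsub _ _ = rowsub (maxrankfun (F i y)) (F i y)) //.
  by apply/matrixP => a b; rewrite !mxE ffunE.
exists (i, h), (\row_j if insub (nat_of_ord j) is Some l then y 0 l else 0).
rewrite (_ : pr _ = y); last by apply/rowP => j; rewrite !mxE /= valK.
by apply/eqmxP; apply: eqmx_trans hE yW.
Qed.

Lemma coverd_seq m (T : eqType) (s : seq T) (Q : T -> 'M[k]_n -> Prop) :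
  (forall x, x \in s -> coverd m (Q x)) -> coverd m (fun W => exists2 x, x \in s & Q x W).
Proof.
elim: s => [|x s IH] cs.
  exists 'I_1, (fun _ _ => 0); split=> [i a b|W [x]//].
  by apply: pfun_ext (pfunC _ 0) => y; rewrite mxE.
have [I [F [FE cF]]] := cs x (mem_head _ _).
have [J [G [GE cG]]] := IH (fun y ys => cs y (mem_behead (s := x :: s) ys)).
exists (I + J)%type, (fun z => match z with inl i => F i | inr j => G j end).
split=> [[i|j]|W [y]]; [exact: FE|exact: GE|].
rewrite inE => /orP [/eqP -> /cF [i [z zW]]|ys yW]; first by exists (inl i), z.
by have [j [z zW]] := cG W (ex_intro2 _ _ y ys yW); exists (inr j), z.
Qed.

Definition fixed (P : 'M[k]_n) W :=
  grass d W /\ (W *m (invmx P *m X *m P) <= W)%MS.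

Lemma fixed_chain_le P m L : P \in unitmx -> (0 < d)%N ->
  (forall f : nat -> nat, (forall j, f j <= csize c j)%N -> (\sum_(0 <= j < n) f j = d)%N ->
     (\sum_(0 <= j < n) f j * (csize c j - f j) <= m)%N) ->
  has_chain (@grass_closed k n d) (fixed P) L -> (L <= m)%N.
Proof.
move=> uP d0 fm.
(* A profile has values at most [n], so it can be stored as a finite function and the charts of all
   profiles form one finite family; [ext] prolongs it by 0. *)
pose ext (f : {ffun 'I_n -> 'I_n.+1}) j := if insub j is Some l then f l : nat else 0%N.
pose ok (f : {ffun 'I_n -> 'I_n.+1}) := [forall j : 'I_n, f j <= csize c j]%N && (\sum_(0 <= j < n) ext f j == d)%N.
have [I [F [FE cF]]] : coverd m (fun W => exists2 f, f \in [pred f | ok f] & 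
    \rank W = d /\ with_profile e c t (ext f) 0 W).
  suff : forall f, f \in enum [pred f | ok f] ->
      coverd m (fun W => \rank W = d /\ with_profile e c t (ext f) 0 W).
    case/coverd_seq => I [F [FE cF]]; exists I, F; split=> // W [f fok fW].
    by apply: cF; exists f => //; rewrite mem_enum.
  move=> f; rewrite mem_enum inE => /andP [/forallP fa /eqP fd].
  have le : (\sum_(0 <= j < n) ext f j * (csize c j - ext f j) <= m)%N.
    by apply: fm fd => j; rewrite /ext; case: insubP => // l _ <-.
  apply: coverdW le _ _ => [W [] //|].
  have [J [p [G [GE cG]]]] := cover_profile Hc t (ext f) (leq0n n).
  by exists J, p, G; split=> // W [_ /cG].
apply: (@chain_le _ _ _ d0 _ _ I (fun i y => F i y *m P)).
- by move=> W [].
- by move=> i; apply: pmxM; [exact: FE|exact: pmxC].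
move=> W [[_ rW] sW].
pose V := W *m invmx P.
have rV : \rank V = d by rewrite mxrankMfree // row_free_unit unitmx_inv.
have sV : (V *m X <= V)%MS.
  have := submxMr (invmx P) sW; rewrite !mulmxA mulmxK //.
pose f : {ffun 'I_n -> 'I_n.+1} :=
  [ffun j : 'I_n => inord (\rank (V :&: from k c j)%MS - \rank (V :&: from k c j.+1)%MS)].
pose r j := \rank (V :&: from k c j)%MS.
have rS j : (r j.+1 <= r j)%N.
  by apply: mxrankS; rewrite capmxS ?fromS.
have rle j : (r j <= n)%N by apply: rank_leq_col.
have fE j : (j < n)%N -> ext f j = (r j - r j.+1)%N.
  move=> jn; rewrite /ext insubT ffunE inordK // ltnS.
  by apply: leq_trans (leq_subr _ _) (rle _).
have rn : r n = 0%N.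
  by apply/eqP; rewrite mxrank_eq0 -submx0 -(from_big k Hc (leqnn n)) capmxSr.
have fS l : (l <= n)%N -> r l = (\sum_(l <= j < n) ext f j)%N.
  move=> ln; rewrite -(subKn ln); move: (n - l)%N (leq_subr l n) => q.
  elim: q => [|q IH] qn; first by rewrite subn0 rn big_geq.
  rewrite big_ltn; last by lia.
  rewrite (_ : (n - q.+1).+1 = n - q)%N; last by lia.
  rewrite -IH ?(ltnW qn) // fE; last by lia.
  rewrite (_ : (n - q.+1).+1 = n - q)%N; last by lia.
  by have := rS (n - q.+1)%N; rewrite (_ : (n - q.+1).+1 = n - q)%N; lia.
have [|i [y yV]] := cF V; last first.
  exists i, y; apply/eqmxP; rewrite -[W](mulmxKV uP) -/V.
  by apply: eqmxMr; apply/eqmxP.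
have r0 : r 0 = d.
  rewrite -rV; apply: eqmx_rank; apply/andP.
  by rewrite capmxSl sub_capmx submx_refl from0.
exists f; last first.
  split; [exact: rV | split; [exact: from0 | exact: sV |]].
  by move=> l /andP [_ ln]; apply: fS.
rewrite inE /ok; apply/andP; split; last by rewrite -fS // r0.
apply/forallP => j; rewrite ffunE inordK; last first.
  by rewrite ltnS (leq_trans (leq_subr _ _)) ?rank_leq_col.
(* The jump at [j] is the dimension of the image of [V :&: from j] in [from j] modulo [from j.+1],
   hence at most [csize c j]. *)
have := mxrank_sum_cap (V :&: from k c j)%MS (from k c j.+1).
have : (\rank ((V :&: from k c j) + from k c j.+1)%MS <= \rank (from k c j))%N.
  by apply: mxrankS; rewrite addsmx_sub capmxSr fromS.
have : (\rank ((V :&: from k c j) :&: from k c j.+1)%MS <= \rank (V :&: from k c j.+1)%MS)%N.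
  apply: mxrankS; rewrite sub_capmx capmxSr andbT.
  by apply: submx_trans (capmxSl _ _) (capmxSl _ _).
by rewrite (rank_from k c j); lia.
Qed.

(** * Stable subspaces as graphs over the boxes outside a lower set *)

Section Family.
Variable U : pred 'I_n.
Hypothesis Ucl : forall i j, lk e i j -> U j -> U i.

Definition rowend u := U u && ~~ [exists j, lk e u j && U j].

(** The positions where entries of the reduced basis are prescribed; the stability equation produces
    the remaining entries. By [Ucl] the set [U] is an initial segment of each row, and it has one
    end in each row that it meets. *)
Definition free_pair (x : 'I_n * 'I_n) :=
  [&& ~~ U x.1, rowend x.2 & (c x.1 <= c x.2)%N].

Section Riccati.
Variables (K : 'I_n -> 'M[k]_n) (Z : 'M[k]_n).
Hypothesis K1 : forall p u, U u -> (c p < c u)%N ->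
  row u (K p) *m shifted e c t (c p) = delta_mx 0 u.
Hypothesis K2 : forall p u j, K p u j != 0 ->
  [/\ U j, (c p <= c j)%N & exists2 j', lk e j j' & U j'].
Hypothesis Z0 : forall p u, Z p u != 0 -> free_pair (p, u).

Let D p := shifted e c t (c p).
Let v p : 'rV[k]_n := (delta_mx 0 p + row p Z) *m D p.

(* The row space of dg (predC U) + phi is stable as soon as riccati phi = phi.
   Row p of riccati phi only involves rows of phi in columns beyond c p, so that
   n iterations reach the fixed point. *)
Definition riccati (phi : 'M[k]_n) : 'M[k]_n :=
  \matrix_p if U p then 0 else row p Z - v p *m (dg k U - phi) *m K p.

Definition graph : 'M[k]_n := iter n riccati 0.

Lemma riccati_supp phi p j : riccati phi p j != 0 -> [/\ ~~ U p, U j & (c p <= c j)%N].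
Proof.
rewrite mxE; case: ifPn => [_|Up]; first by rewrite mxE eqxx.
have [Zpj|/Z0 /and3P [_ /andP [Uj _] cpj]] := eqVneq (Z p j) 0; last by [].
have [K0|[u Ku]] : (forall u, K p u j = 0) \/ exists u, K p u j != 0.
- have [/existsP [u Ku]|/existsPn h] := boolP [exists u, K p u j != 0].
    by right; exists u.
  by left=> u; apply/eqP; rewrite -[_ == _]negbK h.
- rewrite !mxE Zpj add0r oppr_eq0 big1 ?eqxx // => u _.
  by rewrite K0 mulr0.
by case/K2: Ku.
Qed.

(** The column of [K p] at a row end of [U] is zero, so the correction term does not touch the
    prescribed entries. *)
Lemma riccati_free phi p u : free_pair (p, u) -> riccati phi p u = Z p u.
Proof.
case/and3P => Up /andP [/= Uu /negP ue] _; rewrite mxE (negbTE Up) !mxE.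
rewrite big1 ?subr0 // => l _; have [->|/K2 [_ _ [j uj Uj]]] := eqVneq (K p l u) 0.
  by rewrite mulr0.
by case: ue; apply/existsP; exists j; rewrite uj.
Qed.

Lemma v_from p : ~~ U p -> (v p <= from k c (c p).+1)%MS.
Proof.
move=> Up; apply: from_shifted => //; apply/sub_dgP => i j; rewrite -ltnNge => cj.
rewrite [i]ord1 !mxE /=; have [->|/Z0 /and3P [_ _ /= h]] := eqVneq (Z p j) 0; last by lia.
by case: eqP => [jp|]; [subst j; lia|rewrite addr0].
Qed.

Lemma graph_fix : riccati graph = graph.
Proof.
have stab q : forall p, (n <= c p + q)%N -> row p (riccati (iter q riccati 0)) = row p (iter q riccati 0).
  elim: q => [|q IH] p; first by rewrite addn0 leqNgt (col_lt Hc).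
  move=> np; rewrite /= !rowK; case: ifPn => // Up.
  rewrite !mulmxBr; congr (_ - (_ - _) *m _).
  rewrite !mulmx_sum_row; apply: eq_bigr => l _.
  have [cl|cl] := leqP (c p).+1 (c l); first by rewrite IH //; lia.
  by move/sub_dgP: (v_from Up) => -> //; rewrite ?scale0r // -leqNgt.
by apply/row_matrixP => p; apply: stab; rewrite leq_addl.
Qed.

Definition graph_basis : 'M[k]_n := dg k (predC U) + graph.

(** A vector fixed by [graph_basis] lies in its row space. The defect of [v p] is [w]; the
    correction [- w *m K p] in the fixed point equation changes the image under [D p] by exactly
    [- w], and this removes the defect because [w] is supported on [U], where [graph] has zero
    rows. *)
Lemma graph_basis_stable : (graph_basis *m X <= graph_basis)%MS.
Proof.
have gS p j : graph p j != 0 -> [/\ ~~ U p, U j & (c p <= c j)%N].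
  by rewrite -graph_fix; apply: riccati_supp.
have cB : dg k U - graph = 1%:M - graph_basis.
  rewrite /graph_basis opprD addrA; congr (_ - _); apply/matrixP => i j.
  by rewrite !mxE /=; case: (U i); case: (i == j); rewrite /= ?mulr1n ?mulr0n ?subr0 ?subrr.
apply/row_subP => p; rewrite row_mul.
have [Up|Up] := boolP (U p).
  rewrite (_ : row p _ = 0) ?mul0mx ?sub0mx //; apply/rowP => j; rewrite !mxE /= Up mul0rn.
  rewrite add0r; apply/eqP; apply: contraT => /gS [].
  by rewrite Up.
have BE : row p graph_basis = delta_mx 0 p + row p graph.
  rewrite /graph_basis raddfD /=; congr (_ + _); apply/rowP => j; rewrite !mxE /= Up.
  by rewrite eq_sym.
rewrite -[X](subrK (t (c p))%:M) -/(shifted e c t (c p)) mulmxDr addmx_sub //; last first.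
  by rewrite mul_mx_scalar scalemx_sub // row_sub.
suff h : row p graph_basis *m D p *m (1%:M - graph_basis) = 0.
  move/eqP: h; rewrite mulmxBr mulmx1 subr_eq0 => /eqP ->; exact: submxMl.
set w := v p *m (dg k U - graph).
have gp : row p graph = row p Z - w *m K p by rewrite -[in LHS]graph_fix rowK (negbTE Up).
have ws j : w 0 j != 0 -> U j && (c p < c j)%N.
  apply: contraR => /negP h; rewrite /w mulmxBr mxE [X in _ + X]mxE mul_dg.
  have /sub_dgP vf := v_from Up.
  rewrite [X in X - _](_ : _ = 0) ?sub0r ?oppr_eq0; last first.
    by case: ifP => // Uj; apply: vf; apply/negP => cj; apply: h; rewrite Uj.
  rewrite mxE big1 // => l _.
  have [->|/gS [_ Uj cl]] := eqVneq (graph l j) 0; first by rewrite mulr0.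
  by rewrite vf ?mul0r //; apply/negP => cp; apply: h; rewrite Uj; lia.
have wK : w *m K p *m D p = w.
  rewrite -mulmxA mulmx_sum_row [RHS]row_sum_delta; apply: eq_bigr => j _.
  have [->|/ws /andP [Uj cj]] := eqVneq (w 0 j) 0; first by rewrite !scale0r.
  by rewrite row_mul K1.
have wg : w *m (dg k U - graph) = w.
  rewrite mulmxBr [X in _ - X](_ : _ = 0) ?subr0.
    apply/rowP => j; rewrite mul_dg; case: ifPn => // Uj.
    by apply/esym/eqP; apply: contraT => /ws; rewrite (negbTE Uj).
  rewrite mulmx_sum_row big1 // => j _.
  have [->|/ws /andP [Uj _]] := eqVneq (w 0 j) 0; first by rewrite scale0r.
  rewrite (_ : row j graph = 0) ?scaler0 //; apply/rowP => l; rewrite mxE [RHS]mxE.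
  by apply/eqP; apply: contraT => /gS []; rewrite Uj.
rewrite -cB BE gp addrA mulmxBl wK mulmxBl wg -/(v p) -/w subrr //.
Qed.

End Riccati.
End Family.
End StableSubspaces.

(** * Stable subspaces: a free family of maximal dimension *)

Section FreeFamily.
Variables (k : closedFieldType) (n : nat) (e : 'I_n -> bool) (c : 'I_n -> nat).
Hypothesis Hc : columns e c.
Variables (t : nat -> k) (U : pred 'I_n).
Hypothesis Ucl : forall i j, lk e i j -> U j -> U i.

(** The graph comes from iterating a polynomial map a fixed number of times, so the basis is
    polynomial in the entries at the free pairs, while its columns outside [U] form the identity:
    [chain_ge] applies with these entries as coordinates. *)
Lemma fixed_chain_ge P : P \in unitmx ->
  has_chain (@grass_closed k n #|predC U|) (fixed #|predC U| e c t P)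
    #|[pred x | free_pair e c U x]|.
Proof.
move=> uP.
have ex p : exists K : 'M[k]_n,
    (forall u, U u -> (c p < c u)%N -> row u K *m shifted e c t (c p) = delta_mx 0 u) /\
    (forall u j, K u j != 0 -> [/\ U j, (c p <= c j)%N & exists2 j', lk e j j' & U j']).
  exact: shift_inverse.
have [K KE] := fin_all_exists ex.
have K1 p := (KE p).1; have K2 p := (KE p).2.
set E := [pred x | free_pair e c U x].
pose z (j : 'I_#|E|) : 'I_n * 'I_n := enum_val j.
pose Z (y : 'rV[k]_#|E|) : 'M[k]_n := \sum_j y 0 j *: delta_mx (z j).1 (z j).2.
have ZE y a b : Z y a b = \sum_(j | z j == (a, b)) y 0 j.
  rewrite /Z summxE [RHS]big_mkcond /=; apply: eq_bigr => j _; rewrite !mxE.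
  case: (z j) => z1 z2 /=; rewrite xpair_eqE ![_ == a]eq_sym ![_ == b]eq_sym.
  by case: ifP; rewrite ?mulr1 ?mulr0.
have Z0 y p u : Z y p u != 0 -> free_pair e c U (p, u).
  apply: contraR => nf; rewrite ZE big_pred0 // => j.
  by apply/negP => /eqP zj; have := enum_valP j; rewrite -/(z j) zj inE (negbTE nf).
have Zz y j : Z y (z j).1 (z j).2 = y 0 j.
  rewrite ZE (eq_bigl (pred1 j)) ?big_pred1_eq // => l.
  by rewrite -surjective_pairing (inj_eq enum_val_inj).
pose ph y := graph e c t U K (Z y).
have phE y : riccati e c t U K (Z y) (ph y) = ph y.
  by apply: graph_fix => //; apply: Z0.
pose g (i : 'I_#|predC U|) : 'I_n := enum_val i.
have gU i : ~~ U (g i) by have := enum_valP i.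
pose B y := graph_basis e c t U K (Z y).
have phS y p j : ph y p j != 0 -> [/\ ~~ U p, U j & (c p <= c j)%N].
  by rewrite -phE; apply: riccati_supp; [apply: K2|apply: Z0].
have Bs y : (B y *m cmx e c t <= B y)%MS.
  by apply: graph_basis_stable => //; apply: Z0.
have BE y p j : B y p j = ((p == j) && ~~ U p)%:R + ph y p j.
  by rewrite mxE; congr (_ + _); rewrite !mxE /=; case: eqP; case: (U p).
have Bg y : (rowsub g (B y) :=: B y)%MS.
  apply/eqmxP/andP; split; first by rewrite rowsubE submxMl.
  apply/row_subP => p; have [Up|Up] := boolP (U p).
    rewrite (_ : row p _ = 0) ?sub0mx //; apply/rowP => j.
    rewrite mxE BE Up andbF [RHS]mxE add0r.
    by apply/eqP; apply: contraT => /phS []; rewrite Up.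
  have pU : p \in predC U by [].
  rewrite (_ : row p _ = row (enum_rank_in pU p) (rowsub g (B y))) ?row_sub //.
  by apply/rowP => j; rewrite !mxE /g enum_rankK_in.
have gB y : colsub g (rowsub g (B y)) = 1%:M.
  apply/matrixP => i j; rewrite [LHS]mxE [LHS]mxE BE [RHS]mxE (inj_eq enum_val_inj) gU andbT.
  rewrite (_ : ph y _ _ = 0) ?addr0 //; apply/eqP; apply: contraT => /phS [_].
  by rewrite (negbTE (gU j)).
apply: (@chain_ge _ _ _ _ _ (fun y => rowsub g (B y)) P g) => //.
- apply: pmx_rowsub; apply: pmxD; first exact: pmxC.
  suff h q : pmx (fun y => iter q (riccati e c t U K (Z y)) 0) by exact: h.
  elim: q => [|q IH] /=; first exact: pmxC.
  have pZ : pmx Z.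
    move=> a b; pose F0 (j : 'I_#|E|) (y : 'rV[k]_#|E|) := if z j == (a, b) then y 0 j else 0.
    apply: (@pfun_ext _ _ (fun y => \sum_(j <- index_enum 'I_#|E|) F0 j y)).
      by move=> y; rewrite ZE [RHS]big_mkcond.
    apply: pfun_sum => j; rewrite /F0; case: (z j == (a, b)); [exact: pfunX|exact: pfunC].
  move=> p j; rewrite /riccati; have [Up|Up] := boolP (U p).
    by apply: pfun_ext (pfunC _ 0) => y; rewrite [RHS]mxE Up mxE.
  have pZp : pmx (fun y => row p (Z y)).
    by move=> a b; apply: pfun_ext (pZ p b) => y; rewrite [RHS]mxE.
  have h : pmx (fun y => row p (Z y) - ((delta_mx 0 p + row p (Z y)) *m shifted e c t (c p)) *m
     (dg k U - iter q (riccati e c t U K (Z y)) 0) *m K p).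
    apply: pmxD => //; apply: pmxN; apply: pmxM; last exact: pmxC.
    apply: pmxM; first by apply: pmxM; [apply: pmxD => //|]; exact: pmxC.
    by apply: pmxD; [exact: pmxC|apply: pmxN].
  by apply: pfun_ext (h 0 j) => y; rewrite [RHS]mxE (negbTE Up).
- move=> j; have := enum_valP j; rewrite -/(z j) inE => zf.
  have zU : (z j).1 \in predC U by case/and3P: zf.
  exists (enum_rank_in zU (z j).1), (z j).2 => y.
  rewrite mxE /g enum_rankK_in // BE -phE (riccati_free t (Z y) K2 (ph y) (p := (z j).1) zf) Zz.
  case: eqP => [h|_]; last by rewrite add0r.
  by case/and3P: zf; rewrite h => /negbTE nU /andP []; rewrite nU.
move=> y; split; first split; first by rewrite genmx_id.
  rewrite genmxE mxrankMfree ?row_free_unit //; apply/eqP; rewrite eqn_leq rank_leq_row /=.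
  rewrite -[X in (X <= _)%N](mxrank1 k) -(gB y).
  have -> : colsub g (rowsub g (B y)) = rowsub g (B y) *m colsub g 1%:M.
    by rewrite mulmx_colsub mulmx1.
  exact: mxrankM_maxl.
rewrite (eqmxMr _ (genmxE _)) genmxE !mulmxA mulmxK // submxMr //.
by rewrite (eqmxMr _ (Bg y)) Bg.
Qed.

End FreeFamily.

(** * Counting boxes and maximising the dimension of a cell *)

Section Counting.
Variables (n : nat) (e : 'I_n -> bool) (c : 'I_n -> nat).
Hypothesis Hc : columns e c.

Lemma sum_columns (S : pred 'I_n) :
  (\sum_(0 <= j < n) #|[pred i | S i && (c i == j)]| = #|S|)%N.
Proof.
rewrite big_mkord -[RHS]sum1_card [RHS](partition_big (fun i => Ordinal (col_lt Hc i)) xpredT) //=.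
apply: eq_bigr => j _; rewrite -sum1_card; apply: eq_bigl => i; rewrite !inE.
by rewrite -val_eqE.
Qed.

(** Each box of column [m.+1] has exactly one predecessor, which lies in column [m]. *)
Lemma card_pred (S : pred 'I_n) m :
  #|[pred i | (c i == m) && [exists j, lk e i j && S j]]| = #|[pred j | S j && (c j == m.+1)]|.
Proof.
pose nx i := odflt i [pick j | lk e i j].
have nxE i j : lk e i j -> nx i = j.
  by rewrite /nx => ij; case: pickP => [l /lk_fun -/(_ _ ij)|/(_ j)]; rewrite ?ij.
rewrite -(@card_in_imset _ _ nx); last first.
  move=> i i'; rewrite !inE => /andP [_ /existsP [j /andP [ij _]]].
  move=> /andP [_ /existsP [j' /andP [ij' _]]]; rewrite (nxE _ _ ij) (nxE _ _ ij') => h.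
  by subst j'; apply: lk_inj ij ij'.
apply: eq_card => j; rewrite !inE; apply/imsetP/andP => [[i]|[Sj /eqP cj]].
  rewrite !inE => /andP [/eqP <- /existsP [l /andP [il Sl]]] ->.
  by rewrite (nxE _ _ il) Sl (Hc.1 _ _ il).
have [|i ij] := Hc.2 j; first by rewrite cj.
exists i; last by rewrite (nxE _ _ ij).
rewrite inE; apply/andP; split; first by have := Hc.1 _ _ ij; lia.
by apply/existsP; exists j; rewrite ij.
Qed.

Lemma csize_dec m : (csize c m.+1 <= csize c m)%N.
Proof.
rewrite /csize -(card_pred xpredT) subset_leq_card //.
by apply/subsetP => i; rewrite !inE => /andP [].
Qed.

Lemma csize_big m : (n <= m)%N -> csize c m = 0%N.
Proof. by move=> nm; apply: eq_card0 => i; rewrite !inE; have := col_lt Hc i; lia. Qed.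

Lemma set_between (A C : {set 'I_n}) q : A \subset C -> (#|A| <= q <= #|C|)%N ->
  exists2 B : {set 'I_n}, #|B| = q & (A \subset B) && (B \subset C).
Proof.
move=> AC /andP [Aq]; rewrite -(subnKC Aq); move: (q - #|A|)%N => r {Aq q}.
elim: r => [|r IH] rC; first by exists A; rewrite ?addn0 ?subxx.
have [|B Br /andP [AB BC]] := IH; first by lia.
have /set0Pn [x] : C :\: B != set0.
  by rewrite -card_gt0 cardsD (setIidPr BC) Br; lia.
rewrite !inE => /andP [xB xC]; exists (x |: B); first by rewrite cardsU1 xB Br; lia.
rewrite (subset_trans AB) ?subsetUr //=; apply/subsetP => y; rewrite !inE.
by case/orP => [/eqP -> //|]; apply: (subsetP BC).
Qed.

(** Columns are filled from the last to the first. In column [m] the predecessors of the boxes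
    already chosen number [f m.+1], and the bounds on [f m] leave room for [f m] boxes including
    them. *)
Lemma staircase (f : nat -> nat) : (forall j, f j.+1 <= f j)%N -> (forall j, f j <= csize c j)%N ->
  exists2 U : pred 'I_n, (forall i j, lk e i j -> U j -> U i) &
    forall m, #|[pred i | U i && (c i == m)]| = f m.
Proof.
move=> fd fs.
have down q : (q <= n)%N -> exists U : {set 'I_n},
    [/\ forall i j, lk e i j -> (n - q <= c i)%N -> j \in U -> i \in U,
        forall i, i \in U -> (n - q <= c i)%N &
        forall m, (n - q <= m)%N -> #|[pred i | (i \in U) && (c i == m)]| = f m].
  elim: q => [|q IH] qn.
    exists set0; split=> [i j|i|m]; rewrite ?inE // subn0 => nm.
    have := fs m; rewrite csize_big // leqn0 => /eqP ->.
    by apply: eq_card0 => i; rewrite !inE.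
  have [U [Ucl Uc Uf]] := IH (ltnW qn).
  set m := (n - q.+1)%N; have mS : (n - q)%N = m.+1 by rewrite /m; lia.
  rewrite mS in Ucl Uc Uf.
  pose A := [set i | (c i == m) && [exists j, lk e i j && (j \in U)]].
  pose C := [set i | c i == m].
  have cA : #|A| = f m.+1 by rewrite cardsE (card_pred (mem U)) Uf.
  have cC : #|C| = csize c m by rewrite cardsE.
  have [||B Bm /andP [/subsetP AB /subsetP BC]] := @set_between A C (f m).
  - by apply/subsetP => i; rewrite !inE => /andP [].
  - by rewrite cA cC fd fs.
  - exists (U :|: B); split=> [i j ij ci|i|l ml].
    + have cj := Hc.1 _ _ ij; rewrite !inE => /orP [jU|/BC]; last by rewrite inE; lia.
      have [im|im] := eqVneq (c i) m; last by rewrite (Ucl _ _ ij) //; lia.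
      rewrite (AB i) ?orbT // inE im eqxx /=; apply/existsP; exists j.
      by rewrite ij.
    + by rewrite !inE => /orP [/Uc|/BC]; rewrite ?inE; lia.
    have [->|lm] := eqVneq l m.
      rewrite -Bm; apply: eq_card => i; rewrite !inE.
      have [/Uc h|] := boolP (i \in U); have [/BC|] := boolP (i \in B); rewrite ?inE /=; lia.
    rewrite -Uf; last by lia.
    apply: eq_card => i; rewrite !inE.
    by have [/BC|] := boolP (i \in B); rewrite ?inE ?orbF // => /eqP ->; rewrite eq_sym (negbTE lm) !andbF.
have [U [Ucl _ Uf]] := down n (leqnn n).
exists (mem U) => [i j ij jU|m]; first by apply: Ucl ij _ jU; rewrite subnn.
by apply: Uf; rewrite subnn.
Qed.

End Counting.

Lemma sum_split2 n j (F : nat -> nat) : (j.+1 < n)%N ->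
  (\sum_(0 <= l < n) F l =
   \sum_(0 <= l < j) F l + (F j + (F j.+1 + \sum_(j.+2 <= l < n) F l)))%N.
Proof.
move=> jn; rewrite (@big_cat_nat _ _ _ j 0 n) //=; last by lia.
by rewrite (@big_ltn _ _ _ j n) ?(@big_ltn _ _ _ j.+1 n) //; lia.
Qed.

Section Optimum.
Variables (n d : nat) (a : nat -> nat).
Hypothesis a_dec : forall j, (a j.+1 <= a j)%N.
Hypothesis a_big : forall j, (n <= j)%N -> a j = 0%N.

Definition distribution (f : nat -> nat) :=
  (forall j, f j <= a j)%N /\ (\sum_(0 <= j < n) f j)%N = d.

Definition value (f : nat -> nat) := (\sum_(0 <= j < n) f j * (a j - f j))%N.

(* Moving a unit from column j to column j.+1 when a j - f j < a j.+1 - f j.+1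
   does not decrease the value; ties are broken by \sum j * f j. *)
Lemma optimum : (exists f, distribution f) ->
  exists f, [/\ distribution f, forall g, distribution g -> (value g <= value f)%N &
    forall j, (a j.+1 - f j.+1 <= a j - f j)%N].
Proof.
move=> ex.
have [f0 f0d f0m] := @ex_max_prop _ distribution value (\sum_(0 <= j < n) a j * a j) ex
  ltac:(move=> f [fa _]; apply: leq_sum => j _; apply: leq_mul => //; apply: leq_subr).
have [f [fd fv] fm] := @ex_max_prop _ (fun f => distribution f /\ value f = value f0)
  (fun f => \sum_(0 <= j < n) j * f j)%N (\sum_(0 <= j < n) j * a j)
  (ex_intro _ f0 (conj f0d erefl))
  ltac:(move=> f [[fa _] _]; apply: leq_sum => j _; apply: leq_mul => //).
exists f; split=> // [g /f0m|j]; first by rewrite fv.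
rewrite leqNgt; apply/negP => lt.
have [jn|nj] := ltnP j.+1 n; last by rewrite (a_big nj) in lt.
have [fa fs] := fd; have ad := a_dec j; have fa0 := fa j; have fa1 := fa j.+1.
pose g l := if l == j then (f j).-1 else if l == j.+1 then (f j.+1).+1 else f l.
have gj : g j = (f j).-1 by rewrite /g eqxx.
have gj1 : g j.+1 = (f j.+1).+1 by rewrite /g eqxx ifF //; lia.
have gE l : l != j -> l != j.+1 -> g l = f l by rewrite /g => /negbTE -> /negbTE ->.
have lo F : (\sum_(0 <= l < j) F (g l) l = \sum_(0 <= l < j) F (f l) l)%N.
  by apply: eq_big_nat => l /andP [_ lj]; rewrite gE //; lia.
have hi F : (\sum_(j.+2 <= l < n) F (g l) l = \sum_(j.+2 <= l < n) F (f l) l)%N.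
  by apply: eq_big_nat => l /andP [lj _]; rewrite gE //; lia.
have gd : distribution g.
  split=> [l|].
    have [->|lj] := eqVneq l j; first by rewrite gj; lia.
    have [->|lj1] := eqVneq l j.+1; first by rewrite gj1; lia.
    by rewrite gE.
  rewrite -fs !(sum_split2 _ jn) gj gj1 (lo (fun x _ => x)) (hi (fun x _ => x)).
  lia.
have gv : (value f <= value g)%N.
  rewrite /value !(sum_split2 _ jn) gj gj1.
  rewrite (lo (fun x l => x * (a l - x))%N) (hi (fun x l => x * (a l - x))%N).
  rewrite leq_add2l; move: (\sum_(j.+2 <= l < n) _)%N => C.
  (* With [f j] = x + 1, [a j - f j] = z, [f j.+1] = w and [a j.+1 - f j.+1] = y + 1, the value
     changes by (x - w) + (y - z). Here z <= y by assumption, and [a_dec] gives x - w >= y - z. *)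
  have [x xE] : exists x, f j = x.+1 by exists (f j).-1; lia.
  have [y yE] : exists y, (a j.+1 - f j.+1 = y.+1)%N by exists (a j.+1 - f j.+1).-1; lia.
  have [z zE] : exists z, z = (a j - f j)%N by exists (a j - f j)%N.
  rewrite xE succnK (_ : a j - x = z.+1)%N; last by lia.
  rewrite -xE -zE (_ : a j.+1 - (f j.+1).+1 = y)%N; last by lia.
  rewrite yE xE; move: (f j.+1) yE fa1 lt => w; rewrite -zE => yE fa1 lt.
  have [u uE] : exists u, (x.+1 + z = w + y.+1 + u)%N.
    by exists (x.+1 + z - (w + y.+1))%N; lia.
  rewrite (mulSn x) (mulnS x) (mulSn w) (mulnS w); lia.
have ge : value g = value f0 by apply/eqP; rewrite eqn_leq f0m // -fv gv.
have := fm g (conj gd ge); rewrite !(sum_split2 _ jn) gj gj1.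
rewrite (lo (fun x l => l * x)%N) (hi (fun x l => l * x)%N).
have : (0 < f j)%N by lia.
by case: (f j) => // x _ /=; rewrite !mulnS; lia.
Qed.

End Optimum.

Section Dimension.
Variables (n : nat) (e : 'I_n -> bool) (c : 'I_n -> nat).
Hypothesis Hc : columns e c.

(** A row of [U] that reaches column [m] has exactly one box there, and its end lies in a column of
    index at least [m]. *)
Lemma card_rowend (U : pred 'I_n) m : (forall i j, lk e i j -> U j -> U i) ->
  #|[pred u | rowend e U u && (m <= c u)%N]| = #|[pred u | U u && (c u == m)]|.
Proof.
move=> Ucl; have [nm|mn] := leqP n m.
  by rewrite !eq_card0 // => i; rewrite !inE; have := col_lt Hc i; lia.
rewrite -(subKn (ltnW mn)); move: (n - m)%N (leq_subr m n) => q {mn m}.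
elim: q => [|q IH] qn.
  by rewrite !eq_card0 // => i; rewrite !inE; have := col_lt Hc i; lia.
set m := (n - q.+1)%N; have mS : (n - q)%N = m.+1 by rewrite /m; lia.
have {}IH := IH (ltnW qn); rewrite mS -(card_pred Hc) in IH.
rewrite -(cardID [pred u | (m < c u)%N] [pred u | rowend e U u && (m <= c u)%N]).
rewrite -(cardID [pred i | [exists j, lk e i j && U j]] [pred u | U u && (c u == m)]).
congr (_ + _)%N.
  transitivity #|[pred u | rowend e U u && (m < c u)%N]|.
    by apply: eq_card => u; rewrite !inE; lia.
  rewrite IH; apply: eq_card => u; rewrite !inE.
  have [/existsP [j /andP [uj Uj]]|_] := boolP [exists j, lk e u j && U j]; rewrite ?andbF //.
  by rewrite (Ucl _ _ uj Uj) !andbT.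
by apply: eq_card => u; rewrite !inE /rowend; lia.
Qed.

Lemma card_free_pair (U : pred 'I_n) : (forall i j, lk e i j -> U j -> U i) ->
  #|[pred x | free_pair e c U x]| =
  (\sum_(0 <= j < n) #|[pred i | ~~ U i && (c i == j)]| * #|[pred i | U i && (c i == j)]|)%N.
Proof.
move=> Ucl; rewrite -sum1_card.
rewrite (eq_bigl (fun x => ~~ U x.1 && (rowend e U x.2 && (c x.1 <= c x.2)%N))) //.
rewrite -(pair_big_dep (fun i => ~~ U i) (fun i u => rowend e U u && (c i <= c u)%N) (fun _ _ => 1%N)) /=.
rewrite (eq_bigr (fun i => #|[pred u | U u && (c u == c i)]|)); last first.
  by move=> i _; rewrite -card_rowend // -sum1_card.
rewrite (partition_big (fun i => Ordinal (col_lt Hc i)) xpredT) //= big_mkord.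
apply: eq_bigr => j _; rewrite -sum_nat_const; by apply: eq_big => [i|i /andP [_ /eqP <-]].
Qed.

(** The witness is quantified before the field, [t] and [P], and depends on the column lengths only;
    this uniformity is what equates the dimensions for the three matrices. *)
Theorem fixed_dimension d : (0 < d < n)%N ->
  exists m, forall (k : closedFieldType) (t : nat -> k) P, P \in unitmx ->
    krull_dim (@grass_closed k n d) (fixed d e c t P) m.
Proof.
move=> /andP [d0 dn].
have ex : exists f, distribution n d (csize c) f.
  exists (fun j => #|[pred i : 'I_n | (i < d)%N && (c i == j)]|); split=> [j|].
    by apply: subset_leq_card; apply/subsetP => i; rewrite !inE => /andP [].
  rewrite (sum_columns Hc) -[RHS](card_ord d) -(card_image (f := widen_ord (ltnW dn))).
    apply: eq_card => i; apply/idP/imageP => [id|[j _ ->]]; last by rewrite unfold_in /= ltn_ord.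
    by exists (Ordinal id) => //; apply: val_inj.
  by move=> i j /(congr1 val) /= ij; apply: val_inj.
have [f [[fa fs] fm fd]] := optimum (csize_dec Hc) (csize_big Hc) ex.
exists (value n (csize c) f) => k t P uP; split; last first.
  by move=> L; apply: (fixed_chain_le Hc) => // g ga gs; apply: fm.
(* [U] receives a_j - f_j boxes in column j, a nonincreasing number by the choice of the optimum;
   the pivots outside [U] then number f_j. *)
have [U Ucl Uf] := staircase Hc fd (fun j => leq_subr _ _).
have Cf j : #|[pred i | ~~ U i && (c i == j)]| = f j.
  have := cardID U [pred i | c i == j]; rewrite -/(csize c j).
  have -> : #|[predI [pred i | c i == j] & U]| = (csize c j - f j)%N.
    by rewrite -Uf; apply: eq_card => i; rewrite !inE andbC.
  have -> : #|[predD [pred i | c i == j] & U]| = #|[pred i | ~~ U i && (c i == j)]|.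
    by apply: eq_card => i; rewrite !inE.
  by have := fa j; lia.
have cU : #|predC U| = d.
  by rewrite -fs -(sum_columns Hc); apply: eq_bigr => j _; rewrite -Cf.
have := fixed_chain_ge Hc t Ucl uP; rewrite cU card_free_pair //.
rewrite (eq_bigr (fun j => f j * (csize c j - f j))%N) // => j _.
by rewrite Cf Uf.
Qed.

End Dimension.

(** * Jordan chains *)

Section Extension.
Variables (K : fieldType) (vT : vectType K).
Implicit Types (U V R : {vspace vT}) (u : seq vT).

Lemma dim_addv_line V (x : vT) : x \notin V -> \dim (V + <[x]>) = (\dim V).+1.
Proof.
move=> xV; rewrite dimv_disjoint_sum ?dim_vline.
  by have [x0|] := eqVneq x 0; [rewrite x0 mem0v in xV | rewrite addn1].
apply/eqP; rewrite -subv0; apply/subvP => w; rewrite memv_cap => /andP [wV /vlineP [a wa]].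
rewrite memv0 wa; have [->|a0] := eqVneq a 0; first by rewrite scale0r.
by move: wV; rewrite wa rpredZeq => /orP [|wV]; [rewrite (negbTE a0)|rewrite wV in xV].
Qed.

(* Greedy choice: if no r in R moved u_1 out of V, then R + <u_1> would lie in
   V and U would be too small. *)
Lemma extend_free U V R u : (R <= U)%VS -> (V <= U)%VS -> {subset u <= U} ->
  (U <= V + <<u>> + R)%VS -> (\dim V + size u <= \dim U)%N ->
  exists us, [/\ size us = size u, {subset us <= U}, forall i, us`_i - u`_i \in R &
    \dim (V + <<us>>) = (\dim V + size u)%N].
Proof.
move=> RU; elim: u V => [|x u IH] V VU uU Us dU.
  by exists [::]; split=> // [i|]; rewrite ?nth_nil ?subr0 ?mem0v // span_nil addv0 addn0.
have xU : x \in U by apply: uU; rewrite mem_head.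
have [r rR xr] : exists2 r, r \in R & x + r \notin V.
  have [xV|xV] := boolP (x \in V); last by exists 0; rewrite ?mem0v ?addr0.
  have /subvPn [r rR rV] : ~~ (R <= V)%VS.
    apply/negP => RV; have : (U <= V + <<u>>)%VS.
      apply: subv_trans Us _; rewrite span_cons !subv_add addvSl addvSr.
      rewrite (subv_trans RV) ?addvSl // !andbT.
      by rewrite -memvE (subvP (addvSl V _)).
    move/dimvS; move: dU => /=; have := dim_span u; have := dimv_add_leqif V <<u>>.
    by case=> h _; move: h; lia.
  exists r => //; apply: contra rV => h.
  by rewrite -(addKr x r) addrC memvB.
pose V1 := (V + <[x + r]>)%VS.
have dV1 : \dim V1 = (\dim V).+1 by apply: dim_addv_line.
have rU : r \in U by apply: (subvP RU).
have V1U : (V1 <= U)%VS by rewrite subv_add VU -memvE memvD.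
have [||| us [sus usU usR dus]] := IH V1 V1U.
- by move=> y yu; apply: uU; rewrite inE yu orbT.
- set W := (V1 + <<u>> + R)%VS.
  have V1W : (V1 <= W)%VS by rewrite /W -addvA addvSl.
  have VW : (V <= W)%VS by apply: subv_trans V1W; apply: addvSl.
  have RW : (R <= W)%VS by apply: addvSr.
  have uW : (<<u>> <= W)%VS by apply: subv_trans (addvSl _ R); apply: addvSr.
  apply: subv_trans Us _; rewrite span_cons !subv_add VW RW uW !andbT /=.
  rewrite -memvE -(addrK r x); apply: memvB; last exact: (subvP RW).
  by apply: (subvP V1W); apply: (subvP (addvSr _ _)); apply: memv_line.
- by rewrite dV1 /= in dU *; lia.
exists (x + r :: us); split.
- by rewrite /= sus.
- by move=> y; rewrite inE => /orP [/eqP ->|/usU //]; rewrite memvD.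
- by case=> [|i] //=; rewrite addrAC subrr add0r.
by rewrite span_cons addvA dus dV1 /= addnS.
Qed.

End Extension.

Lemma killing_product (k : closedFieldType) n (Y : 'M[k]_n) :
  exists rs, forall v : 'rV[k]_n, foldl (fun v a => v *m (Y - a%:M)) v rs = 0.
Proof.
case: n Y => [|m] Y; first by exists [::] => v; apply/rowP => [[]].
have [rs rsE] := closed_field_poly_normal (char_poly Y).
exists rs => v; rewrite -[RHS](mulmx0 _ v) -(Cayley_Hamilton Y).
rewrite rsE (monicP (char_poly_monic Y)) scale1r rmorph_prod /=.
elim: rs v {rsE} => [|r rs IH] v; first by rewrite big_nil mulmx1.
rewrite big_cons /= IH; set W := \prod_(j <- rs) _.
by rewrite -mulmxE mulmxA rmorphB /= horner_mx_X horner_mx_C.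
Qed.

Section Chains.
Variables (k : closedFieldType) (n : nat) (X : 'M[k]_n).
Notation vT := 'rV[k]_n.
Implicit Types (U V : {vspace vT}) (cs : seq (vT * seq k)).

Definition shl (a : k) : 'End(vT) := linfun (mulmxr (X - a%:M)).

Lemma shlE a v : shl a v = v *m (X - a%:M).
Proof. by rewrite lfunE. Qed.

Lemma shlD a b v : shl a v = shl b v + (b - a) *: v.
Proof.
rewrite !shlE !mulmxBr !mul_mx_scalar scalerBl addrA; congr (_ - _).
by rewrite subrK.
Qed.

(** The scalar may change at each step: a constant list with zero [chend] gives an ordinary Jordan
    chain, and varying lists give the rows of X_t. *)
Fixpoint chain (v : vT) (s : seq k) : seq vT :=
  if s is a :: s' then v :: chain (shl a v) s' else [::].

Definition chend (v : vT) (s : seq k) := foldl (fun v a => shl a v) v s.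

Definition closed_chain (x : vT * seq k) := chend x.1 x.2 = 0.

Definition vecs cs : seq vT := flatten [seq chain x.1 x.2 | x <- cs].

Lemma vecs_cat cs1 cs2 : vecs (cs1 ++ cs2) = vecs cs1 ++ vecs cs2.
Proof. by rewrite /vecs map_cat flatten_cat. Qed.

Lemma vecs_perm cs1 cs2 : perm_eq cs1 cs2 -> perm_eq (vecs cs1) (vecs cs2).
Proof. by move=> h; apply: perm_flatten; apply: perm_map. Qed.

Lemma mem_vecs cs w : w \in vecs cs -> exists2 x, x \in cs & w \in chain x.1 x.2.
Proof. by case/flatten_mapP => x xc wx; exists x. Qed.

Definition stable_sp U := forall v, v \in U -> v *m X \in U.

Lemma shl_mem U a v : stable_sp U -> v \in U -> shl a v \in U.
Proof. by move=> sU vU; rewrite shlE mulmxBr mul_mx_scalar memvB ?sU ?memvZ. Qed.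

Lemma shl_stable U a : stable_sp U -> stable_sp (shl a @: U)%VS.
Proof.
move=> sU v /memv_imgP [u uU ->]; apply/memv_imgP; exists (u *m X); first exact: sU.
by rewrite !shlE !mulmxBr mulmxBl !mul_mx_scalar scalemxAl.
Qed.

Lemma shl_sub U a : stable_sp U -> (shl a @: U <= U)%VS.
Proof. by move=> sU; apply/subvP => v /memv_imgP [u uU ->]; apply: shl_mem. Qed.

Lemma lift_seq (f : 'End(vT)) U s : {subset s <= (f @: U)%VS} ->
  exists2 us, {subset us <= U} & [seq f u | u <- us] = s.
Proof.
elim: s => [|x s IH] sU; first by exists [::].
have [|us usU usE] := IH; first by move=> y ys; apply: sU; rewrite inE ys orbT.
have /memv_imgP [u uU ->] : x \in (f @: U)%VS by apply: sU; rewrite mem_head.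
exists (u :: us); last by rewrite /= usE.
by move=> y; rewrite inE => /orP [/eqP ->|/usU].
Qed.

Lemma head_mem V x : closed_chain x -> {subset chain x.1 x.2 <= V} -> x.1 \in V.
Proof.
case: x => v [|a s]; rewrite /closed_chain /=; first by move=> ->; rewrite mem0v.
by move=> _; apply; rewrite mem_head.
Qed.

(** The inductive step of both normal forms, from the image of X - a to [U]. Each chain of [cs1] is
    lengthened by a preimage of its head, kernel vectors supply new chains of length one, and [cs2]
    is kept. Preimages are determined only up to the kernel [R], a freedom by which [extend_free]
    makes them independent modulo [V]. *)
Lemma extend_chains U a cs1 cs2 : stable_sp U ->
  let V := (shl a @: U)%VS in let R := (U :&: lker (shl a))%VS in
  basis_of V (vecs (cs1 ++ cs2)) -> (forall x, x \in cs1 ++ cs2 -> closed_chain x) ->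
  (V <= <<[seq x.1 | x <- cs1]>> + shl a @: V)%VS -> (size cs1 <= \dim R)%N ->
  exists cs, [/\ basis_of U (vecs cs), forall x, x \in cs -> closed_chain x,
    size cs = (\dim R + size cs2)%N &
    forall x, x \in cs -> x \in cs2 \/ exists s, x.2 = a :: s /\ 
      (s = [::] \/ exists h, (h, s) \in cs1)].
Proof.
move=> sU V R bV ccl Vh sR.
have VU : (V <= U)%VS by apply: shl_sub.
have dU : \dim U = (\dim V + \dim R)%N by rewrite addnC limg_ker_dim.
have RU : (R <= U)%VS by apply: capvSl.
have csV x : x \in cs1 -> {subset chain x.1 x.2 <= V}.
  move=> xc w wx; rewrite -(span_basis bV); apply: memv_span.
  by apply/flatten_mapP; exists x => //; rewrite mem_cat xc.
have [us0 us0U us0E] : exists2 us, {subset us <= U} & [seq shl a u | u <- us] = [seq x.1 | x <- cs1].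
  apply: lift_seq => _ /mapP [x xc ->].
  by apply: head_mem; [apply: ccl; rewrite mem_cat xc | apply: csV].
have sus0 : size us0 = size cs1 by rewrite -(size_map (shl a)) us0E size_map.
pose q := (\dim R - size cs1)%N.
(* Zero vectors hold the places of the new chains; [extend_free] adds an element of [R] to each. *)
pose u := us0 ++ nseq q 0; pose cs1' := cs1 ++ nseq q (0, [::]).
have su : size u = \dim R by rewrite size_cat size_nseq sus0 /q; lia.
have [|||us [sus usU usR dus]] := @extend_free _ _ U V R u RU VU.
- by move=> x; rewrite mem_cat mem_nseq => /orP [/us0U //|/andP [_ /eqP ->]]; rewrite mem0v.
- apply/subvP => v vU.
  have : shl a v \in (<<[seq x.1 | x <- cs1]>> + shl a @: V)%VS.
    by apply: (subvP Vh); apply: memv_img.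
  rewrite -us0E -limg_span => /memv_addP [_ /memv_imgP [h hu ->] [_ /memv_imgP [w wV ->] vE]].
  have hU : h \in U by apply: (subvP _ _ hu); apply/span_subvP.
  rewrite -[v](subrK (w + h)) addrC memv_add //.
    rewrite memv_add //; apply: (subvP _ _ hu); apply/span_subvP => x xu.
    by apply: memv_span; rewrite mem_cat xu.
  rewrite memv_cap; apply/andP; split.
    by apply: memvB => //; apply: memvD => //; apply: (subvP VU).
  by rewrite memv_ker linearB linearD /= vE [X in _ - X]addrC subrr.
- by rewrite su -dU.
have usE : [seq shl a v | v <- us] = [seq x.1 | x <- cs1'].
  have -> : [seq x.1 | x <- cs1'] = [seq shl a v | v <- u].
    by rewrite /cs1' /u !map_cat us0E !map_nseq /= linear0.
  apply: (@eq_from_nth _ 0); first by rewrite !size_map sus.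
  move=> i; rewrite size_map => ius; rewrite !(nth_map 0) -?sus //.
  have := usR i; rewrite memv_cap memv_ker linearB subr_eq0 => /andP [_ /eqP].
  by [].
pose cs0 := [seq (y.1, a :: y.2.2) | y <- zip us cs1'].
have scs1' : size cs1' = size us by rewrite sus su size_cat size_nseq /q; lia.
have pv : perm_eq (vecs cs0) (us ++ vecs cs1').
  rewrite /cs0; elim: (us) (cs1') scs1' usE => [|v vs IH] [|x xs] //= [sz] [vx usx].
  rewrite /vecs /= perm_cons -/(vecs _) vx.
  rewrite -/(vecs xs) perm_sym perm_catCA perm_cat2l perm_sym; exact: IH.
have vcs1' : vecs cs1' = vecs cs1.
  by rewrite vecs_cat; elim: (q) => [|r IH]; rewrite ?cats0.
exists (cs0 ++ cs2); split.
- have pv2 : perm_eq (vecs (cs0 ++ cs2)) (us ++ vecs (cs1 ++ cs2)).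
    by rewrite !vecs_cat catA perm_cat2r -vcs1'.
  rewrite (perm_basis _ pv2) basisEdim; apply/andP; split.
    rewrite span_cat (span_basis bV) addvC.
    suff -> : U = (V + <<us>>)%VS by rewrite subvv.
    apply/esym/eqP; rewrite eqEdim subv_add VU dus su -dU leqnn andbT /=.
    exact/span_subvP.
  by rewrite size_cat sus su dU -(span_basis bV) (eqP (basis_free bV)) addnC.
- move=> x; rewrite mem_cat => /orP [/mapP [y yz ->]|xc2]; last first.
    by apply: ccl; rewrite mem_cat xc2 orbT.
  have : y.2 \in cs1' /\ shl a y.1 = y.2.1.
    move: yz; elim: (us) (cs1') scs1' usE => [|v vs IH] [|z zs] //= [sz] [vx usx].
    rewrite inE => /orP [/eqP -> /=|yz]; first by rewrite mem_head.
    by have [] := IH zs sz usx yz; rewrite inE => -> ->; rewrite orbT.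
  rewrite /closed_chain /= => [] [yc ->]; move: yc; rewrite mem_cat mem_nseq.
  case/orP => [yc|/andP [_ /eqP -> //]].
  by apply: ccl; rewrite mem_cat yc.
- by rewrite size_cat size_map size_zip scs1' minnn sus su.
move=> x; rewrite mem_cat => /orP [/mapP [y yz ->]|xc2]; [right|by left].
exists y.2.2; split=> //.
have : y.2 \in cs1'.
  move: yz; elim: (us) (cs1') scs1' {usE} => [|v vs IH] [|z zs] //= [sz].
  rewrite inE => /orP [/eqP -> /=|yz]; first by rewrite mem_head.
  by rewrite inE (IH zs) ?orbT.
rewrite mem_cat mem_nseq => /orP [yc|/andP [_ /eqP -> //]]; last by left.
by right; exists y.2.1; case: (y.2) yc.
Qed.

Lemma chend_roots : exists rs, forall v, chend v rs = 0.
Proof.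
have [rs rsE] := killing_product X; exists rs => v; rewrite -[RHS](rsE v).
by rewrite /chend; elim: rs v {rsE} => //= r rs IH v; rewrite IH shlE.
Qed.

Lemma eigen_in U : stable_sp U -> U != 0%VS -> exists a, (0 < \dim (U :&: lker (shl a)))%N.
Proof.
move=> sU U0; have [rs rsE] := chend_roots.
have v0 : vpick U != 0 by rewrite vpick0.
have := rsE (vpick U); move: (vpick U) (memv_pick U) v0 => v.
elim: rs v {rsE} => [|r rs IH] v vU v0 /=; first by move=> h; rewrite h eqxx in v0.
have [r0 _|r0] := eqVneq (shl r v) 0; last by apply: IH => //; apply: shl_mem.
exists r; rewrite lt0n dimv_eq0; apply/negP => /eqP h.
have : v \in (U :&: lker (shl r))%VS by rewrite memv_cap vU memv_ker r0 eqxx.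
by rewrite h memv0 (negbTE v0).
Qed.

Lemma dim_shl_lt U a : (0 < \dim (U :&: lker (shl a)))%N -> (\dim (shl a @: U) < \dim U)%N.
Proof. by move=> h; rewrite -(limg_ker_dim (shl a) U) -[X in (X < _)%N]add0n ltn_add2r. Qed.

(** Modulo the image of X - a the operator acts as the scalar [a], so the whole chain stays on the
    line of its head. *)
Lemma chain_sub_heads V (H : {vspace vT}) a v s : (shl a @: V <= H)%VS -> v \in H ->
  {subset chain v s <= V} -> {subset chain v s <= H}.
Proof.
move=> VH; elim: s v => [|b s IH] v vH //= sV w; rewrite inE => /orP [/eqP -> //|].
apply: IH => [|y ys]; last by apply: sV; rewrite inE ys orbT.
rewrite (shlD _ a) memvD ?memvZ // (subvP VH) // memv_img //.
by apply: sV; rewrite mem_head.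
Qed.

(** X - a is invertible on a Jordan chain for another eigenvalue. *)
Lemma chain_sub_img V a b v m : a != b -> {subset chain v (nseq m b) <= V} ->
  chend v (nseq m b) = 0 -> {subset chain v (nseq m b) <= (shl a @: V)%VS}.
Proof.
move=> ab; elim: m v => [|m IH] v //= sV cv.
have sV' : {subset chain (shl b v) (nseq m b) <= V}.
  by move=> y ys; apply: sV; rewrite inE ys orbT.
have vV : v \in V by apply: sV; rewrite mem_head.
have h := IH _ sV' cv.
have hb : shl b v \in (shl a @: V)%VS.
  by case: (m) h cv => [|m'] /= h cv; [rewrite cv mem0v | apply: h; rewrite mem_head].
move=> w; rewrite inE => /orP [/eqP ->|/h //].
have : (b - a) *: v \in (shl a @: V)%VS.
  rewrite -[_ *: _](addKr (shl b v)) -shlD addrC memvB // memv_img //.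
by rewrite rpredZeq subr_eq0 eq_sym (negbTE ab).
Qed.

Lemma shl_chain_tail a v m : chend v (nseq m a) = 0 ->
  forall w, w \in chain v (nseq m a) -> shl a w \in <<behead (chain v (nseq m a))>>%VS.
Proof.
elim: m v => [|m IH] v //= cv w; rewrite inE => /orP [/eqP ->|wc].
  case: m cv {IH} => [|m] /= cv; first by rewrite cv mem0v.
  by apply: memv_span; rewrite mem_head.
have := IH _ cv w wc; apply: subvP; apply: sub_span => y.
by apply: mem_behead.
Qed.

Lemma shl_chain a b v s : all (pred1 b) s -> chend v s = 0 ->
  forall w, w \in chain v s -> shl a w \in <<chain v s>>%VS.
Proof.
move=> sb cv w wc; rewrite (shlD _ b) memvD ?memvZ //; last exact: memv_span.
have sE : s = nseq (size s) b by apply/all_pred1P.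
rewrite sE in cv wc *; have := shl_chain_tail cv wc; apply: subvP.
by apply: sub_span => y; apply: mem_behead.
Qed.

(** Only the chains for the chosen eigenvalue [a] are lengthened; chains for other eigenvalues are
    carried over unchanged. *)
Lemma jordan_chains U : stable_sp U -> exists cs,
  [/\ basis_of U (vecs cs), forall x, x \in cs -> closed_chain x &
      forall x, x \in cs -> exists m a, x.2 = nseq m.+1 a].
Proof.
have [q] := ubnP (\dim U); elim: q U => // q IH U dU sU.
have [->|U0] := eqVneq U 0%VS.
  by exists [::]; split=> //; rewrite /vecs /= basisEdim dimv0 sub0v.
have [a aR] := eigen_in sU U0.
set V := (shl a @: U)%VS; have dV := dim_shl_lt aR.
have sV : stable_sp V by apply: shl_stable.
have [||cs [bV ccl cst]] := IH V; [by apply: leq_trans dV _| by []|].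
pose P (x : vT * seq k) := all (pred1 a) x.2.
pose cs1 := [seq x <- cs | P x]; pose cs2 := [seq x <- cs | ~~ P x].
have pcs : perm_eq (vecs (cs1 ++ cs2)) (vecs cs) by apply: vecs_perm; rewrite perm_filterC.
have mcs x : x \in cs1 ++ cs2 -> x \in cs.
  by rewrite mem_cat !mem_filter => /orP [] /andP [].
have bV' : basis_of V (vecs (cs1 ++ cs2)) by rewrite (perm_basis _ pcs).
have csV x : x \in cs -> {subset chain x.1 x.2 <= V}.
  move=> xc w wx; rewrite -(span_basis bV); apply: memv_span.
  by apply/flatten_mapP; exists x.
have P1 x : x \in cs1 -> exists m, x.2 = nseq m.+1 a.
  rewrite mem_filter => /andP [Px /cst [m [b xE]]]; exists m; move: Px.
  by rewrite /P xE /= => /andP [/eqP -> _].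
have P2 x : x \in cs2 -> exists m b, a != b /\ x.2 = nseq m.+1 b.
  rewrite mem_filter => /andP [Px /cst [m [b xE]]]; exists m, b; split=> //.
  by apply: contra Px => /eqP ab; rewrite /P xE ab; apply/all_pred1P; rewrite size_nseq.
have V1 : (V <= <<[seq x.1 | x <- cs1]>> + shl a @: V)%VS.
  rewrite -{1}(span_basis bV'); apply/span_subvP => w /mem_vecs [x].
  rewrite mem_cat => /orP [xc1|xc2] wx.
    apply: (@chain_sub_heads V _ a x.1 x.2); rewrite ?addvSr //.
      by apply: (subvP (addvSl _ _)); apply: memv_span; apply: map_f.
    by apply: csV; apply: mcs; rewrite mem_cat xc1.
  apply: (subvP (addvSr _ _)); have [m [b [ab xE]]] := P2 x xc2.
  have xc : x \in cs by apply: mcs; rewrite mem_cat xc2 orbT.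
  have := ccl x xc; have := csV x xc; rewrite /closed_chain xE in wx * => h1 h2.
  exact: (chain_sub_img ab h1 h2).
have sR : (size cs1 <= \dim (U :&: lker (shl a)))%N.
  have : (\dim (V :&: lker (shl a)) <= \dim (U :&: lker (shl a)))%N.
    by apply: dimvS; apply: capvS => //; apply: shl_sub.
  apply: leq_trans; have := limg_ker_dim (shl a) V.
  (* X - a maps [V] into the span of the chain vectors other than the heads of [cs1], so its kernel
     on [V] has dimension at least [size cs1]. *)
  pose tl := flatten [seq behead (chain x.1 x.2) | x <- cs1] ++ vecs cs2.
  have : (shl a @: V <= <<tl>>)%VS.
    rewrite -{1}(span_basis bV') limg_span; apply/span_subvP => _ /mapP [w /mem_vecs [x xc wx] ->].
    have clx := ccl x (mcs x xc).
    move: xc; rewrite mem_cat => /orP [xc1|xc2].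
      have [m xE] := P1 x xc1; rewrite /closed_chain xE in clx wx *.
      have := shl_chain_tail clx wx; apply: subvP; apply: sub_span => y yx.
      by rewrite mem_cat; apply/orP; left; apply/flatten_mapP; exists x; rewrite ?xE.
    have [m [b [_ xE]]] := P2 x xc2.
    have sb : all (pred1 b) x.2 by rewrite xE; apply/all_pred1P; rewrite size_nseq.
    have := shl_chain a sb clx wx; apply: subvP; apply: sub_span => y yx.
    by rewrite mem_cat; apply/orP; right; apply/flatten_mapP; exists x.
  move/dimvS => h1 h2; have h3 := dim_span tl.
  have : (size tl + size cs1)%N = \dim V.
    rewrite -(span_basis bV') (eqP (basis_free bV')) vecs_cat !size_cat addnAC; congr (_ + _)%N.
    elim: (cs1) P1 => [|x xs IHx] P1 //=; rewrite /vecs /= !size_cat -/(vecs xs).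
    have [|m xE] := P1 x; first by rewrite mem_head.
    rewrite -IHx; last by move=> y yx; apply: P1; rewrite inE yx orbT.
    by rewrite xE /=; lia.
  by move=> h4; rewrite -(leq_add2r (\dim (shl a @: V))) h2 -h4 addnC leq_add2r (leq_trans h1 h3).
have ccl' x : x \in cs1 ++ cs2 -> closed_chain x by move/mcs/ccl.
have [cs' [bU cU _ sh]] := extend_chains sU bV' ccl' V1 sR.
exists cs'; split=> // x xc; case: (sh x xc) => [/P2 [m [b [_ xE]]]|]; first by exists m, b.
case=> s [xE [s0|[h hc1]]]; first by exists 0%N, a; rewrite xE s0.
by have [m /= sE] := P1 _ hc1; exists m.+1, a; rewrite xE sE.
Qed.

(* The eigenvalue a is chosen with the largest eigenspace, so that every chain
   of the image can be lifted. *)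
Lemma uniform_chains U : stable_sp U -> exists cs ts b,
  [/\ basis_of U (vecs cs), forall x, x \in cs -> closed_chain x,
      forall x, x \in cs -> x.2 != [::] /\ x.2 = take (size x.2) ts &
      (size cs <= \dim (U :&: lker (shl b)))%N].
Proof.
have [q] := ubnP (\dim U); elim: q U => // q IH U dU sU.
have [->|U0] := eqVneq U 0%VS.
  by exists [::], [::], 0; split=> //; rewrite /vecs /= basisEdim dimv0 sub0v.
have [a _ am] := @ex_max_prop k (fun _ => True) (fun a => \dim (U :&: lker (shl a))) (\dim U)
  (ex_intro _ 0 I) (fun a _ => dimvS (capvSl U (lker (shl a)))).
have [a0 a0R] := eigen_in sU U0.
have aR := leq_trans a0R (am a0 I).
set V := (shl a @: U)%VS; have dV := dim_shl_lt aR.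
have sV : stable_sp V by apply: shl_stable.
have [||cs [ts [b [bV ccl cst sb]]]] := IH V; [by apply: leq_trans dV _| by []|].
have bV' : basis_of V (vecs (cs ++ [::])) by rewrite cats0.
have csV x : x \in cs -> {subset chain x.1 x.2 <= V}.
  move=> xc w wx; rewrite -(span_basis bV); apply: memv_span.
  by apply/flatten_mapP; exists x.
have V1 : (V <= <<[seq x.1 | x <- cs]>> + shl a @: V)%VS.
  rewrite -{1}(span_basis bV); apply/span_subvP => w /mem_vecs [x xc wx].
  apply: (@chain_sub_heads V _ a x.1 x.2); rewrite ?addvSr //; last exact: csV.
  by apply: (subvP (addvSl _ _)); apply: memv_span; apply: map_f.
have sR : (size cs <= \dim (U :&: lker (shl a)))%N.
  apply: leq_trans sb _; apply: leq_trans (am b I).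
  by apply: dimvS; apply: capvS => //; apply: shl_sub.
have ccl' x : x \in cs ++ [::] -> closed_chain x by rewrite cats0 => /ccl.
have [cs' [bU cU sz sh]] := extend_chains sU bV' ccl' V1 sR.
exists cs', (a :: ts), a; split=> //; last by rewrite sz addn0.
move=> x xc; case: (sh x xc) => [//|[s [-> [->|[h hc]]]]]; first by rewrite /= take0.
by have [_ /= sE] := cst _ hc; split=> //=; rewrite -sE.
Qed.

Fixpoint boxes (v : vT) (s : seq k) (c : nat) : seq (vT * k * nat * bool) :=
  if s is a :: s' then (v, a, c, s' != [::]) :: boxes (shl a v) s' c.+1 else [::].

Definition allboxes cs := flatten [seq boxes x.1 x.2 0 | x <- cs].

(* [prev] is what the previous box predicts for the next one; [None] at the
   beginning of a row. *)
Fixpoint linked (q : rel k) (prev : option (vT * k * nat)) (L : seq (vT * k * nat * bool)) : Prop :=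
  if L is x :: L' then
    let: (v, a, c, e) := x in
    [/\ (if prev is Some (v', a', c') then [/\ v = v', q a' a & c = c'] else c = 0%N),
        (~~ e -> shl a v = 0) &
        linked q (if e then Some (shl a v, a, c.+1) else None) L']
  else prev = None.

Lemma linked_boxes q L v s c p : s != [::] -> sorted q s -> chend v s = 0 -> linked q None L ->
  (if p is Some (v', a', c') then [/\ v = v', q a' (head 0 s) & c = c'] else c = 0%N) ->
  linked q p (boxes v s c ++ L).
Proof.
elim: s v c p => [|a s IH] v c p //= _ ps cv LL hp; split=> //.
  by rewrite negbK => /eqP s0; move: cv; rewrite s0.
case: s IH ps cv => [|b s] IH ps cv //=.
apply: (IH (shl a v) c.+1 (Some (shl a v, a, c.+1))) => //=.
  by case/andP: ps.
by case/andP: ps.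
Qed.

Lemma linked_allboxes q cs : (forall x, x \in cs -> closed_chain x) ->
  (forall x, x \in cs -> x.2 != [::] /\ sorted q x.2) -> linked q None (allboxes cs).
Proof.
elim: cs => [|x cs IH] ccl cq //=.
have [xn xq] := cq x (mem_head _ _).
apply: linked_boxes => //; first by apply: ccl; rewrite mem_head.
by apply: IH => y yc; [apply: ccl|apply: cq]; rewrite inE yc orbT.
Qed.

Let d0 : vT * k * nat * bool := (0, 0, 0%N, false).

Lemma linked_nth q p L i : linked q p L -> (i < size L)%N ->
  let: (v, a, c, e) := nth d0 L i in
  (if e then (i.+1 < size L)%N /\ (let: (v', a', c', e') := nth d0 L i.+1 in
      [/\ v' = shl a v, q a a' & c' = c.+1]) else shl a v = 0) /\
  ((0 < c)%N -> (i = 0%N /\ p <> None) \/ (0 < i)%N /\ (nth d0 L i.-1).2).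
Proof.
elim: L i p => [|[[[v a] c] e] L IH] i p //= [hp he LL].
case: i => [_|i].
  split; last first.
    by move=> c0; left; split=> //; case: p hp => // hp; rewrite hp in c0.
  case: e he LL => [_|/(_ isT) //].
  case: L {IH} => [//|[[[v' a'] c'] e'] L] /= [[-> -> ->] _ _].
  by split.
rewrite ltnS => iL; have := IH i _ LL iL.
rewrite -[nth d0 (_ :: L) i.+1]/(nth d0 L i).
case: (nth d0 L i) => [[[v1 a1] c1] e1] [h1 h2]; split.
  by case: e1 h1 {h2} => // [[h11 h12]]; split=> //; rewrite ltnS.
move=> c0; right; split=> //; case: (h2 c0) => [[-> pn]|[i0 h]] /=.
  by case: e pn {h2 LL he}.
by case: i i0 h {iL h1 h2}.
Qed.

Lemma boxes_vecs cs : [seq x.1.1.1 | x <- allboxes cs] = vecs cs.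
Proof.
elim: cs => [|x cs IH] //=; rewrite /allboxes /= map_cat -/(allboxes cs) IH.
rewrite /vecs /=; congr (_ ++ _); case: x => v s /=.
suff h c : [seq x.1.1.1 | x <- boxes v s c] = chain v s by apply: h.
by elim: s v c => [|a s IHs] v c //=; rewrite IHs.
Qed.

(** [q] constrains consecutive scalars of a row, and [Q] ties a scalar to its column: with [q]
    equality the result is the classical form, and with [Q] reading the scalars off one list it is
    X_t. *)
Lemma chains_jordan q (Q : k -> nat -> Prop) cs : basis_of fullv (vecs cs) ->
  (forall x, x \in cs -> closed_chain x) ->
  (forall x, x \in cs -> x.2 != [::] /\ sorted q x.2) ->
  (forall x, x \in cs -> forall i, (i < size x.2)%N -> Q (nth 0 x.2 i) i) ->
  exists lam (e : 'I_n -> bool) (c : 'I_n -> nat), [/\ Defs.similar X (jordan_mx lam e),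
    columns e c, forall i j, lk e i j -> q (lam i) (lam j) & forall i, Q (lam i) (c i)].
Proof.
move=> bF ccl cq cQ.
pose L := allboxes cs; have LL := linked_allboxes ccl cq; rewrite -/L in LL.
have szL : size L = n.
  rewrite -(size_map (fun x => x.1.1.1)) boxes_vecs -(eqP (basis_free bF)) (span_basis bF).
  by rewrite dimvf /dim /= mul1n.
have iL (i : 'I_n) : (i < size L)%N by rewrite szL.
pose b (i : 'I_n) := nth d0 L i.
exists (fun i => (b i).1.1.2), (fun i => (b i).2), (fun i => (b i).1.2).
have lkE (i j : 'I_n) : lk (fun i => (b i).2) i j ->
    [/\ (b j).1.1.1 = shl (b i).1.1.2 (b i).1.1.1, q (b i).1.1.2 (b j).1.1.2 &
        (b j).1.2 = (b i).1.2.+1].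
  case/andP => /eqP ji; have := linked_nth LL (iL i); rewrite -/(b i) -ji -/(b j).
  case: (b i) => [[[v a] c] e]; case: (b j) => [[[v' a'] c'] e'] /= [h _] et.
  by rewrite et in h; case: h.
split.
- pose P : 'M[k]_n := \matrix_i (b i).1.1.1.
  have uP : P \in unitmx.
    rewrite -row_full_unit -sub1mx; apply/row_subP => j.
    have := memvf (row j (1%:M : 'M[k]_n)); rewrite -(span_basis bF).
    have Pv w : w \in vecs cs -> (w <= P)%MS.
      rewrite -boxes_vecs => /mapP [x /(nthP d0) [i iLt <-] ->].
      rewrite -/L szL in iLt; have := row_sub (Ordinal iLt) P; rewrite rowK /b /=.
      by [].
    rewrite -[vecs cs]/(in_tuple (vecs cs) : seq vT) => /coord_span ->.
    apply: summx_sub => i _; apply: scalemx_sub; apply: Pv.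
    by apply: mem_nth; apply: ltn_ord.
  exists P; split=> //; apply: (can_inj (mulKmx uP)).
  rewrite !mulmxA mulmxV // mul1mx; apply/row_matrixP => i.
  rewrite !row_mul rowK [RHS]mulmx_sum_row (bigD1 i) //= [row i _ 0 i]mxE mxE eqxx rowK.
  have := linked_nth LL (iL i); rewrite -/(b i).
  have shE : (b i).1.1.1 *m X = (b i).1.1.2 *: (b i).1.1.1 + shl (b i).1.1.2 (b i).1.1.1.
    by rewrite shlE mulmxBr mul_mx_scalar addrC subrK.
  rewrite {}shE => h; congr (_ + _).
  have [bi|bi] := boolP (b i).2; last first.
    rewrite big1; first by move: bi h; case: (b i) => [[[v a] c] []] //= _ [].
    move=> j ji; rewrite !mxE eq_sym (negbTE ji) (negbTE bi) andbF scale0r //.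
  have iS : (i.+1 < n)%N.
    by rewrite -[X in (_ < X)%N]szL; move: bi h; case: (b i) => [[[v a] c] []] //= _ [[]].
  have lij : lk (fun i => (b i).2) i (Ordinal iS) by rewrite /lk eqxx.
  rewrite (bigD1 (Ordinal iS)) //=; last by rewrite -val_eqE /= neq_ltn ltnSn orbT.
  rewrite big1 ?addr0; last first.
    move=> j /andP [ji jS]; rewrite !mxE eq_sym (negbTE ji).
    by rewrite (_ : (j : nat) == i.+1 = false) ?scale0r //; apply/negbTE.
  rewrite !mxE eq_sym -val_eqE /= (_ : (i.+1 == i) = false); last by lia.
  by rewrite eqxx bi scale1r rowK; case: (lkE _ _ lij).
- split=> [i j /lkE [] //|j cj].
  have := linked_nth LL (iL j); rewrite -/(b j); move: cj.
  case: (b j) => [[[v a] c] e] /= c0 [_ /(_ c0) [[_ //]|[j0 bj]]].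
  have jn : (j.-1 < n)%N by have := ltn_ord j; lia.
  by exists (Ordinal jn); rewrite /lk /= prednK // eqxx.
- by move=> i j /lkE [].
move=> i; have : b i \in L by apply: mem_nth.
rewrite /L /allboxes => /flatten_mapP [x xc]; have := cQ x xc.
case: x {xc} => v s /=.
have gen s' v' c0 : (forall j, (j < size s')%N -> Q (nth 0 s' j) (c0 + j)%N) ->
    b i \in boxes v' s' c0 -> Q (b i).1.1.2 (b i).1.2.
  elim: s' v' c0 => [|a s' IH] v' c0 //= h; rewrite inE => /orP [/eqP ->|] /=.
    by have := h 0%N isT; rewrite addn0.
  by apply: IH => j js; have := h j.+1 js; rewrite addnS.
by move=> h; apply: gen => j; rewrite add0n; apply: h.
Qed.

End Chains.

Lemma stable_full (k : closedFieldType) n (X : 'M[k]_n) : stable_sp X fullv.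
Proof. by move=> v _; apply: memvf. Qed.

Theorem jordan_form (k : closedFieldType) n (X : 'M[k]_n) :
  exists lam e, jordan_data lam e /\ Defs.similar X (jordan_mx lam e).
Proof.
have [cs [bF ccl cst]] := jordan_chains (stable_full X).
have [||lam [e [c [sX _ q _]]]] := @chains_jordan _ _ _ eq_op (fun _ _ => True) cs bF ccl.
- move=> x /cst [m [a ->]]; split=> //=.
  by elim: m => //= m IH; rewrite eqxx.
- by [].
exists lam, e; split=> // i j ij ei; apply/eqP; apply: q.
by rewrite /lk ij eqxx.
Qed.

Theorem uniform_form (k : closedFieldType) n (X : 'M[k]_n) :
  exists (e : 'I_n -> bool) c (t : nat -> k), columns e c /\ Defs.similar X (cmx e c t).
Proof.
have [cs [ts [b [bF ccl cst _]]]] := uniform_chains (stable_full X).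
have [||lam [e [c [sX Hc _ q]]]] := @chains_jordan _ _ _ (fun _ _ => true)
  (fun a i => a = nth 0 ts i) cs bF ccl.
- move=> x /cst [xn _]; split=> //; case: (x.2) => //= a s.
  by elim: s a => //= a' s IH a.
- by move=> x /cst [_ xE] i ix; rewrite xE nth_take.
exists e, c, (nth 0 ts); split=> //.
case: sX => P [uP ->]; exists P; split=> //; congr (_ *m _ *m _).
by apply/matrixP => i j; rewrite !mxE q.
Qed.

(** * Ranks of powers and diagonalization *)

Section Similar.
Variables (k : closedFieldType) (n : nat).
Implicit Types A B C : 'M[k]_n.
Notation sim := (@Defs.similar k n).

Lemma sim_refl A : sim A A.
Proof. by exists 1%:M; rewrite unitmx1 invmx1 mul1mx mulmx1. Qed.

Lemma sim_sym A B : sim A B -> sim B A.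
Proof.
move=> [P [uP ->]]; exists (invmx P); rewrite unitmx_inv invmxK; split=> //.
by rewrite -mulmxA mulmxK // mulKVmx.
Qed.

Lemma sim_intro P A B : P \in unitmx -> P *m A = B *m P -> sim A B.
Proof. by move=> uP PA; exists P; split=> //; rewrite -mulmxA -PA mulKmx. Qed.

Lemma sim_trans A B C : sim A B -> sim B C -> sim A C.
Proof.
move=> [P [uP ->]] [Q [uQ ->]]; apply: (@sim_intro (Q *m P)); first by rewrite unitmx_mul uQ.
by rewrite !mulmxA mulmxK // mulmxV // mul1mx.
Qed.

Lemma sim_tr A B : sim A B -> sim A^T B^T.
Proof.
move=> [P [uP ->]]; exists (invmx P^T); rewrite unitmx_inv unitmx_tr invmxK uP; split=> //.
by rewrite !trmx_mul trmx_inv mulmxA.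
Qed.

Lemma sim_affine (a b : k) A B : sim A B -> sim (a%:M + b *: A) (a%:M + b *: B).
Proof.
move=> [P [uP ->]]; exists P; split=> //; rewrite mulmxDr mulmxDl -scalemxAr -scalemxAl.
by rewrite scalar_mxC -[a%:M *m _ *m _]mulmxA mulVmx // mulmx1.
Qed.

Lemma sim_rank_exp a p A B : sim A B -> \rank ((A - a%:M) ^+ p) = \rank ((B - a%:M) ^+ p).
Proof.
move=> [P [uP AE]].
have -> : (A - a%:M) ^+ p = invmx P *m (B - a%:M) ^+ p *m P.
  elim: p => [|p IH]; first by rewrite !expr0 mulmx1 mulVmx.
  rewrite !exprS -!mulmxE IH AE mulmxA; congr (_ *m _).
  rewrite mulmxBl !mulmxA mulmxK // mulmxBr mulmxBl scalar_mxC //.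
rewrite mxrankMfree ?row_free_unit //; apply: eqmx_rank.
by apply/eqmxP; apply: eqmxMfull; rewrite row_full_unit unitmx_inv.
Qed.

Lemma trmx_exp A p : (A ^+ p)^T = A^T ^+ p.
Proof.
elim: p => [|p IH]; first by rewrite !expr0 trmx1.
by rewrite exprS exprSr -!mulmxE trmx_mul IH.
Qed.

End Similar.

Section Labels.
Variables (k : closedFieldType) (n : nat) (e : 'I_n -> bool).

Lemma jordan_mxE (lam : 'I_n -> k) i j :
  jordan_mx lam e i j = lam i * (i == j)%:R + (lk e i j)%:R.
Proof.
rewrite mxE /lk; case: (eqVneq i j) => [->|ij].
  by rewrite -[_ == _.+1]negbK neq_ltn ltnSn /= addr0 mulr1.
by case: ifP; rewrite mulr0 add0r.
Qed.

Lemma columns_ex : exists c, columns e c.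
Proof.
pose fix pos m := if m is m'.+1 then
  (if insub m' is Some i then (if e i then (pos m').+1 else 0%N) else 0%N) else 0%N.
exists (fun i => pos i); split=> [i j /andP [/eqP -> ei]|j] /=; first by rewrite valK ei.
case: j => [[|m] Hm] //=; case: insubP => // i _ iE; case: ifP => // ei _.
by exists i; rewrite /lk /= iE eqxx.
Qed.

Variable c : 'I_n -> nat.
Hypothesis Hc : columns e c.

Lemma row_jordan (lam : 'I_n -> k) a i :
  (forall j, ~~ lk e i j) -> row i (jordan_mx lam e - a%:M) = (lam i - a) *: delta_mx 0 i.
Proof.
move=> il; apply/rowP => j; rewrite mxE [LHS]mxE jordan_mxE !mxE (negbTE (il j)) addr0.
by rewrite mulrBl [j == i]eq_sym; case: eqP => _; rewrite ?mulr1 ?mulr0.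
Qed.

Lemma row_jordan_lk (lam : 'I_n -> k) a i j : lk e i j ->
  row i (jordan_mx lam e - a%:M) = (lam i - a) *: delta_mx 0 i + delta_mx 0 j.
Proof.
move=> ij; apply/rowP => l; rewrite mxE [LHS]mxE jordan_mxE !mxE /= [l == i]eq_sym.
rewrite addrAC; congr (_ + _%:R).
  by case: eqP => _; rewrite ?mulr1 ?mulr0 ?subr0.
have [il|/negP il] := boolP (lk e i l); first by rewrite (lk_fun il ij) eqxx.
by case: eqP => // lj; rewrite lj in il.
Qed.

Lemma lk_dec i : (exists j, lk e i j) \/ forall j, ~~ lk e i j.
Proof.
have [/existsP h|/existsPn h] := boolP [exists j, lk e i j]; by [left|right].
Qed.

(** The row space of the power is the coordinate space on the boxes counted: on blocks for [a] each
    factor moves boxes one column on, and on the other blocks it is invertible. *)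
Lemma rank_jordan_exp (lam : 'I_n -> k) a p : jordan_data lam e ->
  \rank ((jordan_mx lam e - a%:M) ^+ p) = #|[pred i | (lam i != a) || (p <= c i)%N]|.
Proof.
move=> jd; set Y := jordan_mx lam e - a%:M.
have lamE i j : lk e i j -> lam i = lam j by move=> /andP [/eqP ji ei]; apply: jd.
pose S m := [pred i | (lam i != a) || (m <= c i)%N].
suff h q : (Y ^+ q :=: dg k (S q))%MS by rewrite h rank_dg.
elim: q => [|q IH].
  rewrite expr0 (_ : dg k _ = 1%:M) //; apply/matrixP => i j; rewrite !mxE /= orbT.
  by case: eqP.
rewrite exprSr -mulmxE; apply: eqmx_trans (eqmxMr Y IH) _.
apply/eqmxP/andP; split.
  apply/sub_dgP => i j; rewrite /S /= negb_or negbK -ltnNge => /andP [/eqP lj cj].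
  rewrite mul_diag_mx mxE [Y i j]mxE jordan_mxE !mxE.
  have -> : lam i * (i == j)%:R + (lk e i j)%:R - a *+ (i == j) =
      (lam i - a) * (i == j)%:R + (lk e i j)%:R.
    by rewrite mulrBl addrAC mulr_natr mulr_natr.
  case: (boolP (lk e i j)) => [ij|_]; last first.
    rewrite addr0; case: eqP => [->|_]; first by rewrite lj subrr mul0r mulr0.
    by rewrite !mulr0.
  have -> : S q i = false; last by rewrite mul0r.
  by have := Hc.1 _ _ ij; rewrite /S /= (lamE _ _ ij) lj eqxx /=; lia.
apply/row_subP => j; have [Sj|Sj] := boolP (S q.+1 j); last first.
  rewrite (_ : row j _ = 0) ?sub0mx //; apply/rowP => l; rewrite !mxE (negbTE Sj).
  by rewrite mul0rn.
have -> : row j (dg k (S q.+1)) = delta_mx 0 j.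
  by apply/rowP => l; rewrite !mxE Sj eq_sym.
have SY i : S q i -> (row i Y <= dg k (S q) *m Y)%MS.
  move=> Si; rewrite (_ : row i Y = row i (dg k (S q) *m Y)) ?row_sub //.
  by apply/rowP => l; rewrite mxE [RHS]mxE dg_mul Si.
have [m] := ubnP (n - j); elim: m j Sj => // m IHm j Sj mj.
have [lj|lj] := eqVneq (lam j) a.
  have cj : (q < c j)%N by case/orP: Sj => //; rewrite lj eqxx.
  have [|i ij] := Hc.2 j; first by apply: leq_ltn_trans cj.
  have Si : S q i by apply/orP; right; move: cj; rewrite (Hc.1 _ _ ij).
  by have := SY i Si; rewrite (row_jordan_lk _ _ ij) (lamE _ _ ij) lj subrr scale0r add0r.
have Sqj : S q j by rewrite /S /= lj.
have dj : (delta_mx 0 j : 'rV[k]_n) = (lam j - a)^-1 *: ((lam j - a) *: delta_mx 0 j).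
  by rewrite scalerA mulVf ?scale1r // subr_eq0.
case: (lk_dec j) => [[l jl]|jl]; last first.
  by rewrite dj scalemx_sub // -(row_jordan _ _ jl) SY.
rewrite dj scalemx_sub // -[_ *: _](addrK (delta_mx 0 l)) -(row_jordan_lk lam a jl).
rewrite addmx_sub ?SY // eqmx_opp IHm //; first by rewrite /S /= -(lamE _ _ jl) lj.
case/andP: jl => /eqP -> _; have := ltn_ord j; lia.
Qed.

Variable t : nat -> k.

(** For [a = t (c i)], the number [rep a 0 (c i)] is the position that box [i] takes in the
    partition attached to the eigenvalue [a]. *)
Definition rep a m p := count (fun l => t l == a) (index_iota m p).

Lemma rep_cons a m p : (m < p)%N -> rep a m p = ((t m == a) + rep a m.+1 p)%N.
Proof. by move=> mp; rewrite /rep /index_iota -(subnSK mp). Qed.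

(** Descending induction on [m]. If [t m] is [a], one factor carries [from m] onto [from m.+1].
    Otherwise the kernel of the shift by [t m] on [from m] is an eigenspace where X - a acts by a
    nonzero scalar, and it contributes its full dimension [csize c m]. *)
Lemma rank_from_exp a m p :
  \rank (from k c m *m (cmx e c t - a%:M) ^+ p) =
  #|[pred i | (m <= c i)%N && ~~ ((t (c i) == a) && (rep a m (c i) < p)%N)]|.
Proof.
have [nm|mn] := leqP n m.
  rewrite (from_big k Hc nm) mul0mx mxrank0 eq_card0 // => i; rewrite !inE.
  by have := col_lt Hc i; lia.
rewrite -(subKn (ltnW mn)); move: (n - m)%N (leq_subr m n) => q {mn m}.
elim: q p => [|q IH] p qn.
  rewrite subn0 (from_big k Hc) // mul0mx mxrank0 eq_card0 // => i; rewrite !inE.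
  by have := col_lt Hc i; lia.
set m := (n - q.+1)%N; have mS : (n - q)%N = m.+1 by rewrite /m; lia.
have {}IH p' := IH p' (ltnW qn); rewrite mS in IH.
set Q := cmx e c t - a%:M.
have [tm|tm] := eqVneq (t m) a.
  case: p => [|p].
    rewrite expr0 mulmx1 rank_dg; apply: eq_card => i; rewrite !inE ltn0 andbF.
    by rewrite andbT.
  have -> : \rank (from k c m *m Q ^+ p.+1) = \rank (from k c m.+1 *m Q ^+ p).
    apply: eqmx_rank; apply/eqmxP; rewrite exprS -mulmxE mulmxA; apply: eqmxMr.
    by rewrite /Q -tm; apply: shift_from.
  rewrite IH; apply: eq_card => i; rewrite !inE.
  have [cm|cm] := ltnP m (c i); last first.
    have [cm'|cm'] := leqP m (c i); rewrite ?andbF //.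
    have -> : c i = m by lia.
    by rewrite tm eqxx /rep /index_iota subnn.
  by rewrite (ltnW cm) (rep_cons _ cm) tm eqxx add1n ltnS.
have com : comm_mx (Q ^+ p) (shifted e c t m).
  rewrite /shifted (_ : _ - _ = Q + (a - t m)%:M); last first.
    by rewrite /Q raddfB /= addrA subrK.
  rewrite /comm_mx mulmxDr mulmxDl scalar_mxC; congr (_ + _).
  by rewrite mulmxE -exprS -exprSr.
have h1 := mxrank_mul_ker (from k c m *m Q ^+ p) (shifted e c t m).
have h2 : \rank (from k c m *m Q ^+ p *m shifted e c t m) = \rank (from k c m.+1 *m Q ^+ p).
  rewrite -mulmxA com mulmxA; apply: eqmx_rank; apply/eqmxP; apply: eqmxMr.
  exact: shift_from.
have h3 : \rank (from k c m *m Q ^+ p :&: kermx (shifted e c t m))%MS = csize c m.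
  rewrite -(rank_from_ker Hc t m); apply: eqmx_rank; apply/andP; split.
    rewrite sub_capmx capmxSr andbT; apply: submx_trans (capmxSl _ _) _.
    have st A : (A <= from k c m)%MS -> (A *m Q <= from k c m)%MS.
      move=> Am; rewrite (_ : Q = shifted e c t m + (t m - a)%:M); last first.
        by rewrite /shifted raddfB /= addrA subrK.
      rewrite mulmxDr addmx_sub ?mul_mx_scalar ?scalemx_sub //.
      by apply: submx_trans (from_shifted Hc t Am) (fromS _ _ (leqnSn m)).
    elim: (p) => [|p' IHp]; first by rewrite expr0 mulmx1.
    by rewrite exprSr -mulmxE mulmxA st.
  rewrite sub_capmx capmxSr andbT.
  set R := (from k c m :&: _)%MS.
  have RQ : R *m Q ^+ p = (t m - a) ^+ p *: R.
    elim: (p) => [|p' IHp]; first by rewrite !expr0 mulmx1 scale1r.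
    rewrite !exprSr -mulmxE mulmxA IHp -scalemxAl -scalerA; congr (_ *: _).
    rewrite (_ : Q = shifted e c t m + (t m - a)%:M); last first.
      by rewrite /shifted raddfB /= addrA subrK.
    rewrite mulmxDr mul_mx_scalar (sub_kermxP _) ?add0r //.
    exact: capmxSr.
  have -> : R = (t m - a) ^- p *: (R *m Q ^+ p).
    by rewrite RQ scalerA mulVf ?scale1r // expf_neq0 // subr_eq0.
  by rewrite scalemx_sub // submxMr // capmxSl.
rewrite -h1 h2 h3 IH /csize -cardUI [X in (_ + X)%N](_ : _ = 0%N) ?addn0; last first.
  by apply: eq_card0 => i; rewrite !inE; lia.
apply: eq_card => i; rewrite !inE.
have [cm|cm] := ltnP m (c i).
  by rewrite (ltnW cm) (rep_cons _ cm) (negbTE tm) add0n gtn_eqF //= orbF.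
have [->|cm'] := eqVneq (c i) m; first by rewrite (negbTE tm) leqnn.
by rewrite (_ : (m <= c i)%N = false) //; lia.
Qed.

Lemma rank_cmx_exp a p : \rank ((cmx e c t - a%:M) ^+ p) =
  #|[pred i | ~~ ((t (c i) == a) && (rep a 0 (c i) < p)%N)]|.
Proof.
have := rank_from_exp a 0 p; rewrite (_ : from k c 0 = 1%:M) ?mul1mx //.
by apply/matrixP => i j; rewrite !mxE; case: eqP.
Qed.

Lemma rep_inj p p' : t p = t p' -> rep (t p) 0 p = rep (t p') 0 p' -> p = p'.
Proof.
have lt x y : (x < y)%N -> t x = t y -> (rep (t x) 0 x < rep (t y) 0 y)%N.
  move=> xy txy; rewrite /rep txy /index_iota !subn0.
  have -> : iota 0 y = iota 0 x ++ x :: iota x.+1 (y - x.+1).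
    have := iotaD 0 x (y - x.+1).+1; rewrite add0n.
    by rewrite (_ : x + (y - x.+1).+1 = y)%N // addnS -addSn subnKC.
  by rewrite count_cat -cat1s count_cat /= txy eqxx addn0 add1n addnS ltnS leq_addr.
move=> tp rp; case: (ltngtP p p') => // h.
  by have := lt _ _ h tp; rewrite rp ltnn.
by have := lt _ _ h (esym tp); rewrite rp ltnn.
Qed.

End Labels.

Lemma closed_notin (k : closedFieldType) (s : seq k) : exists x, x \notin s.
Proof.
pose p : {poly k} := \prod_(a <- s) ('X - a%:P).
have [p0|p0] := classic (exists x, ~~ root p x).
  by case: p0 => x; rewrite root_prod_XsubC; exists x.
have : p = 0.
  apply: poly_fun0 => x; apply/eqP; apply: contraT => px.
  by case: p0; exists x.
by move/eqP; rewrite (negbTE (monic_neq0 (monic_prod_XsubC _ _ _))).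
Qed.

Lemma closed_injection (k : closedFieldType) m :
  exists w : nat -> k, forall i j, (i < m)%N -> (j < m)%N -> w i = w j -> i = j.
Proof.
have [s us ss] : exists2 s : seq k, uniq s & size s = m.
  elim: m => [|m [s us ss]]; first by exists [::].
  by have [x xs] := closed_notin s; exists (x :: s); rewrite /= ?xs ?ss.
exists (nth 0 s) => i j im jm /eqP; rewrite nth_uniq ?ss //.
by move/eqP.
Qed.

Section Diagonalization.
Variables (k : closedFieldType) (n : nat) (e : 'I_n -> bool) (c : 'I_n -> nat).
Hypothesis Hc : columns e c.
Variable val : 'I_n -> k.
Hypothesis val_col : forall i j, val i = val j -> c i = c j.

Lemma triangular_solve i l : (c i < c l)%N -> exists w : 'rV[k]_n,
  (forall j : 'I_n, (j < l)%N -> w 0 j = 0) /\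
  w *m (jordan_mx val e - (val i)%:M) = delta_mx 0 l.
Proof.
have [m] := ubnP (n - l); elim: m l => // m IH l ml cl.
have vl : val l - val i != 0.
  by rewrite subr_eq0; apply/eqP => /val_col h; rewrite h ltnn in cl.
have dl (j : 'I_n) : (j < l)%N -> (delta_mx 0 l : 'rV[k]_n) 0 j = 0.
  by move=> jl; rewrite mxE eqxx -val_eqE /= ltn_eqF.
case: (lk_dec e l) => [[l' ll']|nl]; last first.
  exists ((val l - val i)^-1 *: delta_mx 0 l); split=> [j jl|].
    by rewrite mxE dl ?mulr0.
  by rewrite -scalemxAl -rowE row_jordan // scalerA mulVf ?scale1r.
have lS : (l' : nat) = l.+1 by case/andP: ll' => /eqP.
have [||w [w0 wE]] := IH l'.
- by have := ltn_ord l; lia.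
- by rewrite (Hc.1 _ _ ll'); apply: leq_trans cl _.
exists ((val l - val i)^-1 *: (delta_mx 0 l - w)); split=> [j jl|].
  by rewrite mxE [_ 0 j]mxE dl // [(- w) 0 j]mxE w0 ?subr0 ?mulr0 // lS; apply: ltnW.
rewrite -scalemxAl mulmxBl wE -rowE (row_jordan_lk _ _ ll') addrK.
by rewrite scalerA mulVf ?scale1r.
Qed.

(** By [val_col] the values along a block are pairwise distinct. Every box then has an eigenvector
    with leading entry 1, and these form a unitriangular matrix. *)
Lemma jordan_diag : Defs.similar (jordan_mx val e) (jordan_mx val (fun=> false)).
Proof.
have ex i : exists g : 'rV[k]_n, [/\ g 0 i = 1, forall j : 'I_n, (j < i)%N -> g 0 j = 0 &
    g *m jordan_mx val e = val i *: g].
  have eig g : g *m (jordan_mx val e - (val i)%:M) = 0 -> g *m jordan_mx val e = val i *: g.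
    by rewrite mulmxBr mul_mx_scalar => /eqP; rewrite subr_eq0 => /eqP.
  case: (lk_dec e i) => [[l il]|ni]; last first.
    exists (delta_mx 0 i); split; first by rewrite mxE !eqxx.
      by move=> j ji; rewrite mxE eqxx -val_eqE /= ltn_eqF.
    by apply: eig; rewrite -rowE row_jordan // subrr scale0r.
  have lS : (l : nat) = i.+1 by case/andP: il => /eqP.
  have [|w [w0 wE]] := @triangular_solve i l; first by rewrite (Hc.1 _ _ il).
  exists (delta_mx 0 i - w); split.
  - by rewrite mxE [(- w) 0 i]mxE w0 ?subr0 ?lS // mxE !eqxx.
  - move=> j ji; rewrite mxE [(- w) 0 j]mxE w0 ?subr0 ?mxE ?lS 1?ltnW //.
    by rewrite eqxx -val_eqE /= ltn_eqF.
  by apply: eig; rewrite mulmxBl wE -rowE (row_jordan_lk _ _ il) subrr scale0r add0r subrr.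
have [g gE] := fin_all_exists ex.
pose G : 'M[k]_n := \matrix_i g i.
have uG : G \in unitmx.
  rewrite unitmxE -det_tr det_trig.
    by rewrite big1 ?unitr1 // => i _; rewrite !mxE; case: (gE i).
  apply/is_trig_mxP => i j ij; rewrite !mxE.
  by case: (gE j) => _ h _; apply: h.
apply: (sim_intro uG); apply/row_matrixP => i; rewrite !row_mul rowK.
case: (gE i) => _ _ ->; rewrite mulmx_sum_row (bigD1 i) //= !mxE eqxx rowK.
rewrite big1 ?addr0 // => j ji; rewrite !mxE eq_sym (negbTE ji) andbF scale0r //.
Qed.

End Diagonalization.

Section Closure.
Variables (k : closedFieldType) (n : nat).

Lemma diag_perm (v : 'I_n -> k) (s : 'S_n) :
  Defs.similar (jordan_mx (fun i => v (s i)) (fun=> false)) (jordan_mx v (fun=> false)).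
Proof.
apply: sim_sym; apply: (@sim_intro _ _ (perm_mx s)); first exact: unitmx_perm.
have dE (w : 'I_n -> k) : jordan_mx w (fun=> false) = diag_mx (\row_i w i).
  by apply/matrixP => i j; rewrite !mxE andbF; case: eqP.
rewrite !dE; apply/matrixP => i j; rewrite mul_mx_diag mul_diag_mx !mxE.
by case: eqP => [->|_]; rewrite ?mulr1 ?mul1r ?mulr0 ?mul0r.
Qed.

(** A polynomial vanishing on [D] vanishes along the curve away from the zeros of [g], hence
    identically. *)
Lemma closure_line (D : 'M[k]_n -> Prop) (M : k -> 'M[k]_n) (g : {poly k}) s0 :
  (forall i j, upoly (fun s => M s i j)) -> g != 0 -> (forall s, g.[s] != 0 -> D (M s)) ->
  tclosure (@mx_closed k n) D (M s0).
Proof.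
move=> Mp g0 gD C [P CE] DC; apply/CE => p Pp.
have [q qE] : upoly (fun s => p.@[fun i => mxvec (M s) 0 i]).
  apply: upoly_meval => i; case/mxvec_indexP: i => a b.
  by apply: upoly_ext (Mp a b) => s; rewrite mxvecE.
suff q0 : q = 0 by rewrite qE q0 horner0.
have : q * g = 0.
  apply: poly_fun0 => s; rewrite hornerM -qE.
  have [->|gs] := eqVneq g.[s] 0; first by rewrite mulr0.
  by have /CE -> := DC _ (gD s gs); rewrite ?mul0r.
by move/eqP; rewrite mulf_eq0 (negbTE g0) orbF => /eqP.
Qed.

End Closure.

(** * Centralizers *)

Section CentDim.
Variables (k : closedFieldType) (n : nat).
Implicit Types A B : 'M[k]_n.

Definition commutator A B := A *m B - B *m A.

Lemma commutator_linear A : linear (commutator A).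
Proof.
move=> a B C; rewrite /commutator mulmxDr mulmxDl -scalemxAr -scalemxAl scalerBr.
by rewrite opprD addrACA.
Qed.

HB.instance Definition _ A :=
  GRing.isLinear.Build k 'M[k]_n 'M[k]_n _ (commutator A) (commutator_linear A).

Lemma mem_cent A B :
  (B \in lker (linfun (fun B : 'M[k]_n => A *m B - B *m A))) = (A *m B == B *m A).
Proof. by rewrite memv_ker -[linfun _]/(linfun (commutator A)) lfunE /= subr_eq0. Qed.

Lemma cent_dim_le A B (f : 'M[k]_n -> 'M[k]_n) : linear f ->
  (forall C, A *m C = C *m A -> B *m f C = f C *m B) ->
  (forall C, A *m C = C *m A -> f C = 0 -> C = 0) -> (cent_dim A <= cent_dim B)%N.
Proof.
move=> lf fc fi.
pose fL : {linear 'M[k]_n -> 'M[k]_n} := HB.pack f (GRing.isLinear.Build k _ _ _ f lf).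
rewrite /cent_dim; set U := lker _; set V := lker _.
have UE C : C \in U -> A *m C = C *m A by rewrite mem_cent => /eqP.
have <- : \dim (linfun fL @: U) = \dim U.
  apply: limg_dim_eq; apply/eqP; rewrite -subv0; apply/subvP => C.
  rewrite memv_cap memv_ker lfunE memv0 => /andP [/UE CU /eqP fC].
  by apply/eqP; apply: fi.
apply: dimvS; apply/subvP => _ /memv_imgP [C /UE CU ->].
by rewrite mem_cent lfunE; apply/eqP; apply: fc.
Qed.

Lemma cent_dim_sim A B : Defs.similar A B -> cent_dim A = cent_dim B.
Proof.
have le A' B' : Defs.similar A' B' -> (cent_dim A' <= cent_dim B')%N.
  move=> [P [uP ->]]; apply: (@cent_dim_le _ _ (fun C => P *m C *m invmx P)).
  - by move=> a C D; rewrite mulmxDr mulmxDl -scalemxAr -scalemxAl.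
  - move=> C CE; have := congr1 (fun M => P *m M *m invmx P) CE.
    by rewrite !mulmxA mulmxV // mul1mx mulmxK // => <-; rewrite !mulmxA.
  move=> C _ fC; have := congr1 (fun M => invmx P *m M *m P) fC.
  by rewrite !mulmxA mulVmx // mul1mx mulmxKV // mulmx0 mul0mx.
by move=> AB; apply/eqP; rewrite eqn_leq !le //; apply: sim_sym.
Qed.

Lemma cent_dim_tr A : cent_dim A^T = cent_dim A.
Proof.
have le A' : (cent_dim A' <= cent_dim A'^T)%N.
  apply: (@cent_dim_le _ _ trmx).
  - by move=> a C D; rewrite linearP.
  - by move=> C CE; rewrite -!trmx_mul CE.
  by move=> C _ C0; rewrite -[C]trmxK C0 trmx0.
by apply/eqP; rewrite eqn_leq le andbT -{2}[A]trmxK le.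
Qed.

End CentDim.

Section ColumnCentralizer.
Variables (k : closedFieldType) (n : nat) (e : 'I_n -> bool) (c : 'I_n -> nat).
Hypothesis Hc : columns e c.

(** Blocks occupy consecutive indices, so the first box of the block of [i] is [i - c i]. *)
Definition start (i : 'I_n) : 'I_n := Ordinal (leq_ltn_trans (leq_subr (c i) i) (ltn_ord i)).

Lemma start_lk i j : lk e i j -> start j = start i.
Proof.
move=> ij; apply: val_inj; rewrite /= (Hc.1 _ _ ij).
by case/andP: ij => /eqP -> _; rewrite subSS.
Qed.

Lemma start_id i : c i = 0%N -> start i = i.
Proof. by move=> ci; apply: val_inj; rewrite /= ci subn0. Qed.

Lemma start_ind (P : 'I_n -> Prop) : (forall i, c i = 0%N -> P i) ->
  (forall i j, lk e i j -> P i -> P j) -> forall i, P i.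
Proof.
move=> P0 PS i; have [m] := ubnP (c i); elim: m i => // m IH i ci.
case: (posnP (c i)) => [/P0 //|/(Hc.2) [j ji]]; apply: (PS _ _ ji).
by apply: IH; rewrite (Hc.1 _ _ ji) in ci.
Qed.

Lemma col_start i : c (start i) = 0%N.
Proof.
by move: i; apply: start_ind => [i ci|i j /start_lk ->]; first by rewrite start_id.
Qed.

Definition rowlen s := (\max_(j | start j == s) (c j).+1)%N.

Lemma next_ex i j : start i = start j -> (c i < c j)%N -> exists l, lk e i l.
Proof.
move: j; apply: start_ind => [j -> //|j' j jj IH].
rewrite (start_lk jj) (Hc.1 _ _ jj) ltnS => sij.
rewrite leq_eqVlt => /orP [/eqP cij|/(IH sij) //]; exists j.
suff -> : i = j' by [].
apply: val_inj; have := congr1 val sij; rewrite /= cij.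
by have := col_le Hc i; have := col_le Hc j'; rewrite cij; lia.
Qed.

Lemma rowlen_last i : (forall l, ~~ lk e i l) -> rowlen (start i) = (c i).+1.
Proof.
move=> il; apply/eqP; rewrite eqn_leq; apply/andP; split.
  apply/bigmax_leqP => j /eqP ij; rewrite ltnS leqNgt; apply/negP => cij.
  by have [l ill] := next_ex (esym ij) cij; rewrite (negbTE (il l)) in ill.
by rewrite (@leq_bigmax_cond _ (fun j => start j == start i) (fun j => (c j).+1)) ?eqxx.
Qed.

Section Eigenvalues.
Variable t : nat -> k.

Definition killer m : 'M[k]_n := iteri m (fun l M => M *m shifted e c t l) 1%:M.

Lemma killer_from m : (killer m :=: from k c m)%MS.
Proof.
elim: m => [|m IH] /=.
  by apply/eqmxP; rewrite from0 submx1.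
by apply: eqmx_trans (eqmxMr _ IH) (shift_from Hc t m).
Qed.

Lemma cent_rows (B : 'M[k]_n) : cmx e c t *m B = B *m cmx e c t <->
  (forall i, (forall j, lk e i j -> row j B = row i B *m shifted e c t (c i)) /\
    ((forall j, ~~ lk e i j) -> row i B *m shifted e c t (c i) = 0)).
Proof.
have rE i : row i (B *m cmx e c t - cmx e c t *m B) =
    row i B *m shifted e c t (c i) - row i (shifted e c t (c i)) *m B.
  rewrite raddfB /= !row_mul /shifted mulmxBr raddfB /= mulmxBl.
  rewrite mul_mx_scalar (_ : row i _%:M *m B = t (c i) *: row i B).
    by rewrite opprB addrA subrK.
  by rewrite -row_mul mul_scalar_mx; apply/rowP => j; rewrite !mxE.
have sE i j : lk e i j -> row i (shifted e c t (c i)) *m B = row j B.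
  by move=> ij; rewrite (row_shifted _ _ _ ij) subrr scale0r add0r -rowE.
have zE i : (forall j, ~~ lk e i j) -> row i (shifted e c t (c i)) *m B = 0.
  by move=> il; rewrite (row_jordan (fun i => t (c i)) (t (c i)) il) subrr scale0r mul0mx.
split=> [h i|h].
  have {h} h : row i B *m shifted e c t (c i) = row i (shifted e c t (c i)) *m B.
    by apply/eqP; rewrite -subr_eq0 -rE h subrr; apply/eqP/rowP => j; rewrite !mxE.
  by split=> [j /sE <-|/zE z]; rewrite h.
apply/esym/eqP; rewrite -subr_eq0; apply/eqP/row_matrixP => i; rewrite rE [RHS]linear0.
case: (lk_dec e i) => [[j ij]|il]; first by rewrite (sE i j ij) -((h i).1 j ij) subrr.
by rewrite zE // ((h i).2 il) subrr.
Qed.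

Lemma cent_start (B : 'M[k]_n) : cmx e c t *m B = B *m cmx e c t ->
  forall i, row i B = row (start i) B *m killer (c i).
Proof.
move/cent_rows => h; apply: start_ind => [i ci|i j ij IH].
  by rewrite start_id // ci mulmx1.
by rewrite ((h i).1 j ij) (start_lk ij) (Hc.1 _ _ ij) /= mulmxA -IH.
Qed.

End Eigenvalues.

(* A commuting B is determined by its rows at the starts s of the Jordan rows,
   which may be any vectors killed by [killer t (rowlen s)], and the dimension
   of that kernel does not depend on t. *)
Lemma cent_dim_columns (t t' : nat -> k) : cent_dim (cmx e c t) = cent_dim (cmx e c t').
Proof.
have le (t1 t2 : nat -> k) : (cent_dim (cmx e c t1) <= cent_dim (cmx e c t2))%N; last first.
  by apply/eqP; rewrite eqn_leq !le.
(* Both [killer] products have the rank of [from] at [rowlen s], so an invertible matrix carries one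
   kernel onto the other. *)
have ex s : exists g : 'M[k]_n, g \in unitmx /\
    (kermx (killer t2 (rowlen s)) :=: kermx (killer t1 (rowlen s)) *m g)%MS.
  have rk : \rank (kermx (killer t1 (rowlen s))) = \rank (kermx (killer t2 (rowlen s))).
    by rewrite !mxrank_ker !killer_from.
  by have [g ug gE] := eq_rank_unitmx rk; exists g.
have [g gE] := fin_all_exists ex.
pose f (B : 'M[k]_n) : 'M[k]_n :=
  \matrix_i (row (start i) B *m g (start i) *m killer t2 (c i)).
apply: (@cent_dim_le _ _ _ _ f).
- move=> a B C; apply/row_matrixP => i.
  by rewrite linearP /= !rowK linearP /= !mulmxDl -!scalemxAl.
- move=> B hB; apply/cent_rows => i; split=> [j ij|il].
    by rewrite !rowK (start_lk ij) (Hc.1 _ _ ij) /= mulmxA.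
  rewrite rowK -mulmxA -[_ *m shifted e c t2 (c i)]/(killer t2 (c i).+1).
  rewrite -(rowlen_last il); apply/sub_kermxP; rewrite ((gE (start i)).2) submxMr //.
  apply/sub_kermxP; rewrite rowlen_last //= mulmxA -cent_start //.
  by have /cent_rows h := hB; rewrite ((h i).2 il).
move=> B hB fB; have B0 s : c s = 0%N -> row s B = 0.
  move=> cs; have := congr1 (row s) fB; rewrite rowK start_id // cs mulmx1 linear0 => h.
  by rewrite -[row s B](mulmxK (gE s).1) h mul0mx.
apply/row_matrixP => i; rewrite (cent_start hB) B0 ?col_start // mul0mx.
by rewrite linear0.
Qed.

End ColumnCentralizer.

(** * Degenerations *)

Section JordanAlgebra.
Variables (k : closedFieldType) (n : nat).

Lemma jordan_shift (b : k) (lam : 'I_n -> k) e :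
  jordan_mx (fun i => b + lam i) e = b%:M + jordan_mx lam e.
Proof.
by apply/matrixP => i j; rewrite !mxE; case: eqP => _; rewrite ?mulr1n // mulr0n add0r.
Qed.

Lemma jordan_scale (b : k) (lam : 'I_n -> k) e : b != 0 ->
  Defs.similar (jordan_mx (fun i => b * lam i) e) (b *: jordan_mx lam e).
Proof.
move=> b0; apply: (@sim_intro _ _ (diag_mx (\row_i b ^- i))).
  rewrite unitmxE det_diag unitfE; apply/prodf_neq0 => i _.
  by rewrite mxE invr_neq0 // expf_neq0.
apply/matrixP => i j; rewrite mul_diag_mx mul_mx_diag !mxE.
case: eqP => [->|_]; first by rewrite mulrC.
case: ifP => [/andP [/eqP -> _]|_]; last by rewrite !mulr0 mul0r.
by rewrite !mulr1 exprS invfM mulrA divff // mul1r.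
Qed.

Lemma rank_exp_tr (A : 'M[k]_n) a p : \rank ((A^T - a%:M) ^+ p) = \rank ((A - a%:M) ^+ p).
Proof. by rewrite -[in RHS]mxrank_tr trmx_exp raddfB /= tr_scalar_mx. Qed.

(** Uniqueness of the Jordan form in the shape required: the number of boxes with a given eigenvalue
    and position is a difference of ranks of consecutive powers on either side, and transposition
    preserves these ranks. *)
Lemma label_perm (A : 'M[k]_n) lam e1 c1 e c t : jordan_data lam e1 ->
  columns e1 c1 -> columns e c -> Defs.similar A (jordan_mx lam e1) ->
  Defs.similar A^T (cmx e c t) ->
  exists s : 'S_n, forall i, lam i = t (c (s i)) /\ c1 i = rep t (lam i) 0 (c (s i)).
Proof.
move=> jd Hc1 Hc sA sT.
pose l1 (i : 'I_n) := (lam i, c1 i).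
pose l2 (i : 'I_n) := (t (c i), rep t (t (c i)) 0 (c i)).
have cnt y : #|[pred i | l1 i == y]| = #|[pred i | l2 i == y]|.
  case: y => a p.
  have r p' : #|[pred i | (lam i != a) || (p' <= c1 i)%N]| =
      #|[pred i | ~~ ((t (c i) == a) && (rep t a 0 (c i) < p')%N)]|.
    rewrite -(rank_jordan_exp Hc1 a p' jd) -(rank_cmx_exp Hc t) -(sim_rank_exp a p' sA).
    by rewrite -(sim_rank_exp a p' sT) rank_exp_tr.
  have h1 : #|[pred i | (lam i != a) || (p <= c1 i)%N]| =
      (#|[pred i | l1 i == (a, p)]| + #|[pred i | (lam i != a) || (p < c1 i)%N]|)%N.
    rewrite -cardUI [X in (_ + X)%N]eq_card0 ?addn0.
      by apply: eq_card => i; rewrite !inE xpair_eqE; case: eqP => //=; lia.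
    by move=> i; rewrite !inE xpair_eqE; case: eqP => //=; lia.
  have h2 : #|[pred i | ~~ ((t (c i) == a) && (rep t a 0 (c i) < p)%N)]| =
      (#|[pred i | l2 i == (a, p)]| + #|[pred i | ~~ ((t (c i) == a) && (rep t a 0 (c i) < p.+1)%N)]|)%N.
    rewrite -cardUI [X in (_ + X)%N]eq_card0 ?addn0.
      by apply: eq_card => i; rewrite !inE xpair_eqE; case: eqP => //= ->; lia.
    by move=> i; rewrite !inE xpair_eqE; case: eqP => //= ->; lia.
  by apply/eqP; rewrite -(eqn_add2r #|[pred i | (lam i != a) || (p < c1 i)%N]|) -h1 r h2 r.
have /tuple_permP [s sE] : perm_eq [tuple l1 i | i < n] [tuple l2 i | i < n].
  apply/allP => y _ /=; apply/eqP.
  have ctE (l : 'I_n -> k * nat) : count (pred1 y) [seq l i | i <- enum 'I_n] = #|[pred i | l i == y]|.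
    rewrite count_map cardE -size_filter; congr size.
    by rewrite /enum_mem -filter_predI; apply: eq_filter => i; rewrite /= !inE andbT.
  by rewrite !ctE cnt.
exists s => i.
have := congr1 (fun x => nth (0, 0%N) x i) sE.
rewrite -!tnth_nth !tnth_mktuple => [[-> ->]].
by [].
Qed.

End JordanAlgebra.

Section Degenerations.
Variables (k : closedFieldType) (n : nat) (A : 'M[k]_n).
Variables (e : 'I_n -> bool) (c : 'I_n -> nat) (t : nat -> k).
Hypothesis Hc : columns e c.
Hypothesis sT : Defs.similar A^T (cmx e c t).

Lemma upoly_conj (P Q : 'M[k]_n) (M : k -> 'M[k]_n) :
  (forall i j, upoly (fun s => M s i j)) ->
  forall i j, upoly (fun s => (P *m M s *m Q) i j).
Proof.
move=> Mp; apply: upoly_mulmx; last by move=> i j; apply: upolyC.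
by apply: upoly_mulmx => // i j; apply: upolyC.
Qed.

Lemma jordan_false_tr (lam : 'I_n -> k) :
  (jordan_mx lam (fun=> false))^T = jordan_mx lam (fun=> false).
Proof. by apply/matrixP => i j; rewrite !mxE !andbF eq_sym; case: eqP => // ->. Qed.

Lemma semisimple_columns (w : nat -> k) : (forall i j, (i < n)%N -> (j < n)%N -> w i = w j -> i = j) ->
  Defs.similar (cmx e c w)^T (jordan_mx (fun i => w (c i)) (fun=> false)).
Proof.
move=> winj; rewrite -jordan_false_tr; apply: sim_tr; apply: (jordan_diag Hc) => i j.
by apply: winj; apply: (col_lt Hc).
Qed.

(** Adding [s * w (c1 i)] to the eigenvalue at box [i] separates, for all but finitely many [s], the
    boxes that differ in eigenvalue or position. The perturbed matrix is then diagonalisable, and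
    its multiplicities are the column lengths because [label_perm] matches labels with columns. *)
Lemma closure_semisimple (w : nat -> k) B : (forall i j, (i < n)%N -> (j < n)%N -> w i = w j -> i = j) ->
  Dset A B -> tclosure (@mx_closed k n) (Dset (cmx e c w)^T) B.
Proof.
move=> winj [lam [e1 [jd [sA [sg [sgI [P [uP BE]]]]]]]].
have [c1 Hc1] := columns_ex e1.
have [pi piE] := label_perm jd Hc1 Hc sA sT.
pose v s i := sg (lam i) + s * w (c1 i).
pose M s := invmx P *m jordan_mx (v s) e1 *m P.
(* A product over pairs of distinct labels. Each factor is nonzero, because [sg] separates the
   eigenvalues of [A] and [w] the positions. *)
pose g : {poly k} := \prod_(x : 'I_n * 'I_n | (lam x.1, c1 x.1) != (lam x.2, c1 x.2))
  ((sg (lam x.1) - sg (lam x.2))%:P + (w (c1 x.1) - w (c1 x.2)) *: 'X).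
have -> : B = M 0.
  rewrite BE /M; congr (_ *m _ *m _); apply/matrixP => i j; rewrite !mxE.
  by rewrite /v mul0r addr0.
apply: (@closure_line _ _ _ M g).
- apply: upoly_conj => i j.
  apply: (@upoly_ext _ (fun s => v s i * (i == j)%:R + (lk e1 i j)%:R)).
    by move=> s; rewrite jordan_mxE.
  apply: upolyD; last exact: upolyC.
  apply: upolyM; last exact: upolyC.
  by apply: upolyD; [exact: upolyC|apply: upolyM; [exact: upolyX|exact: upolyC]].
- apply/prodf_neq0 => [[i j]] /=; rewrite xpair_eqE negb_and => ij.
  apply/negP => /eqP h; move: ij.
  have := congr1 (fun p : {poly k} => p`_0) h; have := congr1 (fun p : {poly k} => p`_1) h.
  rewrite !coefE /= mulr1 mulr0 add0r addr0 => /eqP; rewrite subr_eq0 => /eqP wE /eqP.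
  rewrite subr_eq0 => /eqP /sgI ->; rewrite eqxx /=.
  by rewrite (winj _ _ (col_lt Hc1 i) (col_lt Hc1 j) wE) eqxx.
move=> s; rewrite horner_prod => /prodf_neq0 gs.
have vI i j : v s i = v s j -> lam i = lam j /\ c1 i = c1 j.
  move=> vij; apply: NNPP => h.
  have ij : (lam i, c1 i) != (lam j, c1 j) by apply/eqP => [[h1 h2]]; apply: h.
  have := gs (i, j) ij; rewrite !hornerE /= => /negP; apply; rewrite mulrBl [w (c1 i) * s]mulrC [w (c1 j) * s]mulrC.
  by rewrite addrACA -opprD subr_eq0; apply/eqP.
pose lam0 x := w (c x).
pose vv x := v s (pi^-1%g x).
exists lam0, (fun=> false); split; first by [].
split; first exact: semisimple_columns.
have cE x y : c x = c y <-> (lam (pi^-1%g x) = lam (pi^-1%g y) /\ c1 (pi^-1%g x) = c1 (pi^-1%g y)).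
  have [] := piE (pi^-1%g x); have [] := piE (pi^-1%g y); rewrite !permKV.
  move=> l2 r2 l1 r1; split=> [cxy|[lxy cxy]].
    have ll : lam (pi^-1%g x) = lam (pi^-1%g y) by rewrite l1 l2 cxy.
    by rewrite r1 r2 ll cxy.
  apply: (@rep_inj _ t); first by rewrite -l1 -l2.
  by rewrite -l1 -l2 -r1 -r2.
(* The relabelling must be defined on all scalars; 0 is the default off the values [w (c x)]. *)
pose sg' z := if [pick x | lam0 x == z] is Some x then vv x else 0.
have sgE x : sg' (lam0 x) = vv x.
  rewrite /sg'; case: pickP => [y /eqP yx|/(_ x)]; last by rewrite eqxx.
  have /cE [h1 h2] : c y = c x by apply: winj yx; apply: (col_lt Hc).
  by rewrite /vv /v h1 h2.
exists sg'; split=> [x y|].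
  by rewrite !sgE => /vI h; rewrite /lam0; congr (w _); apply/cE.
have -> : jordan_mx (fun i => sg' (lam0 i)) (fun=> false) = jordan_mx (fun x => v s (pi^-1%g x)) (fun=> false).
  by apply/matrixP => i j; rewrite !mxE sgE.
apply: sim_trans (sim_sym (diag_perm _ _)).
apply: sim_trans (jordan_diag Hc1 (fun i j vij => (vI i j vij).2)).
by exists P.
Qed.

Lemma nilpotent_columns lam e0 :
  Defs.similar (cmx e c (fun=> 0 : k))^T (jordan_mx lam e0) -> jordan_data lam e0 ->
  forall i, lam i = 0.
Proof.
move=> sN jd i; have [c0 Hc0] := columns_ex e0.
have := rank_jordan_exp Hc0 0 n jd; rewrite -(sim_rank_exp 0 n sN) rank_exp_tr.
rewrite (rank_cmx_exp Hc) eq_card0 => [/esym h|j]; last first.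
  rewrite !inE eqxx /= (leq_ltn_trans (count_size _ _)) //.
  by rewrite size_iota subn0 (col_lt Hc).
by have := card0_eq h i; rewrite !inE => /norP [] /negbNE /eqP.
Qed.

(** [B] is similar to a scalar plus the nilpotent matrix. Replacing the zero diagonal by the values
    s t_m gives, for nonzero [s], a matrix similar to a scalar plus [s] times [A], which relabels
    the eigenvalues of [A] by an affine bijection. *)
Lemma closure_equipotent B :
  Dset (cmx e c (fun=> 0 : k))^T B -> tclosure (@mx_closed k n) (Dset A) B.
Proof.
move=> [lam [e0 [jd [sN [sg [_ sB]]]]]].
have lam0 := nilpotent_columns sN jd.
set N := (cmx e c _)^T in sN.
have [Q [uQ BE]] : Defs.similar B ((sg 0)%:M + 1 *: N).
  apply: sim_trans (sim_affine (sg 0) 1 (sim_sym sN)); rewrite scale1r -jordan_shift.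
  rewrite (_ : jordan_mx (fun i => _ + lam i) _ = jordan_mx (fun i => sg (lam i)) e0) //.
  by apply/matrixP => i j; rewrite !mxE lam0 addr0.
pose M s := invmx Q *m ((sg 0)%:M + (cmx e c (fun m => s * t m))^T) *m Q.
have -> : B = M 0.
  rewrite BE scale1r /M /N; congr (_ *m (_ + _^T) *m _).
  by apply/matrixP => i j; rewrite !mxE mul0r.
apply: (@closure_line _ _ _ M 'X).
- apply: upoly_conj => i j.
  apply: (@upoly_ext _ (fun s => ((sg 0)%:M : 'M[k]_n) i j + (s * t (c j) * (j == i)%:R + (lk e j i)%:R))).
    by move=> s; rewrite [RHS]mxE; congr (_ + _); rewrite mxE jordan_mxE.
  apply: upolyD; first exact: upolyC.
  apply: upolyD; last exact: upolyC.
  apply: upolyM; last exact: upolyC.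
  by apply: upolyM; [exact: upolyX|exact: upolyC].
- by rewrite polyX_eq0.
move=> s; rewrite hornerX => s0.
have [lamA [eA [jdA sA]]] := jordan_form A.
exists lamA, eA; split=> //; split=> //; exists (fun z => sg 0 + s * z); split.
  by move=> i j /addrI /(mulfI s0).
rewrite jordan_shift.
apply: (@sim_trans _ _ _ ((sg 0)%:M + (cmx e c (fun m => s * t m))^T)); first by exists Q.
have aff X Y : Defs.similar X Y -> Defs.similar ((sg 0)%:M + X) ((sg 0)%:M + Y).
  by move=> /(sim_affine (sg 0) 1); rewrite !scale1r.
apply: aff.
have sc : Defs.similar (cmx e c (fun m => s * t m))^T (s *: (cmx e c t)^T).
  by rewrite -linearZ /=; apply: sim_tr; apply: (jordan_scale (fun i => t (c i))).
apply: sim_trans sc _.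
apply: sim_trans (sim_sym (jordan_scale lamA eA s0)).
have := sim_affine 0 s (sim_trans (sim_sym (sim_tr sT)) _); rewrite trmxK => /(_ _ sA).
by rewrite (_ : 0%:M = 0 :> 'M[k]_n) ?add0r //; apply/matrixP => i j; rewrite !mxE mul0rn.
Qed.

End Degenerations.

Theorem theorem1p1 (k : closedFieldType) (n : nat) (A : 'M[k]_n) :
  exists S N : 'M[k]_n,
    semisimple S /\ equipotent N /\
    (forall B, Dset A B -> tclosure (@mx_closed k n) (Dset S) B) /\
    (forall B, Dset N B -> tclosure (@mx_closed k n) (Dset A) B) /\
    cent_dim A = cent_dim S /\ cent_dim S = cent_dim N /\
    (forall d : nat, (1 <= d < n)%N ->
       exists m : nat,
         krull_dim (@grass_closed k n d) (grass_fix d A) m /\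
         krull_dim (@grass_closed k n d) (grass_fix d S) m /\
         krull_dim (@grass_closed k n d) (grass_fix d N) m).
Proof.
(* [grass_fix] lets [A^T] act on row spaces, so the normal form is taken for the transpose. *)
have [e [c [t [Hc sT]]]] := uniform_form A^T.
have [w winj] := closed_injection k n.
exists (cmx e c w)^T, (cmx e c (fun=> 0))^T.
split.
  have [P [uP ->]] := semisimple_columns Hc winj.
  exists P, (\row_i w (c i)); split=> //; congr (_ *m _ *m _).
  by apply/matrixP => i j; rewrite !mxE andbF; case: eqP.
split.
  exists 0 => a; rewrite eigenvalue_root_char char_poly_trig; last first.
    apply/is_trig_mxP => i j ij; rewrite !mxE -val_eqE /= gtn_eqF //.
    by rewrite (_ : (i : nat) == j.+1 = false) //; lia.
  rewrite /root horner_prod => /eqP /eqP /prodf_eq0 [i _].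
  by rewrite !hornerE !mxE eqxx subr0 => /eqP.
split; first by move=> B; apply: closure_semisimple sT _ _ winj.
split; first by move=> B; apply: closure_equipotent sT _.
split.
  by rewrite -cent_dim_tr (cent_dim_sim sT) cent_dim_tr; apply: cent_dim_columns.
split; first by rewrite !cent_dim_tr; apply: cent_dim_columns.
move=> d dn; have [m mE] := fixed_dimension Hc dn; exists m.
have K Z tt : Defs.similar Z^T (cmx e c tt) -> krull_dim (@grass_closed k n d) (grass_fix d Z) m.
  by move=> [P [uP ZE]]; have := mE k tt P uP; rewrite /fixed -ZE.
split; first exact: K sT.
by split; apply: K; rewrite trmxK; apply: sim_refl.
Qed.
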